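(* Let $\Omega_0,T_0\ge2$ and $\varepsilon_T,\varepsilon_\Omega>0$. Let $f\in L^2(\mathbb R)$ satisfy $$\int_{|t|>T_0}|f(t)|^2\,dt\le\varepsilon_T^2\|f\|_{L^2(\mathbb R)}^2\qquad\text{and}\qquad\int_{|\omega|>\Omega_0}|\hat f(\omega)|^2\,d\omega\le\varepsilon_\Omega^2\|f\|_{L^2(\mathbb R)}^2.$$ For an integer $n$, let $K_nf=\sum_{k=0}^n\langle f,h_k\rangle h_k$ be the orthogonal projection of $f$ onto $\mathrm{span}(h_0,\dots,h_n)$. Let $T\ge T_0$ and assume $n\ge\max(2T^2,2\Omega_0^2)$. Then $$\|f-K_nf\|_{L^2([-T,T])}\le\left(2\varepsilon_T+\varepsilon_\Omega+\frac{34T^3}{\sqrt{2n+1}}\right)\|f\|_{L^2(\mathbb R)}.$$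
   Context: For an integer $n\ge0$, $H_n(x)=(-1)^n e^{x^2}\frac{d^n}{dx^n}e^{-x^2}$ is the $n$-th Hermite polynomial and $h_n(x)=\frac{1}{\pi^{1/4}\sqrt{2^n n!}}H_n(x)e^{-x^2/2}$ is the $n$-th Hermite function; $(h_n)_{n\ge0}$ is an orthonormal basis of $L^2(\mathbb R)$. The Fourier transform is normalized as $\hat f(\omega)=\frac{1}{\sqrt{2\pi}}\int_{\mathbb R}f(t)e^{-it\omega}\,dt$ for $f\in L^1(\mathbb R)$, extended to a unitary operator on $L^2(\mathbb R)$. *)

(* Defs.v *)
From HB Require Import structures.
From mathcomp Require Import all_boot all_order all_algebra.
From mathcomp Require Import all_classical all_reals all_analysis.
Set Implicit Arguments. Unset Strict Implicit. Unset Printing Implicit Defensive.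
Import Order.TTheory GRing.Theory Num.Theory.
Import numFieldNormedType.Exports.
Local Open Scope classical_set_scope.
Local Open Scope ring_scope.

(* A complex-valued function f : R -> C is represented by the pair (fr, fi)
   of its real and imaginary parts: f = fr + i fi. *)

Section HermiteL2.
Context {R : realType}.
Local Notation mu := (@lebesgue_measure R).

Definition gauss (x : R) : R := expR (- x ^+ 2).

Definition hermiteH (n : nat) (x : R) : R :=
  (-1) ^+ n * expR (x ^+ 2) * derive1n n gauss x.

Definition hermite_fun (n : nat) (x : R) : R :=
  (Num.sqrt (Num.sqrt pi) * Num.sqrt (2 ^+ n * (n`!)%:R))^-1
  * hermiteH n x * expR (- (x ^+ 2) / 2).

Definition sqnorm (D : set R) (fr fi : R -> R) : \bar R :=
  (\int[mu]_(x in D) ((fr x) ^+ 2 + (fi x) ^+ 2)%:E)%E.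

Definition L2norm (D : set R) (fr fi : R -> R) : R :=
  Num.sqrt (fine (sqnorm D fr fi)).

Definition inL2 (fr fi : R -> R) : Prop :=
  [/\ measurable_fun setT fr, measurable_fun setT fi
    & (sqnorm setT fr fi < +oo)%E].

(* Real and imaginary parts of the truncated Fourier integral
   (1/sqrt(2 pi)) \int_{-r}^{r} f(t) e^{-i t w} dt *)
Definition trunc_FT_re (fr fi : R -> R) (r w : R) : R :=
  (Num.sqrt (2 * pi))^-1 *
  Rintegral mu [set t | `|t| <= r] (fun t => fr t * cos (t * w) + fi t * sin (t * w)).
Definition trunc_FT_im (fr fi : R -> R) (r w : R) : R :=
  (Num.sqrt (2 * pi))^-1 *
  Rintegral mu [set t | `|t| <= r] (fun t => fi t * cos (t * w) - fr t * sin (t * w)).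

Definition is_L2_fourier (fr fi gr gi : R -> R) : Prop :=
  [/\ measurable_fun setT gr, measurable_fun setT gi &
    (fun r : R => sqnorm setT (fun w => gr w - trunc_FT_re fr fi r w)
                              (fun w => gi w - trunc_FT_im fr fi r w))
      @ +oo --> 0%E].

(* <f, h_k> = \int f(t) h_k(t) dt  (h_k is real), real and imaginary parts *)
Definition hcoef (fr : R -> R) (k : nat) : R :=
  Rintegral mu setT (fun t => fr t * hermite_fun k t).

(* K_n f = \sum_{k=0}^n <f, h_k> h_k, componentwise *)
Definition Kproj (n : nat) (fr : R -> R) (x : R) : R :=
  \sum_(k < n.+1) hcoef fr k * hermite_fun k x.

End HermiteL2.

(* Main.v *)
(* If 34 T^3 >= sqrt (2n+1), the claim is Bessel's inequality. Otherwise split f = f1 + f2 with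
   f1 = f on [-T, T]. On [-T, T], f - K_n f = (f1 - K_n f1) - K_n f2, and |K_n f2| <= |f2| <=
   eps_T |f|. By completeness, |f1 - K_n f1|^2 is the sum of |<f1, h_k>|^2 over k > n, and up
   to a unimodular factor <f1, h_k> = <U, h_k> for U the transform of f1. The part of U at
   frequencies above Omega0 contributes at most (eps_Omega + eps_T) |f|. For the rest, multiply
   U by a smooth cutoff m equal to 1 for w^2 <= n/2 and to 0 for w^2 >= n; as h_k'' = (w^2 -
   (2k+1)) h_k and 2k+1 - w^2 >= k on the support of m, two integrations by parts give <m U,
   h_k> = - <(m U / (2k+1 - w^2))'', h_k> = O(T^2 / k) |f1|, because U' and U'' are the
   transforms of t f1 and t^2 f1; summing squares over k > n gives O(T^2 / sqrt n). All of this
   is done for real functions with the Hartley transform (kernel cos + sin), under which the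
   two real components of f decouple. *)
Require Import Defs.
From HB Require Import structures.
From mathcomp Require Import all_boot all_order all_algebra.
From mathcomp Require Import all_classical all_reals all_analysis.
From mathcomp Require Import measurable_realfun ring lra.
Set Implicit Arguments. Unset Strict Implicit. Unset Printing Implicit Defensive.
Import Order.TTheory GRing.Theory Num.Theory.
Import numFieldNormedType.Exports.
Local Open Scope classical_set_scope.
Local Open Scope ring_scope.

(** * The space L2 *)

(** The Fourier eigenvalue of h_k is (-i)^k, whereas its Hartley eigenvalue is 1 or -1; this keeps
    every estimate real, and the complex statement is recovered by Minkowski's inequality in the
    plane, without loss in the constants. Truncation to [-T, T] is what makes the transform
    differentiable, each derivative costing a factor T. Completeness is obtained as follows. A
    function e orthogonal to all h_k is orthogonal to every polynomial times exp(- x^2 / 2) and, by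
    the exponential series, to these times any power of a translated Gaussian. Polynomials in that
    Gaussian converge to indicators of small balls, so the means of e exp(- x^2 / 2) over such balls
    vanish, and Lebesgue differentiation gives e = 0 almost everywhere. Riesz-Fischer turns this
    into Parseval's identity. The cases are separated at n = 576 T^6. Above it, sqrt n >= 24 T^3
    makes the derivatives of the cutoff negligible against T^2; below it, 34^2 = 1156 exceeds 2 *
    576 by enough to absorb the 1 in 2n + 1. *)

Section L2.
Context {R : realType}.
Local Notation mu := (@lebesgue_measure R).
Implicit Types (f g h : R -> R) (D : set R).

Definition integ f := mu.-integrable setT (EFin \o f).
Definition L2 f := measurable_fun setT f /\ integ (fun x => f x ^+ 2).
Definition ip f g := \int[mu]_x (f x * g x).
Definition nrm f := Num.sqrt (ip f f).

Lemma integ_measurable f : integ f -> measurable_fun setT f.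
Proof. by move=> /(measurable_int mu)/measurable_EFinP. Qed.

Lemma integ_le f g : measurable_fun setT f -> integ g ->
  (forall x, `|f x| <= g x) -> integ f.
Proof.
move=> mf ig fg; apply: (le_integrable measurableT _ _ ig).
  exact/measurable_EFinP.
by move=> x _ /=; rewrite lee_fin (le_trans (fg x))// ler_norm.
Qed.

Lemma integD f g : integ f -> integ g -> integ (fun x => f x + g x).
Proof. by move=> hf hg; apply: (integrableD measurableT hf hg). Qed.

Lemma integZ c f : integ f -> integ (fun x => c * f x).
Proof. by move=> hf; apply: (integrableZl measurableT c hf). Qed.

Lemma integN f : integ f -> integ (fun x => - f x).
Proof. by move=> hf; apply: (integrableN hf). Qed.

Lemma integB f g : integ f -> integ g -> integ (fun x => f x - g x).
Proof. by move=> hf hg; apply/integD/integN. Qed.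

Lemma integ_norm f : integ f -> integ (fun x => `|f x|).
Proof. exact: integrable_norm. Qed.

Lemma integ_sum I (r : seq I) (F : I -> R -> R) :
  (forall i, integ (F i)) -> integ (fun x => \sum_(i <- r) F i x).
Proof.
move=> hF; elim: r => [|i r ih].
  rewrite (_ : (fun _ => _) = cst 0); last by apply/funext => x; rewrite big_nil.
  exact: integrable0.
rewrite (_ : (fun _ => _) = (fun x => F i x + \sum_(j <- r) F j x)).
  exact: integD.
by apply/funext => x; rewrite big_cons.
Qed.

Lemma measurable_L2 f : L2 f -> measurable_fun setT f.
Proof. by case. Qed.

Lemma L2_mul f g : L2 f -> L2 g -> integ (fun x => f x * g x).
Proof.
move=> [mf f2] [mg g2].
apply: (@integ_le _ (fun x => f x ^+ 2 + g x ^+ 2)); first exact: measurable_funM.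
  exact: integD.
move=> x; rewrite ler_norml; apply/andP; split.
  rewrite -subr_ge0 (_ : _ - _ = 2^-1 * (f x ^+ 2 + g x ^+ 2 + (f x + g x) ^+ 2)); last by field.
  by rewrite mulr_ge0// addr_ge0 ?sqr_ge0// addr_ge0 ?sqr_ge0.
rewrite -subr_ge0 (_ : _ - _ = 2^-1 * (f x ^+ 2 + g x ^+ 2 + (f x - g x) ^+ 2)); last by field.
by rewrite mulr_ge0// addr_ge0 ?sqr_ge0// addr_ge0 ?sqr_ge0.
Qed.

Lemma L2Z c f : L2 f -> L2 (fun x => c * f x).
Proof.
move=> [mf f2]; split; first exact: measurable_funM.
rewrite (_ : (fun _ => _) = (fun x => c ^+ 2 * f x ^+ 2)); first exact: integZ.
by apply/funext => x; rewrite exprMn.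
Qed.

Lemma L2N f : L2 f -> L2 (fun x => - f x).
Proof.
move=> hf; rewrite (_ : (fun _ => _) = (fun x => -1 * f x)); first exact: L2Z.
by apply/funext => x; rewrite mulN1r.
Qed.

Lemma L2D f g : L2 f -> L2 g -> L2 (fun x => f x + g x).
Proof.
move=> hf hg; split; first exact: measurable_funD (measurable_L2 hf) (measurable_L2 hg).
rewrite (_ : (fun _ => _) = (fun x => f x ^+ 2 + 2 * (f x * g x) + g x ^+ 2)).
  by apply: integD; [apply: integD; [apply hf.2|exact/integZ/L2_mul]|apply hg.2].
by apply/funext => x; ring.
Qed.

Lemma L2B f g : L2 f -> L2 g -> L2 (fun x => f x - g x).
Proof. by move=> hf hg; apply/L2D/L2N. Qed.

Lemma L20 : L2 (fun=> 0).
Proof.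
split; first exact: measurable_cst.
rewrite (_ : (fun _ => _) = cst 0); first exact: integrable0.
by apply/funext => x; rewrite expr0n.
Qed.

Lemma L2_sum I (r : seq I) (F : I -> R -> R) :
  (forall i, L2 (F i)) -> L2 (fun x => \sum_(i <- r) F i x).
Proof.
move=> hF; elim: r => [|i r ih].
  rewrite (_ : (fun _ => _) = cst 0); last by apply/funext => x; rewrite big_nil.
  exact: L20.
rewrite (_ : (fun _ => _) = (fun x => F i x + \sum_(j <- r) F j x)).
  exact: L2D.
by apply/funext => x; rewrite big_cons.
Qed.

Lemma L2_le C f g : measurable_fun setT f -> L2 g ->
  (forall x, `|f x| <= C * `|g x|) -> L2 f.
Proof.
move=> mf [mg g2] fg; split => //.
apply: (@integ_le _ (fun x => C ^+ 2 * g x ^+ 2)); [exact: measurable_funX|exact: integZ|].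
move=> x; rewrite ger0_norm ?sqr_ge0// -[leLHS]real_normK ?num_real//.
rewrite -[g x ^+ 2]real_normK ?num_real// -exprMn.
by rewrite ler_sqr ?nnegrE// (le_trans _ (fg x)).
Qed.

Lemma L2_mul_bounded C f g : measurable_fun setT f -> L2 g ->
  (forall x, `|f x| <= C) -> L2 (fun x => f x * g x).
Proof.
move=> mf hg fC; apply: (@L2_le C _ g) => //.
  exact: measurable_funM mf (measurable_L2 hg).
by move=> x; rewrite normrM ler_wpM2r.
Qed.

Lemma L2_indic D f : measurable D -> L2 f -> L2 (fun x => \1_D x * f x).
Proof.
move=> mD hf; apply: (@L2_mul_bounded 1) => //.
by move=> x; rewrite indicE; case: (_ \in _); rewrite ?normr1 ?normr0.
Qed.

Lemma ipC f g : ip f g = ip g f.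
Proof. by rewrite /ip; under eq_Rintegral do rewrite mulrC. Qed.

Lemma ipDl f g h : L2 f -> L2 g -> L2 h ->
  ip (fun x => f x + g x) h = ip f h + ip g h.
Proof.
move=> hf hg hh; rewrite /ip; under eq_Rintegral do rewrite mulrDl.
by rewrite RintegralD//; exact: L2_mul.
Qed.

Lemma ipZl c f g : L2 f -> L2 g -> ip (fun x => c * f x) g = c * ip f g.
Proof.
move=> hf hg; rewrite /ip; under eq_Rintegral do rewrite -mulrA.
by rewrite RintegralZl//; exact: L2_mul.
Qed.

Lemma ipBl f g h : L2 f -> L2 g -> L2 h ->
  ip (fun x => f x - g x) h = ip f h - ip g h.
Proof.
move=> hf hg hh; rewrite /ip; under eq_Rintegral do rewrite mulrBl.
by rewrite RintegralB//; exact: L2_mul.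
Qed.

Lemma ipDr f g h : L2 f -> L2 g -> L2 h ->
  ip h (fun x => f x + g x) = ip h f + ip h g.
Proof. by move=> hf hg hh; rewrite ipC ipDl// !(ipC h). Qed.

Lemma ipBr f g h : L2 f -> L2 g -> L2 h ->
  ip h (fun x => f x - g x) = ip h f - ip h g.
Proof. by move=> hf hg hh; rewrite ipC ipBl// !(ipC h). Qed.

Lemma ipZr c f g : L2 f -> L2 g -> ip f (fun x => c * g x) = c * ip f g.
Proof. by move=> hf hg; rewrite ipC ipZl// ipC. Qed.

Lemma ip_suml I (r : seq I) (F : I -> R -> R) h : (forall i, L2 (F i)) -> L2 h ->
  ip (fun x => \sum_(i <- r) F i x) h = \sum_(i <- r) ip (F i) h.
Proof.
move=> hF hh; elim: r => [|i r ih].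
  rewrite big_nil /ip; under eq_Rintegral do rewrite big_nil mul0r.
  by rewrite Rintegral_cst// mul0r.
rewrite big_cons -ih -ipDl//; last exact: L2_sum.
by congr ip; apply/funext => x; rewrite big_cons.
Qed.

Lemma ip_ge0 f : 0 <= ip f f.
Proof. by apply: Rintegral_ge0 => x _; rewrite -expr2 sqr_ge0. Qed.

Lemma nrm_ge0 f : 0 <= nrm f. Proof. exact: sqrtr_ge0. Qed.

Lemma sqr_nrm f : nrm f ^+ 2 = ip f f.
Proof. by rewrite sqr_sqrtr// ip_ge0. Qed.

Lemma ip_norm_le f g : L2 f -> L2 g -> `|ip f g| <= nrm f * nrm g.
Proof.
move=> hf hg.
have key t : 0 <= ip f f + 2 * t * ip f g + t ^+ 2 * ip g g.
  have hz : L2 (fun x => t * g x) by exact: L2Z.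
  have := ip_ge0 (fun x => f x + t * g x).
  rewrite ipDl//; last exact: L2D.
  rewrite !ipDr// !ipZl// !ipZr// (ipC g f).
  by congr (_ <= _); ring.
rewrite -(@ler_pXn2r _ 2) ?nnegrE// ?mulr_ge0 ?nrm_ge0//.
rewrite real_normK ?num_real// exprMn !sqr_nrm.
have [g0|g0] := eqVneq (ip g g) 0.
  rewrite g0 mulr0.
  have [->|fg0] := eqVneq (ip f g) 0; first by rewrite expr0n.
  (* The quadratic in [t] has degenerated to an affine function, and this [t] gives it the value
     -1. *)
  have := key (- (ip f f + 1) / (2 * ip f g)); rewrite g0 mulr0 addr0.
  rewrite (_ : 2 * _ * _ = - (ip f f + 1)); last by field.
  by rewrite opprD addrA subrr sub0r oppr_ge0 ler10.
have gp : 0 < ip g g by rewrite lt_neqAle eq_sym g0 ip_ge0.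
have := key (- ip f g / ip g g).
rewrite (_ : _ + _ + _ = (ip f f * ip g g - ip f g ^+ 2) / ip g g); last by field.
by rewrite pmulr_lge0 ?invr_gt0// subr_ge0.
Qed.

Lemma nrmD f g : L2 f -> L2 g -> nrm (fun x => f x + g x) <= nrm f + nrm g.
Proof.
move=> hf hg.
rewrite -(@ler_pXn2r _ 2) ?nnegrE ?addr_ge0 ?nrm_ge0//.
rewrite sqrrD !sqr_nrm ipDl//; last exact: L2D.
rewrite !ipDr// (ipC g f) (_ : _ + _ + (_ + _) = ip f f + ip f g *+ 2 + ip g g); last by ring.
rewrite lerD2r lerD2l lerMn2r/=; apply: le_trans (ip_norm_le hf hg).
exact: ler_norm.
Qed.

Lemma nrmZ c f : L2 f -> nrm (fun x => c * f x) = `|c| * nrm f.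
Proof.
move=> hf; rewrite /nrm ipZl//; last exact: L2Z.
rewrite ipC ipZl// mulrA -expr2 sqrtrM ?sqr_ge0// sqrtr_sqr//.
Qed.

Lemma nrmN f : nrm (fun x => - f x) = nrm f.
Proof. by rewrite /nrm /ip; under eq_Rintegral do rewrite mulrNN. Qed.

Lemma nrmB f g : L2 f -> L2 g -> nrm (fun x => f x - g x) <= nrm f + nrm g.
Proof. by move=> hf hg; rewrite -[nrm g]nrmN nrmD//; exact: L2N. Qed.

Lemma nrm_le f g : L2 f -> L2 g -> (forall x, `|f x| <= `|g x|) -> nrm f <= nrm g.
Proof.
move=> hf hg fg; apply: ler_wsqrtr; apply: le_Rintegral => //; [exact: L2_mul..|].
move=> x _; rewrite -!expr2 -[leLHS]real_normK ?num_real//.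
by rewrite -[leRHS]real_normK ?num_real// ler_sqr ?nnegrE.
Qed.

(** With [N := n.+1] and [e := hermite_fun] this unfolds to [Kproj n], so that facts about
    orthonormal families apply to it by conversion. *)
Definition fproj (N : nat) (e : nat -> R -> R) f := fun x => \sum_(k < N) ip f (e k) * e k x.

Definition is_orthonormal (N : nat) (e : nat -> R -> R) := (forall k, L2 (e k)) /\
  forall i j : 'I_N, ip (e i) (e j) = (i == j)%:R.

Lemma L2_fproj N e f : is_orthonormal N e -> L2 (fproj N e f).
Proof. by move=> -[he _]; apply: L2_sum => i; exact: L2Z. Qed.

Lemma ip_fproj N e f (j : 'I_N) : is_orthonormal N e -> ip (fproj N e f) (e j) = ip f (e j).
Proof.
move=> [he oe]; rewrite /fproj ip_suml//; last by move=> i; exact: L2Z.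
rewrite (bigD1 j)//= ipZl// oe eqxx mulr1 big1 ?addr0// => i ij.
by rewrite ipZl// oe (negbTE ij) mulr0.
Qed.

Lemma nrm_fproj N e f : is_orthonormal N e ->
  ip (fproj N e f) (fproj N e f) = \sum_(k < N) ip f (e k) ^+ 2.
Proof.
move=> oe; have [he _] := oe.
rewrite {1}/fproj ip_suml//; [|by move=> i; exact: L2Z|exact: L2_fproj].
apply: eq_bigr => i _; rewrite ipZl//; last exact: L2_fproj.
by rewrite (ipC (e i)) ip_fproj// expr2.
Qed.

Lemma nrm_sub_fproj N e f : is_orthonormal N e -> L2 f ->
  ip (fun x => f x - fproj N e f x) (fun x => f x - fproj N e f x) =
  ip f f - \sum_(k < N) ip f (e k) ^+ 2.
Proof.
move=> oe hf; have [he _] := oe; have hp := L2_fproj f oe.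
have ipp : ip (fproj N e f) f = \sum_(k < N) ip f (e k) ^+ 2.
  rewrite /fproj ip_suml//; last by move=> i; exact: L2Z.
  by apply: eq_bigr => i _; rewrite ipZl// ipC expr2.
rewrite ipBl//; last exact: L2B.
by rewrite !ipBr// ipp (ipC f) ipp nrm_fproj// subrr subr0.
Qed.

Lemma bessel N e f : is_orthonormal N e -> L2 f ->
  \sum_(k < N) ip f (e k) ^+ 2 <= ip f f.
Proof. by move=> oe hf; rewrite -subr_ge0 -nrm_sub_fproj// ip_ge0. Qed.

Lemma nrm_fproj_le N e f : is_orthonormal N e -> L2 f -> nrm (fproj N e f) <= nrm f.
Proof. by move=> oe hf; rewrite ler_wsqrtr// nrm_fproj// bessel. Qed.

Lemma nrm_sub_fproj_le N e f : is_orthonormal N e -> L2 f ->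
  nrm (fun x => f x - fproj N e f x) <= nrm f.
Proof.
move=> oe hf; rewrite ler_wsqrtr// nrm_sub_fproj// lerBlDr lerDl.
by apply: sumr_ge0 => i _; exact: sqr_ge0.
Qed.

End L2.

(** * Invariance of Lebesgue measure under translation and reflection *)

Section Invariance.
Context {R : realType}.
Local Notation mu := (@lebesgue_measure R).

(** A measure agreeing with [mu] on half-open intervals is [mu], so only the lengths of translated
    intervals are compared. *)
Lemma lebesgue_measure_shift (c : R) (A : set R) : measurable A ->
  mu A = pushforward mu (fun x => x + c) A.
Proof.
move=> mA.
have mc : measurable_fun setT (fun x : measurableTypeR R => (x + c : measurableTypeR R)).
  by apply: measurable_funD.
apply: (@lebesgue_measure_unique R (pushforward mu (fun x : measurableTypeR R => (x + c : measurableTypeR R)) : {measure set _ -> \bar R})) => //.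
move=> X /ocitvP[->|[[a b] /= ab ->]]; first by rewrite !measure0.
rewrite /pushforward /= (_ : _ @^-1` _ = `]a - c, b - c]%classic); last first.
  by apply/seteqP; split => x /=; rewrite !in_itv/= ltrBlDr lerBrDr.
rewrite !lebesgue_measure_itv/= !lte_fin ltrD2r; case: ifPn => // _.
by rewrite -!EFinB; congr (_%:E); ring.
Qed.

Lemma lebesgue_measureN (A : set R) : measurable A ->
  mu A = pushforward mu (fun x => - x) A.
Proof.
move=> mA.
have mc : measurable_fun setT (fun x : measurableTypeR R => (- x : measurableTypeR R)).
  exact: oppr_measurable.
apply: (@lebesgue_measure_unique R (pushforward mu (fun x : measurableTypeR R => (- x : measurableTypeR R)) : {measure set _ -> \bar R})) => //.
move=> X /ocitvP[->|[[a b] /= ab ->]]; first by rewrite !measure0.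
rewrite /pushforward /= (_ : _ @^-1` _ = `[- b, - a[%classic); last first.
  by apply/seteqP; split => x /=; rewrite !in_itv/= lerNl ltrNr andbC.
rewrite !lebesgue_measure_itv/= !lte_fin ltrN2; case: ifPn => // _.
by rewrite -!EFinB; congr (_%:E); ring.
Qed.

Lemma integral_shift (c : R) (D : set R) (f : R -> \bar R) : measurable D ->
  measurable_fun D f -> {in D, forall x, 0 <= f x}%E ->
  (\int[mu]_(x in D) f x = \int[mu]_(x in (fun x => x + c)%R @^-1` D) f (x + c)%R)%E.
Proof.
move=> mD mf f0.
have mc : measurable_fun setT (fun x : measurableTypeR R => (x + c : measurableTypeR R)).
  by apply: measurable_funD.
rewrite -(ge0_integral_pushforward mc mu)//.
by apply: eq_measure_integral => A mA _; exact: lebesgue_measure_shift.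
Qed.

Lemma integral_reflect (D : set R) (f : R -> \bar R) : measurable D ->
  measurable_fun D f -> {in D, forall x, 0 <= f x}%E ->
  (\int[mu]_(x in D) f x = \int[mu]_(x in (fun x => - x)%R @^-1` D) f (- x)%R)%E.
Proof.
move=> mD mf f0.
have mc : measurable_fun setT (fun x : measurableTypeR R => (- x : measurableTypeR R)).
  exact: oppr_measurable.
rewrite -(ge0_integral_pushforward mc mu)//.
by apply: eq_measure_integral => A mA _; exact: lebesgue_measureN.
Qed.
End Invariance.

(** * Riesz-Fischer theorem *)
Section RieszFischer.
Context {R : realType}.
Local Notation mu := (@lebesgue_measure R).

Local Notation ae_filterS := (@filterS _ _ (ae_filter_ringOfSetsType mu) _ _).

Lemma cvgn_le (u : nat -> R) (l M : R) : u @ \oo --> l -> (forall n, u n <= M) ->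
  l <= M.
Proof.
move=> ul uM; rewrite -(cvg_lim _ ul)//.
by apply: limr_le; [apply/cvg_ex; exists l|exact: nearW].
Qed.

Lemma DCT_ae (f_ : nat -> R -> R) (f g : R -> R) :
  (forall n, measurable_fun setT (f_ n)) -> measurable_fun setT f -> integ g ->
  {ae mu, forall x, f_ ^~ x @ \oo --> f x} ->
  {ae mu, forall x, forall n, `|f_ n x| <= g x} ->
  integ f /\ \int[mu]_x f_ n x @[n --> \oo] --> \int[mu]_x f x.
Proof.
move=> mf_ mf ig cf bf.
have [|||||i _ c] := @dominated_convergence _ _ R mu setT measurableT
  (fun n => EFin \o f_ n) (EFin \o f) (EFin \o g).
- by move=> n; apply/measurable_EFinP; exact: mf_.
- by apply/measurable_EFinP; exact: mf.
- by apply: (ae_filterS _ cf) => x h _; apply: cvg_EFin => //; exact: nearW.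
- exact: ig.
- by apply: (ae_filterS _ bf) => x h n _ /=; rewrite lee_fin.
split; first exact: i.
apply: fine_cvg; rewrite fineK; last exact: integrable_fin_num i.
exact: c.
Qed.

Lemma DCT (f_ : nat -> R -> R) (f g : R -> R) :
  (forall n, measurable_fun setT (f_ n)) -> integ g ->
  (forall x, f_ ^~ x @ \oo --> f x) ->
  (forall x n, `|f_ n x| <= g x) ->
  integ f /\ \int[mu]_x f_ n x @[n --> \oo] --> \int[mu]_x f x.
Proof.
move=> mf_ ig cf bf; apply: (@DCT_ae f_ f g) => //.
- by apply: (@measurable_fun_cvg _ _ _ _ f_) => // x _.
- exact: aeW.
- exact: aeW.
Qed.

Lemma Rintegral_EFin (f : R -> R) : integ f ->
  (\int[mu]_x (f x)%:E)%E = (\int[mu]_x f x)%:E.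
Proof. by move=> hf; rewrite /Rintegral fineK//; exact: integrable_fin_num hf. Qed.

(** With such gaps, the partial sums of [|e n.+1 - e n|] have norm at most 2. By monotone
    convergence their squares have an integrable limit; it is finite almost everywhere, forces
    absolute convergence there, and dominates [(e n - l) ^+ 2]. *)
Lemma riesz_fischer (e : nat -> R -> R) : (forall n, L2 (e n)) ->
  (forall n, nrm (fun x => e n.+1 x - e n x) <= 2^-1 ^+ n) ->
  exists l, L2 l /\ nrm (fun x => e n x - l x) @[n --> \oo] --> 0.
Proof.
move=> he hd.
pose d n x := `|e n.+1 x - e n x|.
have hdL n : L2 (d n).
  apply: (@L2_le _ 1 _ (fun x => e n.+1 x - e n x)); last by move=> x; rewrite mul1r normr_id.
    by apply: measurableT_comp => //; apply: measurable_funB; apply: measurable_L2.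
  exact: L2B.
pose S N x := \sum_(i < N) d i x.
have hS N : L2 (S N) by exact: L2_sum.
have d0 n x : 0 <= d n x by rewrite /d.
have S0 N x : 0 <= S N x by exact: sumr_ge0.
have ndS x : {homo (S ^~ x) : n m / (n <= m)%N >-> n <= m}.
  move=> n m nm; rewrite -(subnKC nm) /S big_split_ord/= lerDl.
  exact: sumr_ge0.
have nS N : nrm (S N) <= 2.
  (* The exact geometric sum is what the induction can carry. *)
  suff : nrm (S N) <= 2 * (1 - 2^-1 ^+ N).
    by move=> h; apply: le_trans h _; rewrite ler_piMr// lerBlDr lerDl.
  elim: N => [|N ih].
    rewrite expr0 subrr mulr0 /nrm /ip /S.
    by under eq_Rintegral do rewrite big_ord0 mulr0; rewrite Rintegral_cst// mul0r sqrtr0.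
  rewrite (_ : S N.+1 = fun x => S N x + d N x); last by apply/funext => x; rewrite /S big_ord_recr.
  apply: le_trans (nrmD _ _) _ => //.
  have : nrm (d N) <= 2^-1 ^+ N.
    apply: le_trans (hd N); apply: nrm_le => //; first exact: L2B.
    by move=> x; rewrite normr_id.
  move=> h; apply: le_trans (lerD ih h) _.
  rewrite exprS; set a := _ ^+ N; lra.
pose G x : \bar R := limn (fun N => ((S N x) ^+ 2)%:E).
have ndS2 x : {homo (fun N => ((S N x) ^+ 2)%:E) : n m / (n <= m)%N >-> (n <= m)%E}.
  by move=> n m nm; rewrite lee_fin ler_sqr ?nnegrE//; exact: ndS.
have mS2 n : measurable_fun setT (fun x => ((S n x) ^+ 2)%:E).
  by apply/measurable_EFinP; apply: measurable_funX; apply: measurable_L2.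
have SG x n : (((S n x) ^+ 2)%:E <= G x)%E.
  apply: lime_ge; first exact: ereal_nondecreasing_is_cvgn.
  by near=> m; apply: ndS2; near: m; exact: nbhs_infty_ge.
have G0 x : (0 <= G x)%E by apply: le_trans (SG x 0%N); rewrite lee_fin sqr_ge0.
have mG : measurable_fun setT G.
  apply: (emeasurable_fun_cvg (fun N x => ((S N x) ^+ 2)%:E)) => // x _.
  exact: ereal_nondecreasing_is_cvgn.
have iG : mu.-integrable setT G.
  apply/integrableP; split => //.
  under eq_integral do rewrite gee0_abs//.
  apply: (@le_lt_trans _ _ 4%:E); last exact: ltry.
  rewrite /G (monotone_convergence mu measurableT mS2); last 2 first.
  - by move=> n x _; rewrite lee_fin sqr_ge0.
  - by move=> x _; exact: ndS2.
  apply: lime_le.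
    apply: ereal_nondecreasing_is_cvgn => n m nm; apply: ge0_le_integral => //.
    + by move=> x _; rewrite lee_fin sqr_ge0.
    + exact: mS2.
    + exact: mS2.
    + by move=> x _; exact: ndS2.
  apply: nearW => n; rewrite Rintegral_EFin; last exact: (hS n).2.
  rewrite lee_fin (_ : \int[mu]_x _ = nrm (S n) ^+ 2); last first.
    by rewrite sqr_nrm /ip; under eq_Rintegral do rewrite expr2.
  by rewrite (_ : 4 = 2 ^+ 2); [rewrite ler_sqr ?nnegrE// nrm_ge0|ring].
pose A := [set x | (G x < +oo)%E].
have mA : measurable A.
  have := @measurable_lte _ _ R setT measurableT G (cst +oo%E) mG.
  by rewrite setTI; apply; exact: measurable_cst.
have aeA : {ae mu, forall x, A x}.
  apply: (ae_filterS _ (integrable_ae measurableT iG)) => x /(_ I) h.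
  by rewrite /A /= ltey_eq h.
pose H x := fine (G x).
have HG x : A x -> (H x)%:E = G x.
  by move=> Ax; rewrite /H fineK// ge0_fin_numE.
have iH : integ H.
  apply: (le_integrable measurableT _ _ iG).
    apply/measurable_EFinP; apply: measurableT_comp => //; exact: fine_measurable.
  move=> x _ /=; rewrite /H; have := G0 x; case: (G x) => [r| |]//=.
  by rewrite normr0.
have H0 x : 0 <= H x by exact: fine_ge0.
have telS x n m : (n <= m)%N -> `|e m x - e n x| <= S m x.
  move=> nm; rewrite /S.
  rewrite -(subnKC nm); elim: (m - n)%N => [|k ih].
    by rewrite addn0 subrr normr0 sumr_ge0.
  rewrite addnS big_ord_recr/=.
  rewrite (_ : _ - _ = (e (n + k)%N x - e n x) + (e (n + k).+1 x - e (n + k)%N x)); last by ring.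
  by apply: le_trans (ler_normD _ _) _; rewrite lerD.
have tel2 x n m : A x -> (e m x - e n x) ^+ 2 <= H x.
  move=> Ax; rewrite -lee_fin HG//.
  wlog nm : n m / (n <= m)%N.
    move=> h; have [/h//|/ltnW/h] := leqP n m.
    by rewrite -sqrrN opprB.
  apply: le_trans (SG x m); rewrite lee_fin -[leLHS]real_normK ?num_real//.
  by rewrite ler_sqr ?nnegrE//; exact: telS.
(* Cutting [e n] off outside the set [A] where [G] is finite makes the sequence converge everywhere,
   so that its limit [l] is measurable; outside [A], [l] is 0. *)
pose u n x := \1_A x * e n x.
have cu x : cvgn (u ^~ x).
  have [Ax|Ax] := pselect (A x); last first.
    rewrite /u indicE memNset//; under eq_fun do rewrite mul0r; exact: is_cvg_cst.
  rewrite /u indicE mem_set//; under eq_fun do rewrite mul1r.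
  have : cvgn (series (fun n => e n.+1 x - e n x)).
    apply: normed_cvg; rewrite (_ : [normed series _] = S ^~ x); last first.
      by apply/funext => n; rewrite /= seriesEord.
    apply: (@nondecreasing_is_cvgn); first exact: ndS.
    exists (H x + 1) => _ [n _ <-].
    have h : (S n x) ^+ 2 <= H x by rewrite -lee_fin HG.
    nra.
  rewrite (_ : series _ = fun n => e n x - e 0%N x); last first.
    by apply/funext => n; rewrite /series/= telescope_sumr.
  move=> h; rewrite (_ : (fun n => e n x) = (fun n => (e n x - e 0%N x) + e 0%N x)).
    by apply: is_cvgD => //; exact: is_cvg_cst.
  by apply/funext => n; rewrite subrK.
pose l x := limn (u ^~ x).
have ml : measurable_fun setT l.
  apply: (@measurable_fun_cvg _ _ _ _ u) => [n|x _]; last exact: cu.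
  by apply: measurable_L2; apply: L2_indic.
have cl x : A x -> e ^~ x @ \oo --> l x.
  move=> Ax; have := cu x; rewrite /l /u indicE mem_set//.
  by under [fun n => _]eq_fun do rewrite mul1r.
have lb x n : A x -> (e n x - l x) ^+ 2 <= H x.
  move=> Ax.
  have c : (e n x - e m x) ^+ 2 @[m --> \oo] --> (e n x - l x) ^+ 2.
    rewrite expr2; under eq_fun do rewrite expr2.
    by apply: cvgM; (apply: cvgB; [exact: cvg_cst|exact: cl]).
  by apply: (cvgn_le c) => m; exact: tel2.
have hl : L2 l.
  split => //.
  (* On [A], the square of [l] is at most twice the square of [e 0 - l] plus twice that of [e 0]. *)
  apply: (@integ_le _ _ (fun x => 2 * H x + 2 * e 0%N x ^+ 2)).
  - exact: measurable_funX.
  - by apply: integD; apply: integZ => //; exact: (he 0%N).2.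
  move=> x; rewrite ger0_norm ?sqr_ge0//.
  have [Ax|Ax] := pselect (A x).
    have := lb x 0%N Ax; have := sqr_ge0 (e 0%N x - l x + e 0%N x); nra.
  have -> : l x = 0.
    rewrite /l /u indicE memNset//; under [fun n => _]eq_fun do rewrite mul0r.
    exact: lim_cst.
  by have := H0 x; have := sqr_ge0 (e 0%N x); nra.
exists l; split => //.
have [|||||_ c] := @DCT_ae (fun n x => (e n x - l x) * (e n x - l x)) (cst 0) H.
- by move=> n; apply: measurable_funM; apply: measurable_funB => //; exact: measurable_L2.
- exact: measurable_cst.
- exact: iH.
- apply: (ae_filterS _ aeA) => x Ax; rewrite -[X in _ --> X](mulr0 0) -(subrr (l x)).
  by apply: cvgM; (apply: cvgB; [exact: cl|exact: cvg_cst]).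
- by apply: (ae_filterS _ aeA) => x Ax n; rewrite -expr2 ger0_norm ?sqr_ge0//; exact: lb.
rewrite -[X in _ --> X](sqrtr0 R); apply: continuous_cvg; first exact: sqrt_continuous.
by move: c; rewrite Rintegral_cst// mul0r.
Unshelve. all: by end_near. Qed.
End RieszFischer.

(** * Derivatives and the fundamental theorem of calculus *)

Section Calculus.
Context {R : realType}.
Local Notation mu := (@lebesgue_measure R).
Implicit Types (f g : R -> R) (x : R).

Lemma is_derive_mul f g x df dg : is_derive x 1 f df -> is_derive x 1 g dg ->
  is_derive x 1 (fun y => f y * g y) (df * g x + f x * dg).
Proof.
move=> hf hg; have h := is_deriveM hf hg.
by apply: (is_derive_eq h); rewrite /GRing.scale/=; ring.
Qed.

Lemma is_derive_add f g x df dg : is_derive x 1 f df -> is_derive x 1 g dg ->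
  is_derive x 1 (fun y => f y + g y) (df + dg).
Proof. by move=> hf hg; exact: is_deriveD. Qed.

Lemma is_derive_sub f g x df dg : is_derive x 1 f df -> is_derive x 1 g dg ->
  is_derive x 1 (fun y => f y - g y) (df - dg).
Proof. by move=> hf hg; exact: is_deriveB. Qed.

Lemma is_derive_const c x : is_derive x 1 (fun=> c : R) 0.
Proof. exact: is_derive_cst. Qed.

Lemma is_derive_idfun x : is_derive x 1 (fun y => y) (1 : R).
Proof. exact: is_derive_id. Qed.

Lemma is_derive_scale c f x df : is_derive x 1 f df -> is_derive x 1 (fun y => c * f y) (c * df).
Proof. by move=> hf; have := is_derive_mul (is_derive_const c x) hf; rewrite mul0r add0r. Qed.

Lemma is_derive_compose f g x df dg : is_derive (g x) 1 f df -> is_derive x 1 g dg ->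
  is_derive x 1 (fun y => f (g y)) (df * dg).
Proof. by move=> hf hg; exact: is_derive1_comp. Qed.

Lemma is_derive_horner (p : {poly R}) x : is_derive x 1 (horner p) (p^`().[x])%R.
Proof.
apply: DeriveDef; first exact: derivable_horner.
by rewrite -derive1E (derivE p).
Qed.

Lemma is_derive_val_eq f x (d d' : R) : is_derive x 1 f d -> d = d' -> is_derive x 1 f d'.
Proof. by move=> h <-. Qed.

Lemma is_derive_continuous f x d : is_derive x 1 f d -> {for x, continuous f}.
Proof. by move=> h; apply/differentiable_continuous/derivable1_diffP; exact: ex_derive. Qed.

Lemma is_derive_continuousT f f' : (forall x, is_derive x 1 f (f' x)) -> continuous f.
Proof. by move=> h x; exact: is_derive_continuous (h x). Qed.

Lemma is_derive_derive1 f x d : is_derive x 1 f d -> derive1 f x = d.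
Proof. by move=> h; rewrite derive1E; exact: derive_val. Qed.

Lemma FTC_itv f f' a b : a < b -> (forall x, is_derive x 1 f (f' x)) -> continuous f' ->
  (\int[mu]_(x in `[a, b]) (f' x)%:E = (f b - f a)%:E)%E.
Proof.
move=> ab df cf'; have cf := is_derive_continuousT df.
rewrite EFinB; apply: continuous_FTC2 => //.
- exact: continuous_subspaceT.
- split; first by move=> x _; apply: ex_derive.
  + by apply: cvg_at_right_filter; exact: cf.
  + by apply: cvg_at_left_filter; exact: cf.
- by move=> x _; rewrite derive1E; exact: derive_val.
Qed.

Lemma indic_mul_measurable (D : set R) f : measurable D -> measurable_fun setT f ->
  measurable_fun setT (fun x => \1_D x * f x).
Proof. by move=> mD mf; apply: measurable_funM => //; exact: measurable_indic. Qed.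

Lemma Rintegral_indic (D : set R) f : 
  \int[mu]_x (\1_D x * f x) = \int[mu]_(x in D) f x.
Proof.
rewrite [RHS]Rintegral_mkcond; congr Rintegral; apply/funext => x.
by rewrite /patch indicE; case: ifPn; rewrite ?mul1r ?mul0r.
Qed.

(** The integrals over [[- n, n]] are boundary terms and tend to the full integral by dominated
    convergence. Integrations by parts on the whole line are done by giving [f] as a product. *)
Lemma FTC_T f f' : (forall x, is_derive x 1 f (f' x)) -> continuous f' -> integ f' ->
  f n%:R - f (- n%:R) @[n --> \oo] --> (0 : R) -> \int[mu]_x f' x = 0.
Proof.
move=> df cf' If lf.
have [||||_ c] := @DCT _ (fun n x => \1_(`[- n%:R, n%:R] : set R) x * f' x) f' (fun x => `|f' x|).
- by move=> n; apply: indic_mul_measurable => //; exact: integ_measurable.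
- exact: integ_norm.
- move=> x; apply: cvg_near_cst; near=> n.
  rewrite indicE mem_set ?mul1r//= in_itv/= -ler_norml.
  by near: n; exact: nbhs_infty_ger.
- move=> x n; rewrite normrM indicE; case: (_ \in _); rewrite ?normr1 ?normr0 ?mul1r ?mul0r//.
have c2 : \int[mu]_x (\1_(`[- n%:R, n%:R] : set R) x * f' x) @[n --> \oo] --> (0 : R).
  apply: cvg_trans lf; apply: near_eq_cvg; near=> n.
  rewrite Rintegral_indic /Rintegral (@FTC_itv f f')//.
  have : (0 < n)%N by near: n; exact: nbhs_infty_gt.
  by rewrite -(ltr_nat R) => n0; lra.
by apply: (cvg_unique _ c c2); exact: Rhausdorff.
Unshelve. all: by end_near. Qed.

End Calculus.

(** * Gaussians times polynomials *)
Section PolyGauss.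
Context {R : realType}.
Local Notation mu := (@lebesgue_measure R).

Implicit Types (c x : R) (p q : {poly R}).

(** A class closed under derivatives, multiplication by [x] and products (which add the rates [c]).
    Hermite functions lie in it with rate 1/2, and their pairwise products with rate 1. *)
Definition pgauss (c : R) (p : {poly R}) (x : R) := p.[x] * expR (- (c * x ^+ 2)).

Lemma pgaussD c p q x : pgauss c (p + q) x = pgauss c p x + pgauss c q x.
Proof. by rewrite /pgauss hornerD mulrDl. Qed.

Lemma pgaussZ c a p x : pgauss c (a *: p) x = a * pgauss c p x.
Proof. by rewrite /pgauss hornerZ mulrA. Qed.

Lemma pgaussB c p q x : pgauss c (p - q) x = pgauss c p x - pgauss c q x.
Proof. by rewrite /pgauss hornerD hornerN mulrDl mulNr. Qed.

Lemma is_derive_gauss c x : is_derive x 1 (fun y : R => expR (- (c * y ^+ 2)))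
  (- (2 * c * x) * expR (- (c * x ^+ 2))).
Proof.
have h : is_derive x 1 (fun y : R => - c * (y * y)) (- c * (1 * x + x * 1)).
  by apply/is_derive_scale/is_derive_mul; exact: is_derive_idfun.
have := is_derive_compose (is_derive_expR _) h.
rewrite (_ : (fun y => expR _) = (fun y : R => expR (- (c * y ^+ 2)))).
  by move=> h'; apply: is_derive_val_eq h' _; rewrite mulNr -expr2; ring.
by apply/funext => y; rewrite mulNr expr2.
Qed.

Lemma is_derive_pgauss c p x :
  is_derive x 1 (pgauss c p) (pgauss c (p^`() - (2 * c) *: ('X * p)) x).
Proof.
apply: is_derive_val_eq (is_derive_mul (is_derive_horner p x) (is_derive_gauss c x)) _.
by rewrite /pgauss hornerD hornerN hornerZ hornerM hornerX; ring.
Qed.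

Lemma pgauss_continuous c p : continuous (pgauss c p).
Proof. by apply: is_derive_continuousT => x; exact: is_derive_pgauss. Qed.

Lemma pgauss_measurable c p : measurable_fun setT (pgauss c p).
Proof. by apply: continuous_measurable_fun; exact: pgauss_continuous. Qed.

Lemma integ_gauss (c : R) : 0 < c -> integ (fun x => expR (- (c * x ^+ 2))).
Proof.
(* The normal density of variance [1 / (2 c)] is proportional to this Gaussian. *)
move=> c0; pose s := Num.sqrt (2 * c)^-1.
have s0 : 0 < s by rewrite sqrtr_gt0 invr_gt0 mulr_gt0.
have ss : s ^+ 2 = (2 * c)^-1 by rewrite sqr_sqrtr// invr_ge0 mulr_ge0// ltW.
have := @integrable_normal_pdf R 0 s.
rewrite (normal_pdfE _ (lt0r_neq0 s0)) => h.
apply: eq_integrable (integZ (normal_peak s)^-1 h) => //.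
move=> x _ /=; rewrite /normal_fun subr0.
rewrite mulrA mulVf ?mul1r ?gt_eqF ?normal_peak_gt0 ?gt_eqF//.
congr (expR _)%:E; rewrite ss -mulr_natr; field; by rewrite gt_eqF.
Qed.

(** Induction on the degree with the rate left free: half of it pays for the new factor [x], the
    other half for the polynomial of lower degree. *)
Lemma poly_le_gauss (c : R) (p : {poly R}) : 0 < c ->
  exists2 C, 0 <= C & forall x, `|p.[x]| <= C * expR (c * x ^+ 2).
Proof.
elim/poly_ind: p c => [|p a ih] c c0.
  by exists 0 => // x; rewrite horner0 normr0 mul0r.
have c2 : 0 < c / 2 by rewrite divr_gt0.
have [C C0 hC] := ih _ c2.
have bx (x : R) : `|x| <= (1 + 2 / c) * expR (c / 2 * x ^+ 2).
  apply: (@le_trans _ _ ((1 + 2 / c) * (1 + c / 2 * x ^+ 2))); last first.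
    by rewrite ler_wpM2l ?expR_ge1Dx// addr_ge0// divr_ge0// ltW.
  rewrite (_ : (1 + 2 / c) * (1 + _) = 1 + x ^+ 2 + (2 / c + c / 2 * x ^+ 2)); last first.
    by field; rewrite gt_eqF.
  apply: (@le_trans _ _ (1 + x ^+ 2)).
    by rewrite -[x ^+ 2]real_normK ?num_real//; have := sqr_ge0 (`|x| - 1); nra.
  by rewrite lerDl; apply: addr_ge0; [rewrite divr_ge0// ltW|rewrite mulr_ge0 ?sqr_ge0// ltW].
exists (C * (1 + 2 / c) + `|a|).
  by rewrite addr_ge0// mulr_ge0// addr_ge0// divr_ge0// ltW.
move=> x; rewrite hornerMXaddC mulrDl.
apply: le_trans (ler_normD _ _) _; apply: lerD; last first.
  rewrite ler_peMr//; apply: le_trans (expR_ge1Dx _).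
  by rewrite lerDl mulr_ge0 ?sqr_ge0// ltW.
rewrite normrM (_ : expR (c * x ^+ 2) = expR (c / 2 * x ^+ 2) * expR (c / 2 * x ^+ 2)); last first.
  by rewrite -expRD; congr expR; field.
by rewrite mulrACA; apply: ler_pM.
Qed.

Lemma pgauss_le (c : R) p : 0 < c ->
  exists2 C, 0 <= C & forall x, `|pgauss c p x| <= C * expR (- (c / 2 * x ^+ 2)).
Proof.
move=> c0; have [C C0 hC] := @poly_le_gauss (c / 2) p (divr_gt0 c0 (ltr0Sn _ 1)).
exists C => // x; rewrite /pgauss normrM [`|expR _|]ger0_norm ?expR_ge0//.
apply: (@le_trans _ _ (C * expR (c / 2 * x ^+ 2) * expR (- (c * x ^+ 2)))).
  by rewrite ler_wpM2r ?expR_ge0.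
by rewrite -mulrA -expRD (_ : _ + _ = - (c / 2 * x ^+ 2))//; field.
Qed.

Lemma integ_pgauss (c : R) p : 0 < c -> integ (pgauss c p).
Proof.
move=> c0; have [C C0 hC] := @pgauss_le c p c0.
apply: integ_le hC; first exact: pgauss_measurable.
by apply/integZ/integ_gauss; rewrite divr_gt0.
Qed.

Lemma pgaussM c d p q x : pgauss c p x * pgauss d q x = pgauss (c + d) (p * q) x.
Proof. by rewrite /pgauss hornerM mulrACA -expRD mulrDl opprD. Qed.

Lemma L2_pgauss (c : R) p : 0 < c -> L2 (pgauss c p).
Proof.
move=> c0; split; first exact: pgauss_measurable.
rewrite (_ : (fun _ => _) = pgauss (c + c) (p * p)).
  by apply: integ_pgauss; rewrite addr_gt0.
by apply/funext => x; rewrite expr2 pgaussM.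
Qed.

Lemma expR_Nsqr_cvg0 (c : R) : 0 < c -> expR (- (c * n%:R ^+ 2)) @[n --> \oo] --> (0 : R).
Proof.
move=> c0.
(* Since [expR y >= 1 + y], the sequence lies below [1 / (c n)] once [n >= 1]. *)
have h : (c * n%:R)^-1 @[n --> \oo] --> (0 : R).
  apply/gtr0_cvgV0; first by near=> n; rewrite mulr_gt0// ltr0n; near: n; exact: nbhs_infty_gt.
  apply/cvgryPge => A; near=> n; rewrite -ler_pdivrMl//; near: n; exact: nbhs_infty_ger.
apply: (squeeze_cvgr _ (cvg_cst 0) h); near=> n; rewrite expR_ge0/=.
have n1 : (1 <= n%:R :> R) by rewrite ler1n; near: n; exact: nbhs_infty_gt.
rewrite expRN lef_pV2 ?posrE ?expR_gt0 ?mulr_gt0//; last by lra.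
apply: le_trans (expR_ge1Dx _); have : c * n%:R <= c * n%:R ^+ 2; last by lra.
by rewrite ler_pM2l// expr2 ler_peMr//; lra.
Unshelve. all: by end_near. Qed.

Lemma pgauss_cvg0 (c : R) p : 0 < c ->
  pgauss c p n%:R - pgauss c p (- n%:R) @[n --> \oo] --> (0 : R).
Proof.
move=> c0; have [C C0 hC] := @pgauss_le c p c0.
have h : C *+ 2 * expR (- (c / 2 * n%:R ^+ 2)) @[n --> \oo] --> (0 : R).
  rewrite -[X in _ --> X](mulr0 (C *+ 2)); apply: cvgM; first exact: cvg_cst.
  by apply: expR_Nsqr_cvg0; rewrite divr_gt0.
apply/norm_cvg0P; apply: (squeeze_cvgr _ (cvg_cst 0) h); near=> n.
rewrite normr_ge0/=; apply: le_trans (ler_normB _ _) _.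
by rewrite mulrnAl mulr2n; apply: lerD; rewrite ?hC// -[n%:R ^+ 2]sqrrN hC.
Unshelve. all: by end_near. Qed.

Lemma int_pgauss_deriv (c : R) p : 0 < c ->
  \int[mu]_x pgauss c (p^`() - (2 * c) *: ('X * p)) x = 0.
Proof.
move=> c0; apply: (@FTC_T _ (pgauss c p)).
- exact: is_derive_pgauss.
- exact: pgauss_continuous.
- exact: integ_pgauss.
- exact: pgauss_cvg0.
Qed.
End PolyGauss.

(** * Hermite functions *)
Section Hermite.
Context {R : realType}.
Local Notation mu := (@lebesgue_measure R).

(** This recurrence is what one more derivative of a polynomial times [exp (- x ^+ 2)] produces, up
    to the sign that [hermiteH] removes. *)
Fixpoint Hpoly (n : nat) : {poly R} :=
  if n is m.+1 then 2 *: ('X * Hpoly m) - (Hpoly m)^`() else 1.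

Lemma derive1n_gauss n :
  derive1n n (@gauss R) = pgauss 1 ((-1) ^+ n *: Hpoly n).
Proof.
elim: n => [|n ih].
  apply/funext => x; rewrite derive1n0 /gauss /pgauss/= expr0 scale1r hornerC.
  by rewrite !mul1r.
rewrite derive1nS ih; apply/funext => x.
rewrite (is_derive_derive1 (is_derive_pgauss 1 _ x)); congr (pgauss 1 _ x).
rewrite /= exprS mulN1r scaleNr -scalerN opprB scalerBr derivZ mulr1.
by congr (_ - _); rewrite -scalerAr !scalerA mulrC.
Qed.

Lemma hermiteHE n x : hermiteH n x = (Hpoly n).[x] :> R.
Proof.
rewrite /hermiteH derive1n_gauss /pgauss mul1r hornerZ.
rewrite (_ : _ * _ = ((-1) ^+ n * (-1) ^+ n) * (Hpoly n).[x] * (expR (x ^+ 2) * expR (- x ^+ 2))); last by ring.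
by rewrite -expRD subrr expR0 mulr1 -exprD addnn -mul2n exprM sqrrN expr1n expr1n mul1r.
Qed.

Definition hermite_cst (n : nat) : R := (Num.sqrt (Num.sqrt pi) * Num.sqrt (2 ^+ n * (n`!)%:R))^-1.

Lemma hermite_cst_gt0 n : 0 < hermite_cst n.
Proof.
by rewrite invr_gt0 mulr_gt0 ?sqrtr_gt0 ?pi_gt0.
Qed.

Lemma hermite_funE n x : hermite_fun n x = hermite_cst n * pgauss 2^-1 (Hpoly n) x.
Proof.
rewrite /hermite_fun hermiteHE -/(hermite_cst n) -mulrA /pgauss.
by congr (_ * (_ * expR _)); rewrite mulNr mulrC.
Qed.

Lemma hermite_funE' n : @hermite_fun R n = fun x => hermite_cst n * pgauss 2^-1 (Hpoly n) x.
Proof. by apply/funext => x; exact: hermite_funE. Qed.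

(** Differentiating the recurrence gives [2 *: Hpoly n.+1] plus the recurrence applied to the
    derivative of [Hpoly n.+1]; by induction the latter is [2 (n + 1)] times [Hpoly n.+1]. *)
Lemma deriv_Hpoly n : (Hpoly n.+1)^`() = (2 * n.+1%:R) *: Hpoly n.
Proof.
elim: n => [|n ih].
  by rewrite /= mulr1 -polyC1 derivC subr0 derivZ derivX polyC1 mulr1.
rewrite [Hpoly n.+2]/= derivB derivZ derivM derivX mul1r ih derivZ.
rewrite -scalerAr scalerDr.
rewrite (_ : 2 *: (_ *: ('X * Hpoly n)) = (2 * n.+1%:R) *: (2 *: ('X * Hpoly n))); last first.
  by rewrite !scalerA; congr (_ *: _); ring.
rewrite -addrA -scalerBr -/(Hpoly n.+1) -scalerDl; congr (_ *: _).
by rewrite -[in RHS]natr1; ring.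
Qed.

Definition gauss_int (p : {poly R}) : R := \int[mu]_x pgauss 1 p x.

Lemma gauss_intD p q : gauss_int (p + q) = gauss_int p + gauss_int q.
Proof.
rewrite /gauss_int -RintegralD//; [|exact: integ_pgauss..].
by congr Rintegral; apply/funext => x; rewrite pgaussD.
Qed.

Lemma gauss_intZ a p : gauss_int (a *: p) = a * gauss_int p.
Proof.
rewrite /gauss_int -RintegralZl//; last exact: integ_pgauss.
by congr Rintegral; apply/funext => x; rewrite pgaussZ.
Qed.

Lemma gauss_int_deriv p : gauss_int p^`() = gauss_int (2 *: ('X * p)).
Proof.
apply/eqP; rewrite -subr_eq0 -[- gauss_int _]mulN1r -gauss_intZ -gauss_intD scaleN1r.
by have := @int_pgauss_deriv R 1 p ltr01; rewrite mulr1 => h; apply/eqP.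
Qed.

Lemma gauss_int1 : gauss_int 1 = Num.sqrt pi.
Proof.
rewrite /gauss_int /Rintegral; have := @integralT_gauss R; rewrite /gauss_fun => h.
rewrite (_ : (fun x => _) = (fun x : R => (expR (- x ^+ 2))%:E)); first by rewrite h.
by apply/funext => x; rewrite /pgauss hornerC !mul1r.
Qed.

(** For the weight [exp (- x ^+ 2)], the operator [2 x - d/dx] that leads from [Hpoly n] to
    [Hpoly n.+1] is the adjoint of [d/dx]. *)
Lemma gauss_int_Hpoly_rec m n : gauss_int (Hpoly m * Hpoly n.+1) = gauss_int ((Hpoly m)^`() * Hpoly n).
Proof.
rewrite /= mulrBr.
have := gauss_int_deriv (Hpoly m * Hpoly n); rewrite derivM gauss_intD => h.
rewrite gauss_intD -scaleN1r gauss_intZ mulN1r.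
rewrite (_ : Hpoly m * (2 *: ('X * Hpoly n)) = 2 *: ('X * (Hpoly m * Hpoly n))); last first.
  by rewrite -scalerAr mulrCA.
by rewrite -h addrK.
Qed.

(** With [deriv_Hpoly], each use of the adjunction lowers both degrees by one; if one degree reaches
    0 first, the derivative of a constant makes the integral vanish. *)
Lemma gauss_int_Hpoly m n : gauss_int (Hpoly m * Hpoly n) = (m == n)%:R * (2 ^+ n * n`!%:R * Num.sqrt pi).
Proof.
elim: n m => [|n ih] [|m].
- by rewrite mulr1 gauss_int1 eqxx !mul1r.
- by rewrite mulrC gauss_int_Hpoly_rec /= -(polyC1 R) derivC mul0r -(scale0r 1) gauss_intZ !mul0r.
- by rewrite gauss_int_Hpoly_rec /= -(polyC1 R) derivC mul0r -(scale0r 1) gauss_intZ !mul0r.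
rewrite gauss_int_Hpoly_rec deriv_Hpoly -scalerAl gauss_intZ ih eqSS.
case: eqP => [->|_]; last by rewrite !mul0r mulr0.
by rewrite !mul1r exprS factS natrM; ring.
Qed.

Lemma L2_hermite n : L2 (@hermite_fun R n).
Proof. by rewrite hermite_funE'; apply: L2Z; apply: L2_pgauss; rewrite invr_gt0. Qed.

Lemma orthonormal_hermite N : is_orthonormal N (@hermite_fun R).
Proof.
split; first exact: L2_hermite.
suff h m n : ip (@hermite_fun R m) (@hermite_fun R n) = (m == n)%:R.
  by move=> i j; rewrite h.
have L2p k : L2 (pgauss 2^-1 (Hpoly k) : R -> R) by apply: L2_pgauss; rewrite invr_gt0.
rewrite !hermite_funE' ipZl//; last exact: L2Z.
rewrite ipZr// (_ : ip _ _ = gauss_int (Hpoly m * Hpoly n)); last first.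
  rewrite /ip /gauss_int; congr Rintegral; apply/funext => x; rewrite pgaussM.
  by congr (pgauss _ _ x); lra.
rewrite gauss_int_Hpoly; case: eqP => [->|_]; last by rewrite !(mul0r, mulr0).
rewrite mul1r mulrA -expr2 /hermite_cst exprVn exprMn !sqr_sqrtr ?sqrtr_ge0//.
rewrite [X in X^-1]mulrC mulVf// mulf_neq0//.
by rewrite sqrtr_eq0 -ltNge pi_gt0.
Qed.

Lemma Hpoly_ode n : (Hpoly n)^`()^`() = 2 *: ('X * (Hpoly n)^`()) - (2 * n%:R) *: Hpoly n.
Proof.
case: n => [|n].
  have d0 : (0 : {poly R})^`() = 0 by rewrite -(polyC0 R) derivC.
  by rewrite /= -(polyC1 R) derivC d0 !mulr0 scaler0 scale0r subr0.
rewrite deriv_Hpoly derivZ; move: (2 * _) => c.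
rewrite -scalerAr scalerA [2 * c]mulrC -scalerA -scalerBr; congr (_ *: _).
by rewrite /= opprB addrC subrK.
Qed.

Definition hermite_deriv (n : nat) (x : R) : R := hermite_cst n * pgauss 2^-1 ((Hpoly n)^`() - 'X * Hpoly n) x.

Lemma is_derive_hermite n (x : R) : is_derive x 1 (@hermite_fun R n) (hermite_deriv n x).
Proof.
rewrite hermite_funE' /hermite_deriv; apply: is_derive_scale; apply: is_derive_val_eq (is_derive_pgauss _ _ _) _.
by rewrite mulfV// scale1r.
Qed.

Lemma is_derive_hermite_deriv n (x : R) : is_derive x 1 (hermite_deriv n) ((x ^+ 2 - (2 * n%:R + 1)) * hermite_fun n x).
Proof.
rewrite hermite_funE /hermite_deriv; apply: is_derive_val_eq (is_derive_scale _ (is_derive_pgauss _ _ _)) _.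
rewrite [RHS]mulrCA; congr (_ * _); rewrite /pgauss [RHS]mulrA; congr (_ * _).
rewrite mulfV// scale1r derivB derivM derivX mul1r Hpoly_ode.
by rewrite !(hornerD, hornerN, hornerZ, hornerM, hornerX); ring.
Qed.

Lemma hermite_continuous n : continuous (@hermite_fun R n).
Proof. exact: is_derive_continuousT (is_derive_hermite n). Qed.

End Hermite.

(** * Hartley transform of Hermite functions *)
Section Hartley.
Context {R : realType}.
Local Notation mu := (@lebesgue_measure R).
Implicit Types (f g : R -> R) (x w t : R).

Definition cas (x : R) := cos x + sin x.

Lemma is_derive_lin (c x : R) : is_derive x 1 (fun y => c * y) c.
Proof. by apply: is_derive_val_eq (is_derive_scale c (is_derive_idfun x)) _; rewrite mulr1. Qed.

Lemma is_derive_cosZ (c x : R) : is_derive x 1 (fun y => cos (c * y)) (- (c * sin (c * x))).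
Proof. by apply: is_derive_val_eq (@is_derive_compose R cos (fun y => c * y) x _ _ (is_derive_cos _) (is_derive_lin c x)) _; ring. Qed.

Lemma is_derive_sinZ (c x : R) : is_derive x 1 (fun y => sin (c * y)) (c * cos (c * x)).
Proof. by apply: is_derive_val_eq (@is_derive_compose R sin (fun y => c * y) x _ _ (is_derive_sin _) (is_derive_lin c x)) _; ring. Qed.

Lemma norm_cas (x : R) : `|cas x| <= 2.
Proof.
apply: le_trans (ler_normD _ _) _; rewrite (_ : 2 = 1 + 1)//.
by apply: lerD; rewrite ler_norml ?cos_geN1 ?cos_le1 ?sin_geN1 ?sin_le1.
Qed.

Lemma continuous_cas : continuous cas.
Proof. by move=> x; apply: cvgD; [exact: continuous_cos|exact: continuous_sin]. Qed.

Lemma integ_mul_bounded (C : R) f g : integ f -> measurable_fun setT g ->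
  (forall x, `|g x| <= C) -> integ (fun x => f x * g x).
Proof.
move=> hf mg gC; apply: (@integ_le _ _ (fun x => C * `|f x|)).
- by apply: measurable_funM => //; exact: integ_measurable.
- by apply: integZ; exact: integ_norm.
- by move=> x; rewrite normrM mulrC ler_wpM2r.
Qed.

(** Since [K'] is bounded, [C * |t * f t|] dominates the derivative in [v] uniformly. The kernel
    stays abstract in order to serve [cos], [sin] and [cas]. *)
Lemma is_derive_int_kernel (C : R) (K K' : R -> R) f w :
  (forall x, is_derive x 1 K (K' x)) -> continuous K' ->
  (forall x, `|K x| <= C) -> (forall x, `|K' x| <= C) ->
  integ f -> integ (fun t => t * f t) ->
  is_derive w 1 (fun v => \int[mu]_t (f t * K (t * v)))
    (\int[mu]_t ((t * f t) * K' (t * w))).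
Proof.
move=> dK cK' KC K'C hf htf.
pose F v t := f t * K (t * v).
have cK := is_derive_continuousT dK.
have mK (k : R -> R) v : continuous k -> measurable_fun setT (fun t => k (t * v)).
  move=> ck; apply: measurableT_comp; first exact: continuous_measurable_fun.
  by apply: measurable_funM => //; exact: measurable_cst.
have dF t (v : R) : is_derive v 1 (F ^~ t) ((t * f t) * K' (t * v)).
  apply: is_derive_val_eq (is_derive_scale (f t) (@is_derive_compose R K (fun v => t * v) v _ _ (dK _) (is_derive_lin t v))) _; ring.
have hI : `]w - 1, w + 1[%classic w by rewrite /= in_itv/= ltrBlDr ltrDl ltr01.
have h1 v : `]w - 1, w + 1[%classic v -> mu.-integrable setT (EFin \o F v).
  by move=> _; apply: (@integ_mul_bounded C) => //; exact: mK.
have h2 v t : `]w - 1, w + 1[%classic v -> setT t -> derivable (F ^~ t) v 1.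
  by move=> _ _; apply: ex_derive; exact: dF.
have h3 (t : R) : 0 <= C * `|t * f t|.
  by rewrite mulr_ge0// (le_trans _ (KC 0)).
have h4 : mu.-integrable setT (EFin \o (fun t => C * `|t * f t|)).
  by apply: integZ; exact: integ_norm.
have h5 v t : `]w - 1, w + 1[%classic v -> setT t -> `|partial1of2 F v t| <= C * `|t * f t|.
  by move=> _ _; rewrite /partial1of2 (is_derive_derive1 (dF t v)) normrM mulrC ler_wpM2r.
apply: DeriveDef.
  exact: (@derivable_under_integral R _ _ mu F setT measurableT w _ _ hI h1 h2 _ h3 h4 h5).
rewrite -derive1E (@differentiation_under_integral R _ _ mu F setT measurableT w _ _ hI h1 h2 _ h3 h4 h5).
by congr Rintegral; apply/funext => t; rewrite /partial1of2 (is_derive_derive1 (dF t w)).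
Qed.

(** The cosine and sine integrals are treated apart because differentiation in [w] exchanges them;
    their sum is the unnormalised Hartley integral. *)
Definition cosint (p : {poly R}) w := \int[mu]_t (pgauss 2^-1 p t * cos (t * w)).
Definition sinint (p : {poly R}) w := \int[mu]_t (pgauss 2^-1 p t * sin (t * w)).

Lemma norm_cos x : `|cos x| <= 1.
Proof. by rewrite ler_norml cos_geN1 cos_le1. Qed.

Lemma norm_sin x : `|sin x| <= 1.
Proof. by rewrite ler_norml sin_geN1 sin_le1. Qed.

Lemma mulX_pgauss c p x : x * pgauss c p x = pgauss c ('X * p) x.
Proof. by rewrite /pgauss hornerM hornerX mulrA. Qed.

Lemma mulX_pgauss_fun c p : (fun x => x * pgauss c p x) = pgauss c ('X * p).
Proof. by apply/funext => x; exact: mulX_pgauss. Qed.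

Lemma trig_integ f (K : R -> R) w : integ f -> continuous K ->
  (forall x, `|K x| <= 1) -> integ (fun t => f t * K (t * w)).
Proof.
move=> hf cK K1; apply: (@integ_mul_bounded 1) => //.
apply: measurableT_comp; first exact: continuous_measurable_fun.
by apply: measurable_funM => //; exact: measurable_cst.
Qed.

Let i2 : 0 < 2^-1 :> R. Proof. by rewrite invr_gt0. Qed.

Lemma is_derive_cosint p w : is_derive w 1 (cosint p) (- sinint ('X * p) w).
Proof.
have h := @is_derive_int_kernel 1 cos (fun x => - sin x) (pgauss 2^-1 p) w (@is_derive_cos R).
apply: is_derive_val_eq (h _ _ _ _ _) _.
- by move=> x; apply: cvgN; exact: continuous_sin.
- exact: norm_cos.
- by move=> x; rewrite normrN norm_sin.
- exact: integ_pgauss.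
- by rewrite mulX_pgauss_fun; exact: integ_pgauss.
rewrite /sinint -mulN1r -RintegralZl//; last first.
  by apply: trig_integ; [exact: integ_pgauss|exact: continuous_sin|exact: norm_sin].
by congr Rintegral; apply/funext => t; rewrite mulX_pgauss; ring.
Qed.

Lemma is_derive_sinint p w : is_derive w 1 (sinint p) (cosint ('X * p) w).
Proof.
have h := @is_derive_int_kernel 1 sin cos (pgauss 2^-1 p) w (@is_derive_sin R).
apply: is_derive_val_eq (h _ _ _ _ _) _.
- exact: continuous_cos.
- exact: norm_sin.
- exact: norm_cos.
- exact: integ_pgauss.
- by rewrite mulX_pgauss_fun; exact: integ_pgauss.
by congr Rintegral; apply/funext => t; rewrite mulX_pgauss.
Qed.

Lemma pgauss_mul_cvg0 (c : R) p (K : R -> R) : 0 < c -> (forall x, `|K x| <= 1) ->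
  pgauss c p n%:R * K n%:R - pgauss c p (- n%:R) * K (- n%:R) @[n --> \oo] --> (0 : R).
Proof.
move=> c0 K1; have [C Cpos hC] := @pgauss_le R c p c0.
have h : C *+ 2 * expR (- (c / 2 * n%:R ^+ 2)) @[n --> \oo] --> (0 : R).
  rewrite -[X in _ --> X](mulr0 (C *+ 2)); apply: cvgM; first exact: cvg_cst.
  by apply: expR_Nsqr_cvg0; rewrite divr_gt0.
apply/norm_cvg0P; apply: (squeeze_cvgr _ (cvg_cst 0) h); near=> n.
rewrite normr_ge0/=; apply: le_trans (ler_normB _ _) _.
have hK x : `|pgauss c p x * K x| <= C * expR (- (c / 2 * x ^+ 2)).
  by rewrite normrM -[leRHS]mulr1 ler_pM.
by rewrite mulrnAl mulr2n; apply: lerD; rewrite ?hK// -[n%:R ^+ 2]sqrrN hK.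
Unshelve. all: by end_near. Qed.

(** The polynomial [p' - X p] is the one attached to the derivative of [pgauss 2^-1 p], so this is
    an integration by parts whose boundary terms vanish. *)
Lemma cosint_parts p w : cosint (p^`() - 'X * p) w = w * sinint p w.
Proof.
have dK x : is_derive x 1 (fun t => cos (t * w)) (- (w * sin (x * w))).
  rewrite (_ : (fun t => _) = (fun t => cos (w * t))); last by apply/funext => t; rewrite mulrC.
  by apply: is_derive_val_eq (is_derive_cosZ w x) _; rewrite [x * w]mulrC.
have cC : continuous (fun t => cos (t * w)) by exact: is_derive_continuousT dK.
have cS : continuous (fun t => sin (t * w)).
  by move=> x; apply: continuous_comp; [apply: cvgM; [exact: cvg_id|exact: cvg_cst]|exact: continuous_sin].
apply/eqP; rewrite -subr_eq0; apply/eqP.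
rewrite /cosint /sinint -RintegralZl//; last first.
  by apply: trig_integ; [exact: integ_pgauss|exact: continuous_sin|exact: norm_sin].
rewrite -RintegralB//; last 2 first.
- by apply: trig_integ; [exact: integ_pgauss|exact: continuous_cos|exact: norm_cos].
- by apply: integZ; apply: trig_integ; [exact: integ_pgauss|exact: continuous_sin|exact: norm_sin].
apply: (@FTC_T R (fun t => pgauss 2^-1 p t * cos (t * w))).
- move=> x; apply: is_derive_val_eq (is_derive_mul (is_derive_pgauss _ p x) (dK x)) _.
  by rewrite mulfV// scale1r; ring.
- move=> x; apply: cvgB; first by apply: cvgM; [exact: pgauss_continuous|exact: cC].
  by apply: cvgM; [exact: cvg_cst|apply: cvgM; [exact: pgauss_continuous|exact: cS]].
- apply: integB.
    by apply: trig_integ; [exact: integ_pgauss|exact: continuous_cos|exact: norm_cos].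
  by apply: integZ; apply: trig_integ; [exact: integ_pgauss|exact: continuous_sin|exact: norm_sin].
- by apply: (@pgauss_mul_cvg0 _ _ (fun t => cos (t * w))) => // x; exact: norm_cos.
Qed.

Lemma sinint_parts p w : sinint (p^`() - 'X * p) w = - (w * cosint p w).
Proof.
have dK x : is_derive x 1 (fun t => sin (t * w)) (w * cos (x * w)).
  rewrite (_ : (fun t => _) = (fun t => sin (w * t))); last by apply/funext => t; rewrite mulrC.
  by apply: is_derive_val_eq (is_derive_sinZ w x) _; rewrite [x * w]mulrC.
have cS : continuous (fun t => sin (t * w)) by exact: is_derive_continuousT dK.
have cC : continuous (fun t => cos (t * w)).
  by move=> x; apply: continuous_comp; [apply: cvgM; [exact: cvg_id|exact: cvg_cst]|exact: continuous_cos].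
apply/eqP; rewrite -addr_eq0; apply/eqP.
rewrite /cosint /sinint -RintegralZl//; last first.
  by apply: trig_integ; [exact: integ_pgauss|exact: continuous_cos|exact: norm_cos].
rewrite -RintegralD//; last 2 first.
- by apply: trig_integ; [exact: integ_pgauss|exact: continuous_sin|exact: norm_sin].
- by apply: integZ; apply: trig_integ; [exact: integ_pgauss|exact: continuous_cos|exact: norm_cos].
apply: (@FTC_T R (fun t => pgauss 2^-1 p t * sin (t * w))).
- move=> x; apply: is_derive_val_eq (is_derive_mul (is_derive_pgauss _ p x) (dK x)) _.
  by rewrite mulfV// scale1r; ring.
- move=> x; apply: cvgD; first by apply: cvgM; [exact: pgauss_continuous|exact: cS].
  by apply: cvgM; [exact: cvg_cst|apply: cvgM; [exact: pgauss_continuous|exact: cC]].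
- apply: integD.
    by apply: trig_integ; [exact: integ_pgauss|exact: continuous_sin|exact: norm_sin].
  by apply: integZ; apply: trig_integ; [exact: integ_pgauss|exact: continuous_cos|exact: norm_cos].
- by apply: (@pgauss_mul_cvg0 _ _ (fun t => sin (t * w))) => // x; exact: norm_sin.
Qed.

(** The product of [F] with [exp (x ^+ 2 / 2)] has derivative 0. *)
Lemma ode_gauss (F : R -> R) : (forall x, is_derive x 1 F (- (x * F x))) ->
  forall x, F x = F 0 * expR (- (2^-1 * x ^+ 2)).
Proof.
move=> dF x; have dG (y : R) : is_derive y 1 (fun z => F z * expR (- (- 2^-1 * z ^+ 2))) 0.
  by apply: is_derive_val_eq (is_derive_mul (dF y) (is_derive_gauss (- 2^-1) y)) _; rewrite mulrN mulfV//; ring.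
have := is_derive_0_is_cst x 0 dG.
rewrite expr0n/= mulr0 oppr0 expR0 mulr1 => <-.
by rewrite -mulrA -expRD mulNr opprK addrN expR0 mulr1.
Qed.

Lemma int_gauss2 : \int[mu]_t pgauss 2^-1 1 t = Num.sqrt (2 * pi).
Proof.
have := @integral_normal_pdf R 0 1; rewrite normal_pdfE ?oner_neq0// => h.
have p0 : 0 < normal_peak (1 : R) by rewrite normal_peak_gt0 ?oner_neq0.
have e : (fun t => pgauss 2^-1 1 t) = (fun t => (normal_peak (1:R))^-1 * (normal_peak 1 * normal_fun 0 1 t)).
  apply/funext => t; rewrite mulrA mulVf ?gt_eqF// mul1r /normal_fun /pgauss hornerC mul1r subr0.
  by congr expR; rewrite expr1n -mulr_natr; field.
rewrite e RintegralZl//; last first.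
  by have := @integrable_normal_pdf R 0 1; rewrite normal_pdfE ?oner_neq0.
by rewrite /Rintegral h mulr1 /normal_peak invrK expr1n mul1r mulr_natl.
Qed.

(** Differentiation in [w] and integration by parts both lead to the sine integral of
    [t exp (- t ^+ 2 / 2)]; comparing them gives the equation of [ode_gauss], and the value at 0 is
    the Gaussian integral. *)
Lemma cosint1 w : cosint 1 w = Num.sqrt (2 * pi) * pgauss 2^-1 1 w.
Proof.
have dK x : is_derive x 1 (cosint 1) (- (x * cosint 1 x)).
  apply: is_derive_val_eq (is_derive_cosint 1 x) _; have := sinint_parts 1 x.
  rewrite -(polyC1 R) derivC sub0r polyC1 => <-.
  rewrite /sinint -mulN1r -RintegralZl//; last first.
    by apply: trig_integ; [exact: integ_pgauss|exact: continuous_sin|exact: norm_sin].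
  by congr Rintegral; apply/funext => t; rewrite /pgauss hornerN; ring.
rewrite (ode_gauss dK) /pgauss hornerC mul1r; congr (_ * _).
by rewrite -int_gauss2 /cosint; congr Rintegral; apply/funext => t; rewrite mulr0 cos0 mulr1.
Qed.

Lemma sinint1 w : sinint 1 w = 0.
Proof.
have dK x : is_derive x 1 (sinint 1) (- (x * sinint 1 x)).
  apply: is_derive_val_eq (is_derive_sinint 1 x) _; have := cosint_parts 1 x.
  rewrite -(polyC1 R) derivC sub0r polyC1 => <-.
  rewrite /cosint -mulN1r -RintegralZl//; last first.
    by apply: trig_integ; [exact: integ_pgauss|exact: continuous_cos|exact: norm_cos].
  by congr Rintegral; apply/funext => t; rewrite /pgauss hornerN; ring.
rewrite (ode_gauss dK) (_ : sinint 1 0 = 0) ?mul0r// /sinint; under eq_Rintegral do rewrite mulr0 sin0 mulr0.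
by rewrite Rintegral_cst// mul0r.
Qed.

Lemma cosintD p q w : cosint (p + q) w = cosint p w + cosint q w.
Proof.
rewrite /cosint -RintegralD//; try by apply: trig_integ; [exact: integ_pgauss|exact: continuous_cos|exact: norm_cos].
by congr Rintegral; apply/funext => t; rewrite pgaussD mulrDl.
Qed.

Lemma cosintN p w : cosint (- p) w = - cosint p w.
Proof.
rewrite -[RHS]mulN1r /cosint -RintegralZl//; last by apply: trig_integ; [exact: integ_pgauss|exact: continuous_cos|exact: norm_cos].
by congr Rintegral; apply/funext => t; rewrite /pgauss hornerN; ring.
Qed.

Lemma sinintD p q w : sinint (p + q) w = sinint p w + sinint q w.
Proof.
rewrite /sinint -RintegralD//; try by apply: trig_integ; [exact: integ_pgauss|exact: continuous_sin|exact: norm_sin].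
by congr Rintegral; apply/funext => t; rewrite pgaussD mulrDl.
Qed.

Lemma sinintN p w : sinint (- p) w = - sinint p w.
Proof.
rewrite -[RHS]mulN1r /sinint -RintegralZl//; last by apply: trig_integ; [exact: integ_pgauss|exact: continuous_sin|exact: norm_sin].
by congr Rintegral; apply/funext => t; rewrite /pgauss hornerN; ring.
Qed.

(** The number [b - i a] is the eigenvalue [sqrt (2 pi) (-i)^n] of the unnormalised Fourier
    integral. One step multiplies it by [-i], which turns [(a, b)] into [(b, - a)] and preserves
    both conditions on the pair. *)
Lemma cosint_sinint_hermite n : exists a b, [/\ forall w, cosint (Hpoly n) w = b * pgauss 2^-1 (Hpoly n) w,
  forall w, sinint (Hpoly n) w = a * pgauss 2^-1 (Hpoly n) w & (a + b) ^+ 2 = 2 * pi /\ a * b = 0].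
Proof.
elim: n => [|n [a [b [hC hS [ab2 ab0]]]]].
  exists 0, (Num.sqrt (2 * pi)); split=> [w|w|].
  - exact: cosint1.
  - by rewrite sinint1 mul0r.
  - by rewrite add0r mul0r sqr_sqrtr// mulr_ge0// pi_ge0.
(* This is the raising operator [x - d/dx] acting on [pgauss 2^-1 (Hpoly n)]; the transforms
   exchange its two terms up to sign. *)
have e : Hpoly n.+1 = 'X * Hpoly n - ((Hpoly n)^`() - 'X * Hpoly n) :> {poly R}.
  by rewrite /= opprB addrA scaler_nat mulr2n.
have e2 : (Hpoly n)^`() - 'X * Hpoly n - 'X * Hpoly n = - Hpoly n.+1 :> {poly R}.
  by rewrite e !opprB addrC.
have dphi (w : R) : is_derive w 1 (pgauss 2^-1 (Hpoly n)) (pgauss 2^-1 ((Hpoly n)^`() - 'X * Hpoly n) w).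
  by apply: is_derive_val_eq (is_derive_pgauss _ _ _) _; rewrite mulfV// scale1r.
have key w : pgauss 2^-1 ((Hpoly n)^`() - 'X * Hpoly n) w - w * pgauss 2^-1 (Hpoly n) w
    = - pgauss 2^-1 (Hpoly n.+1) w.
  by rewrite mulX_pgauss -pgaussB e2 /pgauss hornerN mulNr.
exists b, (- a); split.
- move=> w; rewrite e cosintD cosintN cosint_parts -e hS.
  have -> : cosint ('X * Hpoly n) w = a * pgauss 2^-1 ((Hpoly n)^`() - 'X * Hpoly n) w.
    rewrite -(is_derive_derive1 (is_derive_sinint _ w)) (_ : sinint (Hpoly n) = fun w => a * pgauss 2^-1 (Hpoly n) w); last exact/funext.
    exact: is_derive_derive1 (is_derive_scale a (dphi w)).
  by rewrite mulNr -mulrN -key; ring.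
- move=> w; rewrite e sinintD sinintN sinint_parts -e hC.
  have -> : sinint ('X * Hpoly n) w = - (b * pgauss 2^-1 ((Hpoly n)^`() - 'X * Hpoly n) w).
    rewrite -[LHS]opprK -(is_derive_derive1 (is_derive_cosint _ w)) (_ : cosint (Hpoly n) = fun w => b * pgauss 2^-1 (Hpoly n) w); last exact/funext.
    by rewrite (is_derive_derive1 (is_derive_scale b (dphi w))).
  by have k := congr1 (fun z => b * z) (key w); rewrite /= in k; lra.
- split; last by rewrite mulrN mulrC ab0 oppr0.
  by rewrite -ab2; nra.
Qed.

(* The real-valued substitute for the Fourier transform: even and odd parts of a Hartley
   transform are cosine and sine transforms, see [trunc_FT_hartley]. *)
Definition hartley f w : R := (Num.sqrt (2 * pi))^-1 * \int[mu]_t (f t * cas (t * w)).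

(** By parity one of the two integrals vanishes and [a + b] is plus or minus [sqrt (2 pi)]. Only the
    square of the sign is recorded, because the tail sum involves squared coefficients. *)
Lemma hartley_hermite n : exists2 s : R, s ^+ 2 = 1 & forall w, hartley (hermite_fun n) w = s * hermite_fun n w.
Proof.
have [a [b [hC hS [ab2 ab0]]]] := cosint_sinint_hermite n.
have p0 : 0 < 2 * pi :> R by rewrite mulr_gt0// pi_gt0.
exists ((Num.sqrt (2 * pi))^-1 * (a + b)).
  by rewrite exprMn ab2 exprVn sqr_sqrtr ?ltW// mulVf// gt_eqF.
move=> w; rewrite /hartley -mulrA; congr (_ * _).
rewrite (_ : (fun t => _) = (fun t => hermite_cst n * (pgauss 2^-1 (Hpoly n) t * cos (t * w) + pgauss 2^-1 (Hpoly n) t * sin (t * w)))); last first.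
  by apply/funext => t; rewrite hermite_funE /cas; ring.
have ic : integ (fun t => pgauss 2^-1 (Hpoly n) t * cos (t * w)).
  by apply: trig_integ; [exact: integ_pgauss|exact: continuous_cos|exact: norm_cos].
have is_ : integ (fun t => pgauss 2^-1 (Hpoly n) t * sin (t * w)).
  by apply: trig_integ; [exact: integ_pgauss|exact: continuous_sin|exact: norm_sin].
rewrite RintegralZl//; last exact: integD.
rewrite RintegralD// -/(cosint _ _) -/(sinint _ _) hC hS hermite_funE; ring.
Qed.

End Hartley.

(** * L2 bound for the Hartley transform *)
Section HartleyBessel.
Context {R : realType}.
Local Notation mu := (@lebesgue_measure R).
Implicit Types (f g u : R -> R) (x w t : R).

Definition seg (T : R) : set R := [set t | `|t| <= T].

Lemma segE (T : R) : seg T = `[- T, T]%classic.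
Proof. by apply/seteqP; split => x; rewrite /seg/= in_itv/= ler_norml. Qed.

Lemma measurable_seg (T : R) : measurable (seg T).
Proof. by rewrite segE; exact: measurable_itv. Qed.

Lemma measure_seg (T : R) : 0 < T -> mu (seg T) = (2 * T)%:E.
Proof.
move=> T0; rewrite segE; have := @lebesgue_measure_itv R `[- T, T]%R => /= ->.
by rewrite lte_fin gtrN// -EFinB opprK mulr_natl mulr2n.
Qed.

Definition supported (T : R) u := forall x, T < `|x| -> u x = 0.

Lemma supported_indic T u : supported T u -> u = fun x => \1_(seg T) x * u x.
Proof.
move=> hu; apply/funext => x; rewrite indicE; have [xT|Tx] := leP `|x| T.
  by rewrite mem_set ?mul1r.
by rewrite (hu x Tx) mulr0.
Qed.

Lemma indic_supported T u : supported T (fun x => \1_(seg T) x * u x).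
Proof. by move=> x Tx; rewrite indicE memNset ?mul0r//= /seg/= leNgt Tx. Qed.

Lemma integ_indic_seg T : integ (\1_(seg T) : R -> R).
Proof.
rewrite /integ segE; exact: (@integrable_indic_itv R (- T) T true false).
Qed.

Lemma L2_indic_seg T : L2 (\1_(seg T) : R -> R).
Proof.
split; first by apply: measurable_indic; exact: measurable_seg.
rewrite (_ : (fun x => _) = \1_(seg T)); first exact: integ_indic_seg.
by apply/funext => x; rewrite indicE; case: (_ \in _); rewrite ?expr1n ?expr0n.
Qed.

Lemma supported_integ T u : L2 u -> supported T u -> integ u.
Proof. by move=> hu /supported_indic ->; apply: L2_mul => //; exact: L2_indic_seg. Qed.

Lemma supported_mulX T u : supported T u -> supported T (fun t => t * u t).
Proof. by move=> hu x /hu ->; rewrite mulr0. Qed.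

Lemma norm_mulX T u x : supported T u -> `|x * u x| <= T * `|u x|.
Proof.
move=> hu; have [xT|Tx] := leP `|x| T; first by rewrite normrM ler_wpM2r.
by rewrite (hu x Tx) mulr0 normr0 mulr0.
Qed.

Lemma L2_mulX T u : L2 u -> supported T u -> L2 (fun t => t * u t).
Proof.
move=> hu su; apply: (@L2_le _ T _ u) => // [|x]; last exact: norm_mulX.
by apply: measurable_funM => //; exact: measurable_L2.
Qed.

Lemma int_seg_FTC (T : R) (K k : R -> R) : 0 < T -> (forall x, is_derive x 1 K (k x)) ->
  continuous k -> \int[mu]_(t in seg T) k t = K T - K (- T).
Proof.
by move=> T0 dK ck; rewrite segE /Rintegral (@FTC_itv R K)//; lra.
Qed.

Lemma continuous_cosZ (c : R) : continuous (fun t => cos (c * t)).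
Proof. exact: is_derive_continuousT (is_derive_cosZ c). Qed.

Lemma continuous_sinZ (c : R) : continuous (fun t => sin (c * t)).
Proof. exact: is_derive_continuousT (is_derive_sinZ c). Qed.

Lemma int_seg_sin (T c : R) : 0 < T -> \int[mu]_(t in seg T) sin (c * t) = 0.
Proof.
move=> T0; have [->|c0] := eqVneq c 0.
  under eq_Rintegral do rewrite mul0r sin0.
  by rewrite Rintegral_cst ?mul0r//; exact: measurable_seg.
have dK x : is_derive x 1 (fun t => - c^-1 * cos (c * t)) (sin (c * x)).
  by apply: is_derive_val_eq (is_derive_scale _ (is_derive_cosZ c x)) _; rewrite mulrNN mulrA mulVf// mul1r.
by rewrite (int_seg_FTC T0 dK (@continuous_sinZ c)) mulrN cosN subrr.
Qed.

Lemma int_seg_cos (T c : R) : 0 < T -> c != 0 -> \int[mu]_(t in seg T) cos (c * t) = 2 * sin (c * T) / c.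
Proof.
move=> T0 c0.
have dK x : is_derive x 1 (fun t => c^-1 * sin (c * t)) (cos (c * x)).
  by apply: is_derive_val_eq (is_derive_scale _ (is_derive_sinZ c x)) _; rewrite mulrA mulVf// mul1r.
by rewrite (int_seg_FTC T0 dK (@continuous_cosZ c)) mulrN sinN; field.
Qed.

Lemma sin_npi (n : nat) : sin (n%:R * pi) = 0 :> R.
Proof.
elim: n => [|n ih]; first by rewrite mul0r sin0.
by rewrite -natr1 mulrDl mul1r sinDpi ih oppr0.
Qed.

Lemma casM (a b : R) : cas a * cas b = cos (a - b) + sin (a + b).
Proof. by rewrite /cas cosB sinD; ring. Qed.

(** The trigonometric system of period [2 T] with all frequencies shifted by [s]. Up to a factor,
    the coefficients of [u] in it are samples of [hartley u] with mesh [pi / T]. *)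
Definition hartley_basis (T s : R) (k : nat) t : R :=
  (Num.sqrt (2 * T))^-1 * (\1_(seg T) t * cas (t * (s + k%:R * (pi / T)))).

Lemma L2_hartley_basis T s k : L2 (hartley_basis T s k).
Proof.
apply: L2Z; rewrite (_ : (fun x => _) = fun t => cas (t * (s + k%:R * (pi / T))) * \1_(seg T) t); last first.
  by apply/funext => t; rewrite mulrC.
apply: (@L2_mul_bounded _ 2); last by move=> x; exact: norm_cas.
  apply: measurableT_comp; first exact: continuous_measurable_fun continuous_cas.
  by apply: measurable_funM => //; exact: measurable_cst.
exact: L2_indic_seg.
Qed.

Lemma integ_seg T (k : R -> R) : continuous k -> mu.-integrable (seg T) (EFin \o k).
Proof.
move=> ck; rewrite segE; apply: continuous_compact_integrable; first exact: segment_compact.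
exact: continuous_subspaceT.
Qed.

(** A product of two members is the cosine of the difference plus the sine of the sum of the
    arguments. The sine integrates to 0 over the symmetric segment for every shift [s]; the cosine
    runs through whole periods unless [i = j]. *)
Lemma orthonormal_hartley_basis T s N : 0 < T -> is_orthonormal N (hartley_basis T s).
Proof.
move=> T0; split; first exact: L2_hartley_basis.
move=> i j.
have e : ip (hartley_basis T s i) (hartley_basis T s j) = (2 * T)^-1 *
  (\int[mu]_(t in seg T) cos ((i%:R - j%:R) * (pi / T) * t) +
   \int[mu]_(t in seg T) sin ((2 * s + (i%:R + j%:R) * (pi / T)) * t)).
  rewrite -RintegralD; [|exact: measurable_seg|exact/integ_seg/continuous_cosZ|exact/integ_seg/continuous_sinZ].
  rewrite -RintegralZl; [|exact: measurable_seg|]; last first.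
    apply: integ_seg => x; apply: cvgD; [exact: continuous_cosZ|exact: continuous_sinZ].
  rewrite -Rintegral_indic /ip; congr Rintegral; apply/funext => t.
  rewrite /hartley_basis [LHS](_ : _ = ((Num.sqrt (2 * T)) ^- 2) * (\1_(seg T) t * \1_(seg T) t) * (cas (t * (s + i%:R * (pi / T))) * cas (t * (s + j%:R * (pi / T))))); last by rewrite -exprVn; ring.
  rewrite sqr_sqrtr; last by rewrite mulr_ge0// ltW.
  rewrite casM (_ : \1_(seg T) t * \1_(seg T) t = \1_(seg T) t); last first.
    by rewrite indicE; case: (_ \in _); rewrite ?mul1r ?mul0r.
  rewrite -mulrA mulrCA; congr (_ * (_ * (cos _ + sin _))); ring.
rewrite e int_seg_sin// addr0.
have [<-|ij] := eqVneq i j.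
  rewrite subrr mul0r; under eq_Rintegral do rewrite mul0r cos0.
  rewrite Rintegral_cst; last exact: measurable_seg.
  have -> : fine (mu (seg T)) = 2 * T by exact: (congr1 fine (measure_seg T0)).
  by rewrite mul1r mulVf// mulf_neq0// gt_eqF.
have c0 : (i%:R - j%:R) * (pi / T) != 0 :> R.
  rewrite mulf_neq0//; first by rewrite subr_eq0 eqr_nat.
  by rewrite gt_eqF// divr_gt0// pi_gt0.
rewrite int_seg_cos//.
suff -> : sin ((i%:R - j%:R) * (pi / T) * T) = 0 :> R by rewrite mulr0 mul0r mulr0.
rewrite -mulrA divfK ?gt_eqF//.
wlog ji : i j {e ij c0} / (j <= i)%N.
  move=> h; have [/h//|/ltnW/h] := leqP j i.
  by rewrite -opprB mulNr sinN => /eqP; rewrite oppr_eq0 => /eqP.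
by rewrite -natrB// sin_npi.
Qed.

Lemma ip_hartley_basis T s k u : 0 < T -> L2 u -> supported T u ->
  ip u (hartley_basis T s k) ^+ 2 = (pi / T) * hartley u (s + k%:R * (pi / T)) ^+ 2.
Proof.
move=> T0 hu su.
rewrite /hartley; set w := s + _.
have -> : ip u (hartley_basis T s k) = (Num.sqrt (2 * T))^-1 * \int[mu]_t (u t * cas (t * w)).
  rewrite -RintegralZl//; last first.
    apply: (@integ_mul_bounded _ 2); [exact: supported_integ su| |by move=> x; exact: norm_cas].
    apply: measurableT_comp; first exact: continuous_measurable_fun continuous_cas.
    by apply: measurable_funM => //; exact: measurable_cst.
  rewrite /ip; congr Rintegral; apply/funext => t.
  by rewrite /hartley_basis -/w [in RHS](supported_indic su); ring.
rewrite !exprMn !exprVn !sqr_sqrtr ?mulr_ge0// ?pi_ge0// ?ltW//.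
have p0 : pi != 0 :> R by rewrite gt_eqF// pi_gt0.
have T00 : T != 0 by rewrite gt_eqF.
move: (\int[mu]_t _) (pi : R) p0 => I q q0; field.
by rewrite q0.

Qed.

Lemma hartley_bessel_sum T s N u : 0 < T -> L2 u -> supported T u ->
  (pi / T) * \sum_(k < N) hartley u (s + k%:R * (pi / T)) ^+ 2 <= ip u u.
Proof.
move=> T0 hu su; have := bessel (orthonormal_hartley_basis s N T0) hu.
by rewrite mulr_sumr; under eq_bigr do rewrite ip_hartley_basis//.
Qed.

(** The derivative of [cas] at [x] is [cas (- x)], whence the reflected argument. *)
Lemma is_derive_hartley u w : integ u -> integ (fun t => t * u t) ->
  is_derive w 1 (hartley u) (hartley (fun t => t * u t) (- w)).
Proof.
move=> hu htu; apply: is_derive_scale.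
have h := @is_derive_int_kernel R 2 cas (fun x => cas (- x)) u w.
apply: is_derive_val_eq (h _ _ _ _ hu htu) _.
- by move=> x; apply: is_derive_val_eq (is_derive_add (is_derive_cos x) (is_derive_sin x)) _; rewrite /cas cosN sinN addrC.
- by move=> x; apply: continuous_comp; [exact: continuousN|exact: continuous_cas].
- exact: norm_cas.
- by move=> x; exact: norm_cas.
by congr Rintegral; apply/funext => t; rewrite mulrN.
Qed.

Lemma hartley_continuous T u : L2 u -> supported T u -> continuous (hartley u).
Proof.
move=> hu su; apply: is_derive_continuousT => w; apply: is_derive_hartley; first exact: supported_integ su.
by apply: (@supported_integ T); [exact: L2_mulX su|exact: supported_mulX].
Qed.

(** Each of the [N] cells of length [d] is translated to [[0, d[]; the integrand then becomes a sum
    of samples, to which [hartley_bessel_sum] applies. *)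
Lemma integral_tile (d a : R) N (f : R -> R) : 0 < d -> continuous f -> (forall x, 0 <= f x) ->
  (\int[mu]_(x in `[a, (a + N%:R * d)%R[) (f x)%:E =
   \int[mu]_(s in `[0%R, d[) (\sum_(k < N) f (s + (a + k%:R * d)))%R%:E)%E.
Proof.
move=> d0 cf f0.
have mf D : measurable_fun D (EFin \o f).
  by apply/measurable_EFinP; apply: measurable_funTS; exact: continuous_measurable_fun.
have mfs c (D : set R) : measurable_fun D (fun s : R => (f (s + c))%:E).
  apply/measurable_EFinP; apply: measurable_funTS; apply: measurableT_comp.
    exact: continuous_measurable_fun.
  by apply: measurable_funD => //; exact: measurable_cst.
elim: N => [|N ih].
  rewrite mul0r addr0 set_itvE integral_set0; apply/esym.
  by under eq_integral do rewrite big_ord0; rewrite integral0.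
have aN : a <= a + N%:R * d by rewrite lerDl mulr_ge0// ltW.
have NS : a + N%:R * d <= a + N.+1%:R * d by rewrite lerD2l ler_pM2r// ler_nat.
rewrite (@itv_bndbnd_setU _ _ _ (BLeft (a + N%:R * d))) ?bnd_simp//.
rewrite ge0_integral_setU//; last 3 first.
- exact: mf.
- by move=> x _; rewrite lee_fin.
- rewrite disj_set2E; apply/eqP; rewrite -subset0 => x [] /=.
  by rewrite !in_itv/= => /andP[_ h1] /andP[h2 _]; move: h1; rewrite ltNge h2.
rewrite ih; under [RHS]eq_integral do rewrite big_ord_recr/= EFinD.
rewrite ge0_integralD//; last 4 first.
- by move=> x _; rewrite lee_fin sumr_ge0.
- by apply/measurable_EFinP; apply: measurable_sum => k; apply/measurable_EFinP; exact: mfs.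
- by move=> x _; rewrite lee_fin.
- exact: mfs.
congr (_ + _)%E.
rewrite (@integral_shift R (a + N%:R * d))//; last by move=> x _; rewrite lee_fin.
have e : a + N.+1%:R * d = d + (a + N%:R * d) by rewrite -natr1; ring.
by congr integral; apply/seteqP; split => x /=; rewrite !in_itv/= e lerDr ltrD2r.
Qed.

(* Bessel's inequality for the shifted Hartley bases, integrated over the shift, bounds the
   L2 norm of the transform without using Plancherel. *)
Lemma hartley_bessel_itv T N u : 0 < T -> L2 u -> supported T u ->
  (\int[mu]_(x in `[(- (N%:R * (pi / T)))%R, (N%:R * (pi / T))%R[) (hartley u x ^+ 2)%:E <= (ip u u)%:E)%E.
Proof.
move=> T0 hu su; set d := pi / T.
have d0 : 0 < d by rewrite divr_gt0// pi_gt0.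
have cU := hartley_continuous hu su.
rewrite [X in `[_, X[%classic](_ : _ = - (N%:R * d) + (N + N)%:R * d); last by rewrite natrD; ring.
rewrite (@integral_tile d _ _ (fun x => hartley u x ^+ 2))//; last first.
- by move=> x; rewrite sqr_ge0.
- by move=> x; apply: cvgM; exact: cU.
(* For each shift the sum of samples is at most [ip u u / d], and the shifts fill an interval of
   length [d]. *)
apply: (@le_trans _ _ (\int[mu]_(s in `[0%R, d[) (cst (d^-1 * ip u u)%:E s))%E).
  apply: ge0_le_integral => //.
  - by move=> x _; rewrite lee_fin sumr_ge0// => k _; rewrite sqr_ge0.
  - apply/measurable_EFinP; apply: measurable_sum => k; apply: measurable_funTS.
    apply: continuous_measurable_fun => x; apply: cvgM;
    apply: (continuous_comp (f := fun s => s + _) (g := hartley u)); try exact: cU;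
    by apply: cvgD; [exact: cvg_id|exact: cvg_cst].
  move=> s _; rewrite /= lee_fin ler_pdivlMl//.
  by under eq_bigr do rewrite addrA; exact: hartley_bessel_sum.
rewrite integral_cst//= lebesgue_measure_itv/= lte_fin d0 oppr0 adde0 -EFinM lee_fin.
by rewrite mulrC mulrA mulfV ?mul1r// gt_eqF.
Qed.

Lemma hartley_L2_le T u : 0 < T -> L2 u -> supported T u ->
  L2 (hartley u) /\ nrm (hartley u) <= nrm u.
Proof.
move=> T0 hu su; set d := pi / T.
have d0 : 0 < d by rewrite divr_gt0// pi_gt0.
have cU := hartley_continuous hu su.
have mU : measurable_fun setT (hartley u) by exact: continuous_measurable_fun.
have key : (\int[mu]_x (hartley u x ^+ 2)%:E <= (ip u u)%:E)%E.
  pose F (N : nat) : set R := `[- (N%:R * d), N%:R * d[%classic.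
  have -> : [set: R] = \bigcup_N F N.
    apply/esym; rewrite -subTset => x _.
    exists (Num.bound (`|x| / d)) => //; rewrite /F/= in_itv/=.
    have : `|x| / d < (Num.bound (`|x| / d))%:R by rewrite archi_boundP// divr_ge0// ltW.
    rewrite ltr_pdivrMr// => h.
    by apply/andP; split; [rewrite lerNl (le_trans _ (ltW h))// -normrN ler_norm|rewrite (le_lt_trans _ h)// ler_norm].
  have ndF : {homo F : n m / (n <= m)%N >-> (n <= m)%O}.
    move=> n m nm; rewrite subsetEset => x; rewrite /F/= !in_itv/= => /andP[h1 h2].
    have h : n%:R * d <= m%:R * d by rewrite ler_pM2r// ler_nat.
    by apply/andP; split; [apply: le_trans h1; rewrite lerN2|apply: lt_le_trans h2 h].
  have c := @ge0_nondecreasing_set_cvg_integral _ (measurableTypeR R) R F (fun x => (hartley u x ^+ 2)%:E) mu ndF.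
  apply: cvge_le (c _ _ _).
  - by apply: nearW => N; exact: hartley_bessel_itv.
  - by move=> i; exact: measurable_itv.
  - by move=> i; apply/measurable_EFinP; apply: measurable_funTS; exact: measurable_funX.
  - by move=> i x _; rewrite lee_fin sqr_ge0.
have hI : integ (fun x => hartley u x ^+ 2).
  apply/integrableP; split; first by apply/measurable_EFinP; exact: measurable_funX.
  under eq_integral do rewrite gee0_abs ?lee_fin ?sqr_ge0//.
  by apply: le_lt_trans key _; exact: ltry.
split; first by split.
apply: ler_wsqrtr; rewrite -lee_fin; apply: le_trans key.
by rewrite Rintegral_EFin.
Qed.

(** The kernel [cas (t * w)] is symmetric in [t] and [w], and its bound 2 makes the double integral
    absolutely convergent. *)
Lemma hartley_fubini u g : integ u -> integ g ->
  \int[mu]_w (hartley u w * g w) = \int[mu]_t (u t * hartley g t).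
Proof.
move=> hu hg; pose c := (Num.sqrt (2 * pi))^-1 : R.
pose F (z : R * R) : R := (c * u z.1) * g z.2 * cas (z.1 * z.2).
have mu_ := integ_measurable hu; have mg := integ_measurable hg.
have mF : measurable_fun setT F.
  apply: measurable_funM; first apply: measurable_funM.
  - apply: measurable_funM; first exact: measurable_cst.
    by apply: measurableT_comp => //; exact: measurable_fst.
  - by apply: measurableT_comp => //; exact: measurable_snd.
  - apply: measurableT_comp; first exact: continuous_measurable_fun continuous_cas.
    by apply: measurable_funM; [exact: measurable_fst|exact: measurable_snd].
have mc t : measurable_fun setT (fun w => cas (t * w)).
  apply: measurableT_comp; first exact: continuous_measurable_fun continuous_cas.
  by apply: measurable_funM => //; exact: measurable_cst.
have mc' w : measurable_fun setT (fun t => cas (t * w)).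
  by under eq_fun do rewrite mulrC; exact: mc.
have ig t : integ (fun w => g w * cas (t * w)).
  by apply: (@integ_mul_bounded _ 2) => // w; exact: norm_cas.
have iu w : integ (fun t => u t * cas (t * w)).
  by apply: (@integ_mul_bounded _ 2) => // t; exact: norm_cas.
have iF : (mu \x mu)%E.-integrable setT (EFin \o F).
  apply/integrable12ltyP; first by apply/measurable_EFinP.
  apply: (@le_lt_trans _ _ (\int[mu]_t ((2 * \int[mu]_w `|g w|) * `|c * u t|)%:E)%E).
    apply: ge0_le_integral => //.
    - by move=> t _; exact: integral_ge0.
    - apply: (@measurable_fun_fubini_tonelli_F _ _ _ _ R mu (fun z => `|(EFin \o F) z|)%E) => //.
      by apply: measurableT_comp => //; apply/measurable_EFinP.
    - apply/measurable_EFinP; apply: measurable_funM; first exact: measurable_cst.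
      by apply: measurableT_comp => //; apply: measurable_funM => //; exact: measurable_cst.
    move=> t _ /=.
    rewrite (_ : (fun w => _) = fun w => (`|F (t, w)|)%:E)//.
    have iFt : integ (fun w => `|F (t, w)|).
      apply: integ_norm; rewrite (_ : (fun w => _) = fun w => (c * u t) * (g w * cas (t * w))); first exact: integZ.
      by apply/funext => w; rewrite /F/= mulrA.
    rewrite Rintegral_EFin// lee_fin mulrAC -RintegralZl//; last exact: integ_norm.
    apply: le_Rintegral => //; [by apply: integZ; exact: integ_norm|].
    move=> w _; rewrite /F/= !normrM [2 * _]mulrC -!mulrA.
    do 2 (rewrite ler_wpM2l//); rewrite mulrC ler_wpM2r//; exact: norm_cas.
  rewrite Rintegral_EFin ?ltry//.
  by apply: integZ; apply: integ_norm; exact: integZ.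
have := Fubini iF.
have -> : (\int[mu]_t \int[mu]_w (EFin \o F) (t, w) = \int[mu]_t (u t * hartley g t)%:E)%E.
  apply: eq_integral => t _.
  rewrite (_ : (fun w => _) = fun w => ((c * u t) * (g w * cas (t * w)))%:E); last first.
    by apply/funext => w; rewrite /F/= mulrA.
  rewrite Rintegral_EFin; last exact: integZ.
  congr (_%:E); rewrite RintegralZl//; last exact: ig.
  rewrite /hartley -/c [RHS](_ : _ = c * u t * \int[mu]_x (g x * cas (x * t))); last by ring.
  by congr (_ * _); congr Rintegral; apply/funext => w; rewrite [w * t]mulrC.
have -> : (\int[mu]_w \int[mu]_t (EFin \o F) (t, w) = \int[mu]_w (hartley u w * g w)%:E)%E.
  apply: eq_integral => w _.
  rewrite (_ : (fun t => _) = fun t => ((c * g w) * (u t * cas (t * w)))%:E); last first.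
    by apply/funext => t; rewrite /F/=; congr (_%:E); ring.
  rewrite Rintegral_EFin; last exact: integZ.
  rewrite RintegralZl//; last exact: iu.
  by rewrite /hartley; congr (_%:E); rewrite -/c; ring.
by rewrite /Rintegral => ->.
Qed.

(** The transform is moved onto the Hermite function, which is an eigenfunction; the support
    condition makes [u] integrable, as [hartley_fubini] requires. *)
Lemma hartley_hcoef T u : L2 u -> supported T u -> forall n,
  exists2 s : R, s ^+ 2 = 1 & ip (hartley u) (hermite_fun n) = s * ip u (hermite_fun n).
Proof.
move=> hu su n; have [s s1 hs] := @hartley_hermite R n; exists s => //.
have iu := supported_integ hu su.
have ih : integ (@hermite_fun R n).
  by rewrite hermite_funE'; apply/integZ/integ_pgauss; rewrite invr_gt0.
rewrite /ip hartley_fubini// -RintegralZl//; last first.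
  by apply: L2_mul => //; exact: L2_hermite.
by congr Rintegral; apply/funext => t; rewrite hs mulrCA.
Qed.

End HartleyBessel.

(** * Completeness of the Hermite functions *)
Section Completeness.
Context {R : realType}.
Local Notation mu := (@lebesgue_measure R).
Implicit Types (e : R -> R) (x y : R) (p q : {poly R}).
Local Notation h := (@hermite_fun R).

Lemma L2_norm e : L2 e -> L2 (fun x => `|e x|).
Proof.
move=> he; apply: (@L2_le _ 1 _ e) => // [|x]; last by rewrite normr_id mul1r.
by apply: measurableT_comp => //; exact: measurable_L2.
Qed.

Lemma X_Hpoly n : 'X * Hpoly n = 2^-1 *: (Hpoly n.+1 + (Hpoly n)^`()) :> {poly R}.
Proof. by rewrite /= subrK scalerA mulVf// scale1r. Qed.

Lemma orth_pgauss e : L2 e -> (forall k, ip e (h k) = 0) -> forall p, ip e (pgauss 2^-1 p) = 0.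
Proof.
move=> he eh p.
have i2 : 0 < 2^-1 :> R by rewrite invr_gt0.
pose L p := ip e (pgauss 2^-1 p).
have LD p1 q1 : L (p1 + q1) = L p1 + L q1.
  rewrite /L -ipDr//; [|exact: L2_pgauss..].
  by congr ip; apply/funext => x; rewrite pgaussD.
have LZ a p1 : L (a *: p1) = a * L p1.
  rewrite /L -ipZr//; last exact: L2_pgauss.
  by congr ip; apply/funext => x; rewrite pgaussZ.
have LH n : L (Hpoly n) = 0.
  have := eh n; rewrite hermite_funE' ipZr//; last exact: L2_pgauss.
  by move/eqP; rewrite mulf_eq0 gt_eqF ?hermite_cst_gt0//= => /eqP.
(* The extra factor [Hpoly n] lets the induction on [p] absorb each ['X] through the three-term
   recurrence, instead of expanding [p] in Hermite polynomials. *)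
suff key n : L (p * Hpoly n) = 0 by have := key 0%N; rewrite mulr1.
elim/poly_ind: p n => [|p a ih] n; first by rewrite mul0r -(scale0r 0) LZ mul0r.
rewrite mulrDl LD mul_polyC LZ LH mulr0 addr0 -mulrA X_Hpoly -scalerAr LZ mulrDr LD ih add0r.
case: n => [|n]; first by rewrite /= -(polyC1 R) derivC mulr0 -(scale0r 0) LZ mul0r mulr0.
by rewrite deriv_Hpoly -scalerAr LZ ih !mulr0.
Qed.

Lemma expR_series_le (x : R) n : `|series (exp_coeff x) n| <= expR `|x|.
Proof.
apply: (@le_trans _ _ (series (exp_coeff `|x|) n)).
  rewrite /series/=; apply: le_trans (ler_norm_sum _ _ _) _; apply: ler_sum => i _.
  by rewrite /exp_coeff/= normrM normfV normrX [X in _ / X]ger0_norm.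
apply: nondecreasing_cvgn_le; last exact: is_cvg_series_exp_coeff.
by apply: nondecreasing_series => i _ _; exact: exp_coeff_ge0.
Qed.

Lemma series_expE (x : R) n : series (exp_coeff x) n = \sum_(i < n) i`!%:R^-1 * x ^+ i.
Proof. by rewrite seriesEord exp_coeffE. Qed.

(* With this rate, [bump y x ^+ (k * k)] crosses 1/2 exactly at [`|x - y| = 4 / k]; being at
   most 1/8, it is small enough for the Gaussian weight to dominate the exponential series of [bump]. *)
Definition bump_rate : R := ln 2 / 16.

Lemma bump_rate_gt0 : 0 < bump_rate.
Proof. by rewrite divr_gt0// ln_gt0// ltr1n. Qed.

Lemma bump_rate_le : bump_rate <= 8^-1.
Proof.
have l : ln 2 <= 1 :> R.
  have e1 := expR_ge1Dx (1 : R).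
  have : ln 2 <= ln (expR 1) :> R by rewrite ler_ln ?posrE ?expR_gt0//; lra.
  by rewrite expRK.
rewrite /bump_rate; lra.
Qed.

Definition bump y x : R := expR (- (bump_rate * (x - y) ^+ 2)).

Lemma bump_ge0 y x : 0 <= bump y x. Proof. exact: expR_ge0. Qed.

Lemma bump_le1 y x : bump y x <= 1.
Proof. by rewrite -expR0 ler_expR oppr_le0 mulr_ge0 ?sqr_ge0// ltW// bump_rate_gt0. Qed.

Lemma bump_continuous y : continuous (bump y).
Proof.
move=> x; apply: continuous_comp; last exact: continuous_expR.
apply: cvgN; apply: cvgM; first exact: cvg_cst.
by rewrite expr2; under eq_fun do rewrite expr2; apply: cvgM; (apply: cvgB; [exact: cvg_id|exact: cvg_cst]).
Qed.

(** One factor [bump y] is expanded at a time, as the exponential series of the polynomial [P]: its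
    terms fall under the induction hypothesis. Expanding [bump y x ^+ j] at once would need a
    majorant of rate [j * bump_rate], which for large [j] outgrows the Gaussian. *)
Lemma orth_bump e y : L2 e -> (forall p, ip e (pgauss 2^-1 p) = 0) ->
  forall j p, integ (fun x => e x * pgauss 2^-1 p x * bump y x ^+ j) /\
   \int[mu]_x (e x * pgauss 2^-1 p x * bump y x ^+ j) = 0.
Proof.
move=> he eh.
have i2 : 0 < 2^-1 :> R by rewrite invr_gt0.
have mb j : measurable_fun setT (fun x => bump y x ^+ j).
  by apply: measurable_funX; apply: continuous_measurable_fun; exact: bump_continuous.
have ib j p : integ (fun x => e x * pgauss 2^-1 p x * bump y x ^+ j).
  apply: (@integ_mul_bounded _ 1) => //; first by apply: L2_mul => //; exact: L2_pgauss.
  move=> x; rewrite ger0_norm ?exprn_ge0 ?bump_ge0//.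
  by rewrite exprn_ile1 ?bump_le1 ?bump_ge0.
elim => [|j ih] p; split => //.
  by have := eh p; rewrite /ip => hp; under eq_Rintegral do rewrite expr0 mulr1.
pose P : {poly R} := - (bump_rate *: ('X - y%:P) ^+ 2).
have PE x : P.[x] = - (bump_rate * (x - y) ^+ 2).
  by rewrite /P !(hornerE, horner_exp).
pose f N x := e x * pgauss 2^-1 p x * bump y x ^+ j * series (exp_coeff P.[x]) N.
have fE N : f N = fun x => \sum_(i < N) (e x * pgauss 2^-1 (i`!%:R^-1 *: (P ^+ i * p)) x * bump y x ^+ j).
  apply/funext => x; rewrite /f series_expE mulr_sumr; apply: eq_bigr => i _.
  by rewrite pgaussZ /pgauss hornerM horner_exp; ring.
have if0 N : integ (f N) by rewrite fE; apply: integ_sum => i; exact: ib.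
have f0 N : \int[mu]_x f N x = 0.
  elim: N => [|N ihN].
    by rewrite fE; under eq_Rintegral do rewrite big_ord0; rewrite Rintegral_cst// mul0r.
  rewrite (_ : (fun x => _) = fun x => f N x + e x * pgauss 2^-1 (N`!%:R^-1 *: (P ^+ N * p)) x * bump y x ^+ j); last first.
    by apply/funext => x; rewrite !fE big_ord_recr.
  rewrite RintegralD//; [by rewrite ihN (ih _).2 addr0|exact: if0|exact: (ih _).1].
pose G x := `|e x| * (expR (y ^+ 2 / 4) * `|pgauss (4^-1) p x|).
have iG : integ G.
  apply: L2_mul; first exact: L2_norm.
  by apply: L2Z; apply: L2_norm; apply: L2_pgauss; rewrite invr_gt0.
have [||||_ c] := @DCT _ f (fun x => e x * pgauss 2^-1 p x * bump y x ^+ j.+1) G.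
- by move=> N; exact: integ_measurable.
- exact: iG.
- move=> x; rewrite /f exprSr mulrA; apply: cvgM; first exact: cvg_cst.
  by rewrite /bump -PE; exact: is_cvg_series_exp_coeff.
- move=> x N; rewrite /f /G; pose E := expR (y ^+ 2 / 4).
  (* Since the square of [x - y] is at most [2 x ^+ 2 + 2 y ^+ 2], a rate of at most 1/8 consumes
     only half of the Gaussian exponent, and [y] enters through the constant [E]. *)
  have hP : expR (- (2^-1 * x ^+ 2)) * expR `|P.[x]| <= E * expR (- (4^-1 * x ^+ 2)).
    have P0 : 0 <= bump_rate * (x - y) ^+ 2 by apply: mulr_ge0; [exact: ltW bump_rate_gt0|exact: sqr_ge0].
    rewrite -!expRD ler_expR PE normrN ger0_norm//.
    have : bump_rate * (x - y) ^+ 2 <= 8^-1 * (x - y) ^+ 2 by rewrite ler_wpM2r ?sqr_ge0 ?bump_rate_le.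
    have := sqr_ge0 (x + y); lra.
  rewrite /pgauss !normrM !(ger0_norm (expR_ge0 _)) -/E.
  apply: (@le_trans _ _ (`|e x| * (`|p.[x]| * expR (- (2^-1 * x ^+ 2))) * 1 * expR `|P.[x]|)).
    apply: ler_pM; rewrite ?mulr_ge0 ?expR_ge0 ?normr_ge0//; last exact: expR_series_le.
    rewrite ler_wpM2l ?mulr_ge0 ?expR_ge0//.
    by rewrite normrX exprn_ile1// ger0_norm ?bump_ge0 ?bump_le1.
  by rewrite mulr1 -(mulrA `|e x|) ler_wpM2l// -(mulrA `|p.[x]|) [leRHS]mulrCA ler_wpM2l.
move: c; under eq_fun do rewrite f0.
move=> c.
by apply: (cvg_unique _ c (cvg_cst _)); exact: Rhausdorff.
Qed.

Lemma bernoulli_ge (x : R) n : 0 <= x <= 1 -> 1 - n%:R * x <= (1 - x) ^+ n.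
Proof.
move=> /andP[x0 x1]; elim: n => [|n ih]; first by rewrite mul0r subr0 expr0.
rewrite exprS; apply: (@le_trans _ _ ((1 - x) * (1 - n%:R * x))); last first.
  by rewrite ler_wpM2l// subr_ge0.
rewrite -natr1; have : 0 <= n%:R * (x * x) by rewrite mulr_ge0// mulr_ge0.
lra.
Qed.

Lemma expR_N1_le (x : R) : 1 - x <= expR (- x).
Proof. exact: expR_ge1Dx. Qed.

(* For [a] in [0, 1] the powers below converge to the indicator of [a < 1/2]. *)
Lemma threshold_cvg1 (a : R) : 0 <= a -> a < 2^-1 ->
  (1 - a ^+ N) ^+ (2 ^ N) @[N --> \oo] --> (1 : R).
Proof.
move=> a0 a2.
(* Bernoulli's inequality gives this lower bound, since [2 ^ N] factors each lose [a ^+ N]. *)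
have h : 1 - (2 * a) ^+ N @[N --> \oo] --> (1 : R).
  rewrite -[X in _ --> X]subr0; apply: cvgB; first exact: cvg_cst.
  have := @cvg_geometric R 1 (2 * a); rewrite -exprn_geometric; apply.
  rewrite ger0_norm ?mulr_ge0//; lra.
apply: (squeeze_cvgr _ h (cvg_cst (1 : R))); apply: nearW => N.
have aN : 0 <= a ^+ N <= 1 by rewrite exprn_ge0//= exprn_ile1//; lra.
apply/andP; split.
  by rewrite exprMn -natrX; exact: bernoulli_ge.
by case/andP: aN => h1 h2; rewrite exprn_ile1//; lra.
Qed.

Lemma threshold_cvg0 (a : R) : 2^-1 < a -> a <= 1 ->
  (1 - a ^+ N) ^+ (2 ^ N) @[N --> \oo] --> (0 : R).
Proof.
move=> a2 a1; have a0 : 0 < a by lra.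
have h : (2 * a)^-1 ^+ N @[N --> \oo] --> (0 : R).
  have := @cvg_geometric R 1 (2 * a)^-1; rewrite -exprn_geometric; apply.
  rewrite ger0_norm ?invr_ge0 ?mulr_ge0 ?ltW// invf_lt1; lra.
apply: (squeeze_cvgr _ (cvg_cst 0) h); apply: nearW => N.
have aN : 0 < a ^+ N <= 1 by rewrite exprn_gt0//= exprn_ile1// ltW.
case/andP: aN => aN0 aN1.
apply/andP; split; first by rewrite exprn_ge0// subr_ge0.
(* With [x = a ^+ N] and [m = 2 ^ N]: the power is at most [exp (- m x)], hence at most [1 / (m x)],
   and [m x] is the N-th power of [2 a > 1]. *)
apply: (@le_trans _ _ (expR (- a ^+ N) ^+ (2 ^ N))).
  by apply: lerXn2r; rewrite ?nnegrE ?expR_ge0 ?subr_ge0//; exact: expR_N1_le.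
rewrite -expRM_natl natrX mulrN -exprMn expRN exprVn lef_pV2 ?posrE ?expR_gt0 ?exprn_gt0 ?mulr_gt0//.
by apply: le_trans (expR_ge1Dx _); rewrite lerDr.
Qed.

Lemma bump_pow y x k : bump y x ^+ (k * k) = expR (- (ln 2 * (k%:R * (x - y) / 4) ^+ 2)).
Proof. by rewrite /bump -expRM_natl natrM /bump_rate; congr expR; field. Qed.

Lemma half_expR : 2^-1 = expR (- ln 2) :> R.
Proof. by rewrite expRN lnK// posrE. Qed.

Lemma bump_gt_half y x k : (2^-1 < bump y x ^+ (k * k)) = (`|k%:R * (x - y) / 4| < 1).
Proof.
rewrite bump_pow half_expR ltr_expR ltrN2 gtr_pMr ?ln_gt0 ?ltr1n//.
by rewrite -[_ ^+ 2]real_normK ?num_real// -[X in _ < X](expr1n _ 2) ltr_pXn2r ?nnegrE.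
Qed.

Lemma bump_lt_half y x k : (bump y x ^+ (k * k) < 2^-1) = (1 < `|k%:R * (x - y) / 4|).
Proof.
rewrite bump_pow half_expR ltr_expR ltrN2 ltr_pMr ?ln_gt0 ?ltr1n//.
by rewrite -[_ ^+ 2]real_normK ?num_real// -[X in X < _](expr1n _ 2) ltr_pXn2r ?nnegrE.
Qed.

(** All polynomials in [bump y] integrate to 0 against [F]. The polynomials [r N] stay in [0, 1] and
    converge to the indicator of the points where [bump y x ^+ (k * k)] exceeds 1/2, which is the
    ball. *)
Lemma orth_ball e y k : L2 e -> (forall p, ip e (pgauss 2^-1 p) = 0) -> (0 < k)%N ->
  \int[mu]_(x in ball y (4 / k%:R)) (e x * pgauss 2^-1 1 x) = 0.
Proof.
move=> he eh k0; have hb := orth_bump y he eh.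
have k0' : 0 < k%:R :> R by rewrite ltr0n.
pose F x := e x * pgauss 2^-1 1 x.
have iF : integ F by have := (hb 0%N 1).1; under eq_fun do rewrite expr0 mulr1.
have poly0 (r : {poly R}) : integ (fun x => F x * r.[bump y x]) /\ \int[mu]_x (F x * r.[bump y x]) = 0.
  have e1 : (fun x => F x * r.[bump y x]) = fun x => \sum_(i < size r) r`_i * (F x * bump y x ^+ i).
    by apply/funext => x; rewrite horner_coef mulr_sumr; apply: eq_bigr => i _; ring.
  rewrite e1; split; first by apply: integ_sum => i; apply: integZ; exact: (hb _ _).1.
  elim: (size r) => [|n ih].
    by under eq_Rintegral do rewrite big_ord0; rewrite Rintegral_cst// mul0r.
  under eq_Rintegral do rewrite big_ord_recr/=.
  rewrite RintegralD//; [|by apply: integ_sum => i; apply: integZ; exact: (hb _ _).1|by apply: integZ; exact: (hb _ _).1].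
  by rewrite ih RintegralZl//; [rewrite (hb _ _).2 mulr0 addr0|exact: (hb _ _).1].
pose r N : {poly R} := 1 - (1 - 'X^(k * k) ^+ N) ^+ (2 ^ N).
have rE N z : (r N).[z] = 1 - (1 - (z ^+ (k * k)) ^+ N) ^+ (2 ^ N).
  by rewrite /r !(hornerE, horner_exp).
have mB : measurable (ball y (4 / k%:R)) by exact: measurable_ball.
have [|||||_ c] := @DCT_ae _ (fun N x => F x * (r N).[bump y x])
   (fun x => \1_(ball y (4 / k%:R)) x * F x) (fun x => `|F x|).
- by move=> N; apply: integ_measurable; exact: (poly0 _).1.
- by apply: indic_mul_measurable => //; exact: integ_measurable.
- exact: integ_norm.
- have nb (z : R) : `|k%:R * (z - y) / 4| = k%:R / 4 * `|y - z|.
    by rewrite !normrM normfV (distrC z y) normr_nat [`|4|]ger0_norm// mulrAC.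
  have bE (z : R) : (`|k%:R * (z - y) / 4| < 1) = (`|y - z| < 4 / k%:R).
    by rewrite nb mulrC -ltr_pdivlMr ?divr_gt0// div1r invf_div.
  (* At the two end points the thresholded quantity is exactly 1/2 and [r N] tends to [1 - 1/e], so
     they form the exceptional null set. *)
  exists [set y - 4 / k%:R; y + 4 / k%:R]; split.
  - by apply: measurableU; exact: measurable_set1.
  - apply: countable_lebesgue_measure0; apply: finite_set_countable; exact: finite_set2.
  move=> x /=; apply: contra_notP => nx.
  have b1 : 0 <= bump y x ^+ (k * k) <= 1 by rewrite exprn_ge0 ?bump_ge0// exprn_ile1 ?bump_ge0 ?bump_le1.
  rewrite indicE; case: (ltrgtP `|k%:R * (x - y) / 4| 1) => h.
  + rewrite mem_set; last by move: h; rewrite bE.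
    rewrite mul1r -[X in _ --> X]mulr1; apply: cvgM; first exact: cvg_cst.
    rewrite -[X in _ --> X]subr0; under eq_fun do rewrite rE; apply: cvgB; first exact: cvg_cst.
    by apply: threshold_cvg0; [rewrite bump_gt_half|case/andP: b1].
  + rewrite memNset; last first.
      by move: (h) => /ltW; rewrite leNgt bE => /negP.
    rewrite mul0r -[X in _ --> X](mulr0 (F x)); apply: cvgM; first exact: cvg_cst.
    rewrite -(subrr (1:R)); under eq_fun do rewrite rE; apply: cvgB; first exact: cvg_cst.
    by apply: threshold_cvg1; [case/andP: b1|rewrite bump_lt_half].
  + exfalso; apply: nx; move: h; rewrite nb => h.
    have {}h : `|y - x| = 4 / k%:R by apply: (mulfI (x := k%:R / 4)); rewrite ?h ?mulf_neq0 ?gt_eqF//; field; rewrite gt_eqF.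
    have [yx|yx] := leP 0 (y - x).
      by left; rewrite -h ger0_norm//; ring.
    by right; rewrite -h ltr0_norm//; ring.
- apply: aeW => x N; rewrite normrM ler_piMr// rE.
  have b1 : 0 <= (bump y x ^+ (k * k)) ^+ N <= 1.
    by rewrite -exprM exprn_ge0 ?bump_ge0// exprn_ile1 ?bump_ge0 ?bump_le1.
  case/andP: b1 => b0 b1.
  have : 0 <= (1 - (bump y x ^+ (k * k)) ^+ N) ^+ (2 ^ N) <= 1.
    by rewrite exprn_ge0 ?subr_ge0// exprn_ile1 ?subr_ge0// lerBlDr lerDl.
  by move=> /andP[c0 c1]; rewrite ler_norml; lra.
have {}c : 0 = \int[mu]_x (\1_(ball y (4 / k%:R)) x * F x).
  move: c; under eq_fun do rewrite (poly0 _).2.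
  by move=> c; apply: (cvg_unique _ (cvg_cst _) c); exact: Rhausdorff.
by rewrite Rintegral_indic in c.
Qed.

(** At a Lebesgue point [y] of [F], the mean of [|F - F y|] tends to 0 with the radius. Over a ball
    of radius [4 / k], however, [F] has mean 0, so that mean is at least [|F y|]. *)
Lemma orth_hermite_ae0 e : L2 e -> (forall k, ip e (h k) = 0) ->
  {ae mu, forall x, e x = 0}.
Proof.
move=> he eh; have pe := orth_pgauss he eh.
have i2 : 0 < 2^-1 :> R by rewrite invr_gt0.
pose F x := e x * pgauss 2^-1 1 x.
have iF : integ F by apply: L2_mul => //; exact: L2_pgauss.
have lF : locally_integrable setT F by apply: open_integrable_locally; [exact: openT|exact: iF].
apply: (@filterS _ _ (ae_filter_ringOfSetsType mu) _ _ _ (lebesgue_differentiation lF)) => y /= ly.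
suff : F y = 0.
  by move/eqP; rewrite mulf_eq0 /pgauss hornerC mul1r [expR _ == 0]gt_eqF ?expR_gt0// orbF => /eqP.
apply/eqP; apply: contrapT => /negP Fy.
have Fy0 : 0 < `|F y| by rewrite normr_gt0.
have : nbhs 0^'+ [set r | (davg F y r < (`|F y|)%:E)%E].
  have hn : nbhs (0%:E : \bar R) [set z | (z < (`|F y|)%:E)%E].
    exact: (@nbhs_open_ereal_lt _ 0 (fun=> `|F y|)).
  by move: ly; rewrite /lebesgue_pt => /(_ _ hn).
move=> [d /= d0 hd].
pose k := (Num.bound (4 / d)).+1; pose r : R := 4 / k%:R.
have k0 : 0 < k%:R :> R by rewrite ltr0n.
have r0 : 0 < r by rewrite divr_gt0.
have rd : r < d.
  rewrite /r ltr_pdivrMr// mulrC -ltr_pdivrMr//.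
  have : 4 / d < (Num.bound (4 / d))%:R by rewrite archi_boundP// divr_ge0// ltW.
  by move/lt_trans; apply; rewrite ltr_nat.
have mB : measurable (ball y r) by exact: measurable_ball.
have muB : mu (ball y r) = (2 * r)%:E.
  by rewrite lebesgue_measure_ball ?ltW// mulr_natl.
have := hd r; rewrite /ball_/= sub0r normrN gtr0_norm// => /(_ rd r0).
have iC : mu.-integrable (ball y r) (EFin \o cst (F y)).
  apply/integrableP; split; first by apply/measurable_EFinP; exact: measurable_cst.
  rewrite (_ : (fun x => _) = cst (`|F y|)%:E)// integral_cst// [X in (_ * X)%E]muB.
  by rewrite -EFinM ltry.
have c : (`|F y|%:E <= davg F y r)%E.
  have iB : mu.-integrable (ball y r) (EFin \o (fun x => F x - F y)).
    have := @integrableB _ _ _ mu (ball y r) mB (EFin \o F) (EFin \o cst (F y)).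
    apply; first by apply: integrableS iF.
    exact: iC.
  rewrite /davg /iavg [X in (X^-1)%E]muB inver mulf_eq0 !gt_eqF//=.
  have hI : `|\int[mu]_(x in ball y r) (F x - F y)| = `|F y| * (2 * r).
    rewrite RintegralB//; last by apply: integrableS iF.
    rewrite (orth_ball y he pe)// sub0r normrN Rintegral_cst//.
    have -> : fine (mu (ball y r)) = 2 * r by exact: (congr1 fine muB).
    by rewrite normrM [`|2 * r|]ger0_norm// mulr_ge0// ltW.
  have h1 : `|F y| * (2 * r) <= \int[mu]_(x in ball y r) `|F x - F y|.
    by rewrite -hI; apply: le_normr_Rintegral => //; exact: iB.
  have e1 : (\int[mu]_(x in ball y r) `|(F x - F y)%:E| = (\int[mu]_(x in ball y r) `|F x - F y|)%:E)%E.
    rewrite /Rintegral fineK//; apply: integrable_fin_num => //.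
    exact: (integrable_norm iB).
  rewrite [X in (_ <= _ * X)%E](_ : _ = (\int[mu]_(x in ball y r) `|F x - F y|)%:E); last exact: e1.
  have r20 : 0 < 2 * r by rewrite mulr_gt0.
  by rewrite -EFinM lee_fin ler_pdivlMl// [X in X <= _]mulrC.
by rewrite ltNge c.
Qed.

Lemma orth_hermite_nrm0 e : L2 e -> (forall k, ip e (h k) = 0) -> nrm e = 0.
Proof.
move=> he eh; have ae0 := orth_hermite_ae0 he eh.
rewrite /nrm (_ : ip e e = 0) ?sqrtr0// /ip /Rintegral.
rewrite (@ae_eq_integral _ _ _ mu setT (cst 0%E)); rewrite ?integral_cst ?mul0e//.
- by apply/measurable_EFinP; apply: measurable_funM; exact: measurable_L2.
- by apply: (@filterS _ _ (ae_filter_ringOfSetsType mu) _ _ _ ae0) => x ex _; rewrite ex mulr0.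
Qed.

(** The squared distance between two residuals is a difference of the convergent sums [a], so a
    subsequence of residuals has a limit [l] in L2. All coefficients of [l] vanish, hence
    [nrm l = 0] and the residuals become small; their norms do not increase, so they stay small. *)
Lemma hermite_parseval v (eps : R) : L2 v -> 0 < eps ->
  exists N0, forall N, (N0 <= N)%N -> ip v v - \sum_(k < N) ip v (h k) ^+ 2 <= eps.
Proof.
move=> hv eps0; pose a N : R := \sum_(k < N) ip v (h k) ^+ 2.
have nda : {homo a : n m / (n <= m)%N >-> n <= m}.
  move=> n m nm; rewrite -(subnKC nm) /a big_split_ord/= lerDl.
  by apply: sumr_ge0 => i _; exact: sqr_ge0.
have uba N : a N <= ip v v by apply: bessel => //; exact: orthonormal_hermite.
have ca : cvgn a by apply: nondecreasing_is_cvgn => //; exists (ip v v) => _ [N _ <-].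
have aL N : a N <= limn a by exact: nondecreasing_cvgn_le.
pose res N x := v x - fproj N h v x.
have hres N : L2 (res N) by apply: L2B => //; exact: L2_fproj (orthonormal_hermite N).
have ipres N k : (k < N)%N -> ip (res N) (h k) = 0.
  move=> kN; rewrite ipBl//; [|exact: L2_fproj (orthonormal_hermite N)|exact: L2_hermite].
  by rewrite (@ip_fproj _ N h v (Ordinal kN) (orthonormal_hermite N)) subrr.
have resB n m : (n <= m)%N -> nrm (fun x => res m x - res n x) ^+ 2 = a m - a n.
  move=> nm; rewrite sqr_nrm ipBl//; last exact: L2B.
  have e0 N M : (N <= M)%N -> ip (res M) (res N) = ip v v - a M.
    move=> NM; rewrite -nrm_sub_fproj//; last exact: orthonormal_hermite.
    rewrite -/(res M) !ipBr//; try exact: L2_fproj (orthonormal_hermite _).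
    congr (_ - _).
    have z K : (K <= M)%N -> ip (res M) (fproj K h v) = 0.
      move=> KM; rewrite ipC ip_suml//; last by move=> i; apply: L2Z; exact: L2_hermite.
      rewrite big1// => i _; rewrite ipZl//; last exact: L2_hermite.
      by rewrite (ipC (h i)) ipres ?mulr0// (leq_trans (ltn_ord i)).
    by rewrite !z.
  rewrite (ipBr (hres m) (hres n) (hres m)) (ipBr (hres m) (hres n) (hres n)).
  rewrite (ipC (res n) (res m)) (e0 m m)// (e0 n m)// (e0 n n)//; ring.
have ex j : exists N, limn a - a N <= (4^-1) ^+ j.
  have h0 : 0 < (4^-1 : R) ^+ j by rewrite exprn_gt0// invr_gt0.
  move/cvgrPdist_le : (ca) => /(_ _ h0)[N _ hN]; exists N.
  by apply: le_trans (hN N _) => //=; exact: ler_norm.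
have [psi hpsi] := choice ex.
(* The sum makes [phi] nondecreasing and at least [psi]; the summand [j] ensures that every index
   [k] is eventually below [phi j]. *)
pose phi j := (j + \sum_(i < j.+1) psi i)%N.
have phiS j : (phi j <= phi j.+1)%N by rewrite /phi [X in (_ <= _ + X)%N]big_ord_recr/= leq_add// leq_addr.
have phipsi j : (psi j <= phi j)%N by rewrite /phi big_ord_recr/= addnA leq_addl.
have phij j : (j <= phi j)%N by rewrite /phi leq_addr.
have [|l [hl cl]] := @riesz_fischer R (fun j => res (phi j)) (fun j => hres (phi j)).
- move=> j; rewrite -(@ler_pXn2r _ 2) ?nnegrE ?nrm_ge0 ?exprn_ge0 ?invr_ge0//.
  rewrite resB// -exprM mulnC exprM (_ : 2^-1 ^+ 2 = 4^-1 :> R); last by field.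
  apply: le_trans (hpsi j); have := nda _ _ (phipsi j); have := aL (phi j.+1); lra.
have l0 : nrm l = 0.
  apply: orth_hermite_nrm0 => // k.
  have cz : nrm (fun x => res (phi j) x - l x) * nrm (h k) @[j --> \oo] --> (0 : R).
    by rewrite -[X in _ --> X](mul0r (nrm (h k))); apply: cvgM => //; exact: cvg_cst.
  apply/eqP; rewrite -normr_le0.
  have : (fun=> `|ip l (h k)|) @ \oo --> (`|ip l (h k)| : R) by exact: cvg_cst.
  move=> c1; apply: ler_cvg_to c1 cz _; near=> j.
  have jk : (k < phi j)%N.
    by apply: leq_trans (phij j); near: j; exact: nbhs_infty_gt.
  have hk : L2 (h k) by exact: L2_hermite.
  have -> : `|ip l (h k)| = `|ip (fun x => res (phi j) x - l x) (h k)|.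
    by rewrite ipBl// ipres// sub0r normrN.
  by apply: ip_norm_le => //; exact: L2B.
have [j hj] : exists j, nrm (res (phi j)) ^+ 2 <= eps.
  have se : 0 < Num.sqrt eps by rewrite sqrtr_gt0.
  move/cvgrPdist_le : cl => /(_ _ se)[j _ hj]; exists j.
  have {}hj := hj j (leqnn j).
  rewrite sub0r normrN ger0_norm ?nrm_ge0// in hj.
  rewrite -(sqr_sqrtr (ltW eps0)) ler_sqr ?nnegrE ?nrm_ge0 ?sqrtr_ge0//.
  apply: le_trans hj; rewrite -[leRHS]addr0 -l0.
  apply: le_trans (nrmD _ _) => //; last exact: L2B.
  by rewrite le_eqVlt; apply/orP; left; apply/eqP; congr nrm; apply/funext => x; rewrite subrK.
exists (phi j) => N jN; apply: le_trans hj.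
rewrite sqr_nrm nrm_sub_fproj//; last exact: orthonormal_hermite.
by rewrite lerD2l lerN2; exact: nda.
Unshelve. all: by end_near. Qed.

End Completeness.

(** * Cutoff and tail estimate *)
Section Cutoff.
Context {R : realType}.
Local Notation mu := (@lebesgue_measure R).
Implicit Types (f g u : R -> R) (x w t : R).

(** Reflections enter through [is_derive_hartley] and through the even and odd parts in [mix1] and
    [mix2]. *)
Lemma L2_reflect f : L2 f -> L2 (fun x => f (- x)) /\ nrm (fun x => f (- x)) = nrm f.
Proof.
move=> [mf f2].
have mf' : measurable_fun setT (fun x => f (- x)) by apply: measurableT_comp => //; exact: oppr_measurable.
have m2 : measurable_fun setT (fun x => (f x ^+ 2)%:E) by apply/measurable_EFinP; exact: measurable_funX.
have e : (\int[mu]_x (f (- x) ^+ 2)%:E = \int[mu]_x (f x ^+ 2)%:E)%E.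
  rewrite [RHS](@integral_reflect R setT (fun x => (f x ^+ 2)%:E)) ?preimage_setT//.
  by move=> x _; rewrite lee_fin sqr_ge0.
have i2 : integ (fun x => f (- x) ^+ 2).
  apply/integrableP; split; first by apply/measurable_EFinP; exact: measurable_funX.
  under eq_integral do rewrite gee0_abs ?lee_fin ?sqr_ge0//.
  by rewrite e Rintegral_EFin// ltry.
by split; [split|rewrite /nrm /ip /Rintegral e].
Qed.

(** Smoothness is asked on [seg r] only, because the function integrated by parts later has poles
    farther out, where [w ^+ 2 = 2 k + 1]. *)
Lemma FTC_seg f f' (r : R) : 0 < r -> (forall x, `|x| <= r -> is_derive x 1 f (f' x)) ->
  (forall x, `|x| <= r -> {for x, continuous f'}) ->
  \int[mu]_(x in seg r) f' x = f r - f (- r).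
Proof.
move=> r0 df cf'; have cf x (xr : `|x| <= r) := is_derive_continuous (df x xr).
have h x : x \in `[- r, r] -> `|x| <= r by rewrite in_itv/= -ler_norml.
rewrite segE /Rintegral (@continuous_FTC2 R f' f)//; first by lra.
- apply: continuous_in_subspaceT => x; rewrite inE => /h; exact: cf'.
- split.
  + move=> x xr; apply: ex_derive; apply: df; apply: h; exact: subset_itv_oo_cc xr.
  + by apply: cvg_at_right_filter; apply: cf; rewrite normrN gtr0_norm.
  + by apply: cvg_at_left_filter; apply: cf; rewrite gtr0_norm.
- by move=> x xr; apply: is_derive_derive1; apply: df; apply: h; exact: subset_itv_oo_cc xr.
Qed.

Lemma measurable_indic_seg f (r : R) : (forall x, `|x| <= r -> {for x, continuous f}) ->
  measurable_fun setT (fun x => \1_(seg r) x * f x).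
Proof.
move=> cf; have m : measurable_fun (seg r) f.
  apply: subspace_continuous_measurable_fun; first exact: measurable_seg.
  by apply: continuous_in_subspaceT => x; rewrite inE => /cf.
have := (measurable_restrictT f (measurable_seg r)).1 m.
rewrite (_ : f \_ _ = fun x => \1_(seg r) x * f x)//.
by apply/funext => x; rewrite /patch indicE; case: ifPn; rewrite ?mul1r ?mul0r.
Qed.

Lemma is_derive_opp f x (df : R) : is_derive x 1 f df -> is_derive x 1 (fun y => - f y) (- df).
Proof. exact: is_deriveN. Qed.

Lemma is_derive_xabs x : is_derive x 1 (fun y : R => y * `|y|) (2 * `|x|).
Proof.
have [x0|x0|->] := ltgtP x 0.
- have h : is_derive x 1 (fun y : R => - (y * y)) (2 * `|x|).
    rewrite ltr0_norm//; apply: is_derive_val_eq (is_derive_opp (is_derive_mul (is_derive_idfun x) (is_derive_idfun x))) _; ring.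
  apply: near_eq_is_derive h.
  near=> y; rewrite ltr0_norm ?mulrN//=; near: y; exact: lt_nbhsl.
- have h : is_derive x 1 (fun y : R => y * y) (2 * `|x|).
    rewrite gtr0_norm//; apply: is_derive_val_eq (is_derive_mul (is_derive_idfun x) (is_derive_idfun x)) _; ring.
  apply: near_eq_is_derive h.
  near=> y; rewrite gtr0_norm//=; near: y; exact: lt_nbhsr.
rewrite normr0 mulr0.
have c : h^-1 *: ((fun y : R => y * `|y|) (h *: (1 : R) + 0) - 0 * `|0 : R|) @[h --> (0:R)^'] --> (0 : R).
  have c0 : `|h| @[h --> (0:R)^'] --> (0 : R).
    by rewrite -[X in _ --> X](@normr0 _ R); apply: cvg_within_filter; exact: norm_continuous.
  apply: cvg_trans c0; apply: near_eq_cvg; near=> h.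
  rewrite /GRing.scale/= mulr1 addr0 mul0r subr0 mulrA mulVf ?mul1r//.
  by near: h; exact: nbhs_dnbhs_neq.
by apply: DeriveDef; [apply/cvg_ex; exists 0|exact: cvg_lim].
Unshelve. all: by end_near. Qed.

(* max(0, x)^3 and its first two derivatives, written with absolute values. *)
Definition cub x : R := (x * x * x + x * (x * `|x|)) / 2.
Definition cub1 x : R := 3 * (x * x + x * `|x|) / 2.
Definition cub2 x : R := 3 * (x + `|x|).

Lemma cubE x : cub x = if 0 <= x then x ^+ 3 else 0.
Proof. by rewrite /cub; case: (lerP 0 x) => x0; [rewrite ger0_norm//|rewrite ltr0_norm//]; field. Qed.

Lemma cub1E x : cub1 x = if 0 <= x then 3 * x ^+ 2 else 0.
Proof. by rewrite /cub1; case: (lerP 0 x) => x0; [rewrite ger0_norm//|rewrite ltr0_norm//]; field. Qed.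

Lemma cub2E x : cub2 x = if 0 <= x then 6 * x else 0.
Proof. by rewrite /cub2; case: (lerP 0 x) => x0; [rewrite ger0_norm//|rewrite ltr0_norm//]; ring. Qed.

Lemma is_derive_cub x : is_derive x 1 cub (cub1 x).
Proof.
have h := is_derive_add (is_derive_mul (is_derive_mul (is_derive_idfun x) (is_derive_idfun x)) (is_derive_idfun x)) (is_derive_mul (is_derive_idfun x) (is_derive_xabs x)).
by apply: is_derive_val_eq (is_derive_mul h (is_derive_const 2^-1 x)) _; rewrite /cub1; field.
Qed.

Lemma is_derive_cub1 x : is_derive x 1 cub1 (cub2 x).
Proof.
have h := is_derive_add (is_derive_mul (is_derive_idfun x) (is_derive_idfun x)) (is_derive_xabs x).
by apply: is_derive_val_eq (is_derive_mul (is_derive_scale 3 h) (is_derive_const 2^-1 x)) _; rewrite /cub2; field.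
Qed.

Lemma continuous_cub2 : continuous cub2.
Proof.
move=> x; apply: cvgM; first exact: cvg_cst.
by apply: cvgD; [exact: cvg_id|exact: norm_continuous].
Qed.

Lemma cub_bounds x : x <= 1 -> [/\ 0 <= cub x <= 1, 0 <= cub1 x <= 3 & 0 <= cub2 x <= 6].
Proof.
move=> x1; rewrite cubE cub1E cub2E; case: ifPn => [x0|_]; last by split; lra.
split; last lra.
- by rewrite exprn_ge0// exprn_ile1.
- by rewrite mulr_ge0 ?exprn_ge0// ler_piMr// exprn_ile1.
Qed.

(* A C^2 cutoff in closed form: 1 on [2 x^2 <= 1], 0 on [`|x| >= 1]. *)
Definition chi x : R := cub (1 - cub (2 * (x * x) - 1)).
Definition chi1 x : R := cub1 (1 - cub (2 * (x * x) - 1)) * - (cub1 (2 * (x * x) - 1) * (4 * x)).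
Definition chi2 x : R :=
  cub2 (1 - cub (2 * (x * x) - 1)) * (cub1 (2 * (x * x) - 1) * (4 * x)) ^+ 2
  - cub1 (1 - cub (2 * (x * x) - 1)) *
    (cub2 (2 * (x * x) - 1) * (4 * x) ^+ 2 + cub1 (2 * (x * x) - 1) * 4).

Lemma is_derive_chi_arg x : is_derive x 1 (fun y => 2 * (y * y) - 1 : R) (4 * x).
Proof.
apply: is_derive_val_eq (is_derive_sub (is_derive_scale 2 (is_derive_mul (is_derive_idfun x) (is_derive_idfun x))) (is_derive_const 1 x)) _; ring.
Qed.

Lemma is_derive_chi_in x : is_derive x 1 (fun y => 1 - cub (2 * (y * y) - 1) : R)
  (- (cub1 (2 * (x * x) - 1) * (4 * x))).
Proof.
have h := @is_derive_compose R cub (fun y => 2 * (y * y) - 1) x _ _ (is_derive_cub _) (is_derive_chi_arg x).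
by apply: is_derive_val_eq (is_derive_sub (is_derive_const 1 x) h) _; rewrite sub0r.
Qed.

Lemma is_derive_chi x : is_derive x 1 chi (chi1 x).
Proof. exact: (@is_derive_compose R cub (fun y => 1 - cub (2 * (y * y) - 1)) x _ _ (is_derive_cub _) (is_derive_chi_in x)). Qed.

Lemma is_derive_chi1 x : is_derive x 1 chi1 (chi2 x).
Proof.
have h := @is_derive_compose R cub1 (fun y => 1 - cub (2 * (y * y) - 1)) x _ _ (is_derive_cub1 _) (is_derive_chi_in x).
have k := @is_derive_compose R cub1 (fun y => 2 * (y * y) - 1) x _ _ (is_derive_cub1 _) (is_derive_chi_arg x).
have l := is_derive_opp (is_derive_mul k (is_derive_lin 4 x)).
by apply: is_derive_val_eq (is_derive_mul h l) _; rewrite /chi2; ring.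
Qed.

Lemma contM f g x : {for x, continuous f} -> {for x, continuous g} ->
  {for x, continuous (fun y => f y * g y)}.
Proof. by move=> hf hg; exact: cvgM. Qed.

Lemma contD f g x : {for x, continuous f} -> {for x, continuous g} ->
  {for x, continuous (fun y => f y + g y)}.
Proof. by move=> hf hg; exact: cvgD. Qed.

Lemma contB f g x : {for x, continuous f} -> {for x, continuous g} ->
  {for x, continuous (fun y => f y - g y)}.
Proof. by move=> hf hg; exact: cvgB. Qed.

Lemma contC (c x : R) : {for x, continuous (fun _ : R => c)}.
Proof. exact: cvg_cst. Qed.

Lemma cont_comp f g x : {for x, continuous f} -> continuous g ->
  {for x, continuous (fun y => g (f y))}.
Proof. by move=> hf hg; apply: continuous_comp => //; exact: hg. Qed.

Lemma continuous_chi2 : continuous chi2.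
Proof.
move=> x.
have carg := is_derive_continuous (is_derive_chi_arg x); have cin := is_derive_continuous (is_derive_chi_in x).
have c1 := is_derive_continuousT is_derive_cub1; have c4 := is_derive_continuous (is_derive_lin 4 x).
have h := contM (cont_comp carg c1) c4.
apply: (contB (contM (cont_comp cin continuous_cub2) (contM h h))).
apply: (contM (cont_comp cin c1)); apply: contD.
- exact: (contM (cont_comp carg continuous_cub2) (contM c4 c4)).
- by apply: contM; [exact: (cont_comp carg c1)|exact: contC].
Qed.

Lemma chi_eq1 x : 2 * x ^+ 2 <= 1 -> chi x = 1.
Proof.
move=> h; rewrite /chi (_ : cub (2 * _ - 1) = 0) ?subr0.
  by rewrite cubE ler01 expr1n.
have {h} h : 2 * (x * x) - 1 <= 0 by rewrite subr_le0 -expr2.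
rewrite cubE; case: ifPn => // h'.
by rewrite (_ : 2 * (x * x) - 1 = 0) ?expr0n//; apply/eqP; rewrite eq_le h h'.
Qed.

Lemma chi_eq0 x : 1 <= `|x| -> chi x = 0 /\ chi1 x = 0.
Proof.
move=> h; have x1 : 1 <= x * x by rewrite -expr2 -real_normK ?num_real// expr_ge1.
have c : 1 <= cub (2 * (x * x) - 1).
  rewrite cubE ifT; last lra.
  by rewrite exprn_ege1//; lra.
rewrite /chi /chi1 cubE cub1E; case: ifPn => // h'; last by rewrite mul0r.
by rewrite (_ : 1 - _ = 0) ?expr0n/= ?mulr0 ?mul0r//; lra.
Qed.

Lemma mul_bounds (a b A B : R) : 0 <= a <= A -> 0 <= b <= B -> 0 <= a * b <= A * B.
Proof. by move=> /andP[a0 aA] /andP[b0 bB]; rewrite mulr_ge0// ler_pM. Qed.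

(** The constants come from the bounds 3 and 6 of [cub_bounds] and from [|4 x| <= 4]: 36 is 3 * 3 *
    4, and 1188 is 6 * 9 * 16 + 3 * (6 * 16 + 3 * 4). *)
Lemma chi_bounds x : `|x| <= 1 -> [/\ 0 <= chi x <= 1, `|chi1 x| <= 36 & `|chi2 x| <= 1188].
Proof.
move=> h; have x1 : x * x <= 1 by rewrite -expr2 -real_normK ?num_real// exprn_ile1.
have [/andP[a0 a1] /andP[b0 b1] /andP[c0 c1]] := @cub_bounds (2 * (x * x) - 1) ltac:(lra).
have [/andP[d0 d1] /andP[e0 e1] /andP[f0 f1]] := @cub_bounds (1 - cub (2 * (x * x) - 1)) ltac:(lra).
split.
- by rewrite d0 d1.
- rewrite /chi1 (normrM (cub1 (1 - _))) normrN (normrM (cub1 _)) (ger0_norm b0) (ger0_norm e0).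
  rewrite (_ : 36 = 3 * (3 * 4)); last ring.
  apply: ler_pM => //; [exact: mulr_ge0|apply: ler_pM => //].
  by rewrite normrM ger0_norm// ler_piMr.
have q16 : 0 <= (4 * x) ^+ 2 <= 16.
  by rewrite sqr_ge0/= (_ : (4 * x) ^+ 2 = 16 * (x * x)); [rewrite ler_piMr|ring].
have q3 : 0 <= cub1 (2 * (x * x) - 1) <= 3 by rewrite b0.
have q6 : 0 <= cub2 (2 * (x * x) - 1) <= 6 by rewrite c0.
have p3 : 0 <= cub1 (1 - cub (2 * (x * x) - 1)) <= 3 by rewrite e0.
have p6 : 0 <= cub2 (1 - cub (2 * (x * x) - 1)) <= 6 by rewrite f0.
have /andP[g0 g1] := mul_bounds p6 (mul_bounds (mul_bounds q3 q3) q16).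
have /andP[k0 k1] := mul_bounds q6 q16.
have /andP[l0 l1] : 0 <= cub1 (2 * (x * x) - 1) * 4 <= 3 * 4 by rewrite mulr_ge0//= ler_pM.
have /andP[m0 m1] := @mul_bounds _ (cub2 (2 * (x * x) - 1) * (4 * x) ^+ 2 + cub1 (2 * (x * x) - 1) * 4)
  _ (6 * 16 + 3 * 4) p3 ltac:(by rewrite addr_ge0// lerD).
by rewrite ler_norml; apply/andP; split; rewrite /chi2 exprMn [X in cub2 _ * (X * _)]expr2; lra.
Qed.

End Cutoff.

(** * Hermite coefficients of the smoothly cut transform *)

Section CutoffParts.
Context {R : realType}.
Local Notation mu := (@lebesgue_measure R).
Implicit Types (f g u : R -> R) (x w t : R).

Lemma integ_seg_cont (r : R) f : (forall x, `|x| <= r -> {for x, continuous f}) ->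
  mu.-integrable (seg r) (EFin \o f).
Proof.
move=> cf; rewrite segE; apply: continuous_compact_integrable; first exact: segment_compact.
by apply: continuous_in_subspaceT => x; rewrite inE/= in_itv/= -ler_norml => /cf.
Qed.

(** Green's identity: [F * h1 - F1 * h] is an antiderivative of [F * h2 - F2 * h] and vanishes at
    both ends. *)
Lemma by_parts2 (r : R) (F F1 F2 h h1 h2 : R -> R) : 0 < r ->
  (forall x, `|x| <= r -> is_derive x 1 F (F1 x)) ->
  (forall x, `|x| <= r -> is_derive x 1 F1 (F2 x)) ->
  (forall x, `|x| <= r -> {for x, continuous F2}) ->
  (forall x, is_derive x 1 h (h1 x)) -> (forall x, is_derive x 1 h1 (h2 x)) ->
  continuous h2 ->
  F r = 0 -> F (- r) = 0 -> F1 r = 0 -> F1 (- r) = 0 ->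
  \int[mu]_(x in seg r) (F x * h2 x) = \int[mu]_(x in seg r) (F2 x * h x).
Proof.
move=> r0 dF dF1 cF2 dh dh1 ch2 Fr FNr F1r F1Nr.
have cF x (xr : `|x| <= r) := is_derive_continuous (dF x xr).
have ch := is_derive_continuousT dh.
have c1 x (xr : `|x| <= r) : {for x, continuous (fun y => F y * h2 y)}.
  by apply: contM; [exact: cF|exact: ch2].
have c2 x (xr : `|x| <= r) : {for x, continuous (fun y => F2 y * h y)}.
  by apply: contM; [exact: cF2|exact: ch].
apply/eqP; rewrite -subr_eq0 -RintegralB//; [|exact: measurable_seg|exact: integ_seg_cont|exact: integ_seg_cont].
have dG x : `|x| <= r -> is_derive x 1 (fun y => F y * h1 y - F1 y * h y) (F x * h2 x - F2 x * h x).
  move=> xr; apply: is_derive_val_eq (is_derive_sub (is_derive_mul (dF x xr) (dh1 x)) (is_derive_mul (dF1 x xr) (dh x))) _; ring.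
have H := @FTC_seg R _ (fun x => F x * h2 x - F2 x * h x) _ r0 dG.
rewrite H ?Fr ?FNr ?F1r ?F1Nr ?mul0r ?subrr// => x xr.
by apply: contB; [exact: c1|exact: c2].
Qed.

Lemma is_derive_inv f x (df : R) : f x != 0 -> is_derive x 1 f df ->
  is_derive x 1 (fun y => (f y)^-1) (- (df * (f x)^-1 ^+ 2)).
Proof.
move=> fx [df1 <-]; apply: DeriveDef; first exact: derivableV.
by rewrite deriveV// /GRing.scale/= mulNr mulrC exprVn.
Qed.

(** The triangle inequality for [cutoff_rem]: 1342 = 1188 + 2 * 72 + 10 and 76 = 2 * (36 + 2). *)
Lemma combination_le (A B C p1 p2 p3 q1 q2 s u v z : R) :
  `|p1| <= 1188 * A -> `|p2| <= 72 * A -> `|p3| <= 10 * A ->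
  `|q1| <= 36 * B -> `|q2| <= 2 * B -> `|s| <= C ->
  `|(p1 + 2 * p2 + p3) * u + 2 * (q1 + q2) * v + s * z| <=
  1342 * A * `|u| + 76 * B * `|v| + C * `|z|.
Proof.
move=> h1 h2 h3 h4 h5 h6.
apply: (le_trans (ler_normD _ _)); apply: lerD; last by rewrite normrM ler_wpM2r.
apply: (le_trans (ler_normD _ _)); apply: lerD; rewrite normrM; apply: ler_wpM2r => //.
- apply: (le_trans (ler_normD _ _)); apply: (le_trans (lerD (ler_normD _ _) h3)).
  have : `|2 * p2| <= 2 * (72 * A) by rewrite normrM ger0_norm// ler_pM2l.
  lra.
- rewrite normrM ger0_norm// (_ : 76 * B = 2 * (36 * B + 2 * B)); last ring.
  by rewrite ler_pM2l//; apply: (le_trans (ler_normD _ _)); exact: lerD.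
Qed.

Section Parametrix.
Variables (k : nat) (r : R).
Hypotheses (r0 : 0 < r) (rk : r ^+ 2 <= k%:R).
Let m w := chi (w / r).
Let m1 w := chi1 (w / r) / r.
Let m2 w := chi2 (w / r) / r ^+ 2.
(** The factor that inverts [2 k + 1 - w ^+ 2]. By [rk] its denominator is at least [k] on [seg r];
    [rho1] and [rho2] are its first two derivatives there. *)
Let rho w := (k%:R * 2 + 1 - w * w)^-1.
Let rho1 w := 2 * w * rho w ^+ 2.
Let rho2 w := 2 * rho w ^+ 2 + 8 * (w * w) * rho w ^+ 3.

Let k0 : 0 < k%:R :> R. Proof. by apply: lt_le_trans rk; rewrite exprn_gt0. Qed.

Let sqr_seg w : `|w| <= r -> w * w <= r ^+ 2.
Proof. by move=> h; rewrite -expr2 -real_normK ?num_real// lerXn2r ?nnegrE// ltW. Qed.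

Let rho_den w : `|w| <= r -> k%:R <= k%:R * 2 + 1 - w * w.
Proof. by move=> /sqr_seg h; have := le_trans h rk; move: (w * w) k0 => y; lra. Qed.

Let is_derive_div w : is_derive w 1 (fun y => y / r) (r^-1).
Proof. by apply: is_derive_val_eq (is_derive_mul (is_derive_idfun w) (is_derive_const r^-1 w)) _; ring. Qed.

Let is_derive_m w : is_derive w 1 m (m1 w).
Proof. exact: (@is_derive_compose R chi (fun y => y / r) w _ _ (is_derive_chi _) (is_derive_div w)). Qed.

Let is_derive_m1 w : is_derive w 1 m1 (m2 w).
Proof.
have h := @is_derive_compose R chi1 (fun y => y / r) w _ _ (is_derive_chi1 _) (is_derive_div w).
apply: is_derive_val_eq (is_derive_mul h (is_derive_const r^-1 w)) _.
by rewrite /m2; field; rewrite gt_eqF.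
Qed.

Let is_derive_rho w : `|w| <= r -> is_derive w 1 rho (rho1 w).
Proof.
move=> wr; have n0 : k%:R * 2 + 1 - w * w != 0 by rewrite gt_eqF// (lt_le_trans k0)// rho_den.
have h := @is_derive_inv (fun y => k%:R * 2 + 1 - y * y) w _ n0 (is_derive_sub (is_derive_const (k%:R * 2 + 1) w) (is_derive_mul (is_derive_idfun w) (is_derive_idfun w))).
by apply: is_derive_val_eq h _; rewrite /rho1 /rho; ring.
Qed.

Let is_derive_rho1 w : `|w| <= r -> is_derive w 1 rho1 (rho2 w).
Proof.
move=> wr; have h := is_derive_mul (is_derive_lin 2 w) (is_derive_mul (is_derive_rho wr) (is_derive_rho wr)).
by apply: is_derive_val_eq h _; rewrite /rho2 /rho1; ring.
Qed.

Let continuous_rho2 w : `|w| <= r -> {for w, continuous rho2}.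
Proof.
move=> wr; have c := is_derive_continuous (is_derive_rho wr).
have i := is_derive_continuous (is_derive_idfun w).
apply: contD; apply: contM; [exact: contC|exact: (contM c c)| |exact: (contM c (contM c c))].
by apply: contM; [exact: contC|exact: (contM i i)].
Qed.

Let continuous_m2 w : {for w, continuous m2}.
Proof.
apply: contM; last exact: contC.
exact: (cont_comp (is_derive_continuous (is_derive_div w)) continuous_chi2).
Qed.

Variables (U U1 U2 : R -> R).
Hypotheses (dU : forall w, is_derive w 1 U (U1 w)) (dU1 : forall w, is_derive w 1 U1 (U2 w)).
Hypothesis cU2 : continuous U2.

(** The second derivative of [m * rho * U], grouped by [U], [U1] and [U2] so that each can be
    estimated by its own norm. *)
Definition cutoff_rem w :=
  (m2 w * rho w + 2 * (m1 w * rho1 w) + m w * rho2 w) * U w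
  + 2 * (m1 w * rho w + m w * rho1 w) * U1 w + m w * rho w * U2 w.

Lemma continuous_cutoff_rem w : `|w| <= r -> {for w, continuous cutoff_rem}.
Proof.
move=> wr; have cm := is_derive_continuous (is_derive_m w); have cm1 := is_derive_continuous (is_derive_m1 w).
have cr := is_derive_continuous (is_derive_rho wr); have cr1 := is_derive_continuous (is_derive_rho1 wr).
have cu := is_derive_continuous (dU w); have cu1 := is_derive_continuous (dU1 w).
have c2 : {for w, continuous (fun=> 2 : R)} by exact: contC.
apply: contD; last exact: (contM (contM cm cr) (@cU2 w)).
apply: contD; last exact: (contM (contM c2 (contD (contM cm1 cr) (contM cm cr1))) cu1).
apply: (contM (contD (contD _ _) _) cu).
- exact: (contM (@continuous_m2 w) cr).
- exact: (contM c2 (contM cm1 cr1)).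
- exact: (contM cm (continuous_rho2 wr)).
Qed.

(* Here m = m rho (K - w^2) and (K - w^2) h_k = - h_k'' for K = 2k+1, so that two
   integrations by parts move the derivatives onto m rho U. *)
Lemma cutoff_parts : \int[mu]_(w in seg r) (m w * U w * hermite_fun k w) =
  - \int[mu]_(w in seg r) (cutoff_rem w * hermite_fun k w).
Proof.
have nr : `|r| = r by rewrite gtr0_norm.
have [mr m1r] : m r = 0 /\ m1 r = 0.
  have [e e1] : chi (r / r) = 0 /\ chi1 (r / r) = 0 by apply: chi_eq0; rewrite divff ?normr1// gt_eqF.
  by rewrite /m /m1 e e1 mul0r.
have [mNr m1Nr] : m (- r) = 0 /\ m1 (- r) = 0.
  have [e e1] : chi (- r / r) = 0 /\ chi1 (- r / r) = 0.
    by apply: chi_eq0; rewrite mulNr divff ?normrN1// gt_eqF.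
  by rewrite /m /m1 e e1 mul0r.
pose h2 w := (w ^+ 2 - (2 * k%:R + 1)) * hermite_fun k w.
pose F w := m w * rho w * U w.
pose F1 w := (m1 w * rho w + m w * rho1 w) * U w + m w * rho w * U1 w.
have H := @by_parts2 r F F1 cutoff_rem (hermite_fun k) (hermite_deriv k) h2 r0.
have e : \int[mu]_(w in seg r) (m w * U w * hermite_fun k w) = - \int[mu]_(w in seg r) (F w * h2 w).
  rewrite -mulN1r -RintegralZl; [|exact: measurable_seg|]; last first.
    apply: integ_seg_cont => w wr; apply: contM.
      exact: (contM (contM (is_derive_continuous (is_derive_m w)) (is_derive_continuous (is_derive_rho wr))) (is_derive_continuous (dU w))).
    apply: contM; last exact: hermite_continuous.
    by apply: contB; [exact: exprn_continuous|exact: contC].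
  apply: eq_Rintegral => w; rewrite inE => /= wr.
  have n0 : k%:R * 2 + 1 - w * w != 0 by rewrite gt_eqF// (lt_le_trans k0)// rho_den.
  by rewrite /F /h2 /rho; field.
rewrite e; congr (- _); apply: H.
- move=> w wr; apply: is_derive_val_eq (is_derive_mul (is_derive_mul (is_derive_m w) (is_derive_rho wr)) (dU w)) _; rewrite /F1; ring.
- move=> w wr.
  have h := is_derive_add (is_derive_mul (is_derive_add (is_derive_mul (is_derive_m1 w) (is_derive_rho wr)) (is_derive_mul (is_derive_m w) (is_derive_rho1 wr))) (dU w))
    (is_derive_mul (is_derive_mul (is_derive_m w) (is_derive_rho wr)) (dU1 w)).
  by apply: is_derive_val_eq h _; rewrite /cutoff_rem; ring.
- exact: continuous_cutoff_rem.
- exact: is_derive_hermite.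
- exact: is_derive_hermite_deriv.
- move=> w; apply: (@contM R (fun w => w ^+ 2 - (2 * k%:R + 1)) (hermite_fun k) w); last exact: hermite_continuous.
  by apply: contB; [exact: exprn_continuous|exact: contC].
- by rewrite /F mr !mul0r.
- by rewrite /F mNr !mul0r.
- by rewrite /F1 mr m1r !(mul0r, addr0).
- by rewrite /F1 mNr m1Nr !(mul0r, addr0).
Qed.

(** A derivative falling on the cutoff costs a factor of order [1 / r]; one falling on [rho] costs
    order [r / k], which is no more because [r ^+ 2 <= k]. *)
Lemma cutoff_rem_le w : `|w| <= r -> `|cutoff_rem w| <=
  1342 / (r ^+ 2 * k%:R) * `|U w| + 76 / (r * k%:R) * `|U1 w| + k%:R^-1 * `|U2 w|.
Proof.
move=> wr.
have wr1 : `|w / r| <= 1 by rewrite normrM normfV (gtr0_norm r0) ler_pdivrMr// mul1r.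
have [/andP[m_0 m_1] c1 c2] := chi_bounds wr1.
have ri : 0 < r^-1 by rewrite invr_gt0.
have ki : 0 < k%:R^-1 :> R by rewrite invr_gt0.
have am : `|m w| <= 1 by rewrite ger0_norm.
have am1 : `|m1 w| <= 36 * r^-1 by rewrite normrM (gtr0_norm ri) ler_pM2r.
have am2 : `|m2 w| <= 1188 * r^-1 ^+ 2.
  by rewrite /m2 -exprVn normrM (gtr0_norm (exprn_gt0 2 ri)) ler_pM2r ?exprn_gt0.
have kd := rho_den wr.
have rho0 : 0 <= rho w by rewrite invr_ge0 (le_trans _ kd)// ltW.
have ar : `|rho w| <= k%:R^-1 by rewrite ger0_norm// lef_pV2// posrE (lt_le_trans k0).
have arr : `|rho w| ^+ 2 <= k%:R^-1 ^+ 2 by rewrite lerXn2r// nnegrE// ltW.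
have ar1 : `|rho1 w| <= 2 * r * k%:R^-1 ^+ 2.
  rewrite normrM normrX ler_pM// ?exprn_ge0//.
  by rewrite normrM ger0_norm// ler_pM2l.
have wk : r ^+ 2 * k%:R^-1 <= 1 by rewrite ler_pdivrMr// mul1r.
have ar2 : `|rho2 w| <= 10 * k%:R^-1 ^+ 2.
  have w2 : 0 <= w * w by rewrite -expr2 sqr_ge0.
  have [p2 p3] : 0 <= rho w ^+ 2 /\ 0 <= rho w ^+ 3 by rewrite !exprn_ge0.
  have q3 : rho w ^+ 3 <= k%:R^-1 ^+ 3.
    by rewrite -(ger0_norm rho0) lerXn2r// nnegrE// ltW.
  rewrite ger0_norm; last by apply: addr_ge0; apply: mulr_ge0 => //; apply: mulr_ge0.
  rewrite [10 * _](_ : _ = 2 * k%:R^-1 ^+ 2 + 8 * (k%:R^-1 ^+ 2)); last ring.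
  apply: lerD; first by rewrite ler_pM2l// -(ger0_norm rho0).
  rewrite -mulrA ler_pM2l//; apply: (le_trans (ler_pM w2 p3 (sqr_seg wr) q3)).
  by rewrite exprS mulrA ler_piMl// exprn_ge0// ltW.
have rk1 : r * k%:R^-1 ^+ 2 <= r^-1 * k%:R^-1.
  by rewrite ler_pdivlMl// mulrA -expr2 expr2 mulrA ler_piMl// ltW.
have kk : k%:R^-1 ^+ 2 <= r^-1 ^+ 2 * k%:R^-1 :> R.
  by rewrite expr2 ler_pM2r// exprVn lef_pV2 ?posrE ?exprn_gt0.
have b1 : `|m2 w * rho w| <= 1188 * (r^-1 ^+ 2 * k%:R^-1) by rewrite normrM mulrA ler_pM.
have b2 : `|m1 w * rho1 w| <= 72 * (r^-1 ^+ 2 * k%:R^-1).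
  rewrite normrM (le_trans (ler_pM _ _ am1 ar1))//.
  rewrite (_ : _ * _ * _ = 72 * (r^-1 * (r * k%:R^-1 ^+ 2))); last ring.
  by rewrite ler_pM2l// expr2 -mulrA ler_pM2l.
have b3 : `|m w * rho2 w| <= 10 * (r^-1 ^+ 2 * k%:R^-1).
  by rewrite normrM -[leRHS]mul1r ler_pM// (le_trans ar2)// ler_pM2l.
have b4 : `|m1 w * rho w| <= 36 * (r^-1 * k%:R^-1) by rewrite normrM mulrA ler_pM.
have b5 : `|m w * rho1 w| <= 2 * (r^-1 * k%:R^-1).
  by rewrite normrM -[leRHS]mul1r ler_pM// (le_trans ar1)// -mulrA ler_pM2l.
have b6 : `|m w * rho w| <= k%:R^-1 by rewrite normrM -[leRHS]mul1r ler_pM.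
rewrite (invfM (r ^+ 2)) -exprVn (invfM r).
exact: combination_le b1 b2 b3 b4 b5 b6.
Qed.
Hypotheses (hU : L2 U) (hU1 : L2 U1) (hU2 : L2 U2).

(** Cauchy-Schwarz with the unit vector [hermite_fun k]. The remainder is multiplied by the
    indicator of [seg r], the only place where it is controlled; the cutoff makes the left side live
    there too. *)
Lemma cutoff_coef_le : `|ip (fun w => chi (w / r) * U w) (hermite_fun k)| <=
  1342 / (r ^+ 2 * k%:R) * nrm U + 76 / (r * k%:R) * nrm U1 + k%:R^-1 * nrm U2.
Proof.
have z (w : R) : \1_(seg r) w * (m w * U w * hermite_fun k w) = chi (w / r) * U w * hermite_fun k w.
  rewrite indicE; case: (lerP `|w| r) => wr; first by rewrite mem_set// mul1r.
  rewrite memNset; last by rewrite /seg/= leNgt wr.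
  rewrite (_ : chi (w / r) = 0) ?mul0r//.
  by apply: (chi_eq0 _).1; rewrite normrM normfV (gtr0_norm r0) ler_pdivlMr// mul1r ltW.
have e : ip (fun w => chi (w / r) * U w) (hermite_fun k) =
    - ip (fun w => \1_(seg r) w * cutoff_rem w) (hermite_fun k).
  rewrite /ip [in RHS](_ : (fun w => _) = fun w => \1_(seg r) w * (cutoff_rem w * hermite_fun k w)); last first.
    by apply/funext => w; exact: (esym (mulrA _ _ _)).
  rewrite Rintegral_indic -cutoff_parts -[RHS]Rintegral_indic; congr Rintegral; apply/funext => w.
  exact: esym (z w).
set a := 1342 / _; set b := 76 / _; set c := k%:R^-1.
have a0 : 0 <= a.
  by apply: divr_ge0; [exact: ler0n|apply: mulr_ge0; [apply: exprn_ge0; exact: ltW|exact: ler0n]].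
have b0 : 0 <= b.
  by apply: divr_ge0; [exact: ler0n|apply: mulr_ge0; [exact: ltW|exact: ler0n]].
have c0 : 0 <= c by rewrite invr_ge0 ltW.
have n0 := L2_norm hU; have n1 := L2_norm hU1; have n2 := L2_norm hU2.
pose G w := a * `|U w| + b * `|U1 w| + c * `|U2 w|.
have G0 w : 0 <= G w by rewrite !addr_ge0// mulr_ge0.
have L01 : L2 (fun w => a * `|U w| + b * `|U1 w|) by apply: L2D; exact: L2Z.
have LG : L2 G by apply: L2D => //; exact: L2Z.
have le w : `|\1_(seg r) w * cutoff_rem w| <= `|G w|.
  rewrite (ger0_norm (G0 w)) indicE; case: (lerP `|w| r) => wr.
    by rewrite mem_set// mul1r; exact: cutoff_rem_le.
  by rewrite memNset; [rewrite mul0r normr0|rewrite /seg/= leNgt wr].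
have Lr : L2 (fun w => \1_(seg r) w * cutoff_rem w).
  apply: (@L2_le _ 1 _ G) => //; last by move=> w; rewrite mul1r.
  by apply: measurable_indic_seg => w; exact: continuous_cutoff_rem.
have hk : L2 (@hermite_fun R k) by exact: L2_hermite.
have nk : nrm (@hermite_fun R k) = 1.
  have [_ /(_ ord_max ord_max)] := @orthonormal_hermite R k.+1.
  by rewrite eqxx/= /nrm => ->; rewrite sqrtr1.
rewrite e normrN; apply: (le_trans (ip_norm_le Lr hk)); rewrite nk mulr1.
apply: (le_trans (nrm_le Lr LG le)); apply: (le_trans (nrmD L01 (L2Z c n2))).
have nn V : nrm (fun w => `|V w|) = nrm V.
  by rewrite /nrm /ip; under eq_Rintegral do rewrite -expr2 real_normK ?num_real// expr2.
rewrite (nrmZ c n2) nn (ger0_norm c0) lerD2r.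
apply: (le_trans (nrmD (L2Z a n0) (L2Z b n1))).
by rewrite (nrmZ a n0) (nrmZ b n1) !nn (ger0_norm a0) (ger0_norm b0).
Qed.
End Parametrix.
End CutoffParts.

(** * The Hermite tail of a compactly supported function *)

Section RealBound.
Context {R : realType}.
Local Notation h := (@hermite_fun R).
Implicit Types (f g u : R -> R) (x w t : R).

Lemma hartleyB u v w : integ u -> integ v -> hartley (fun t => u t - v t) w = hartley u w - hartley v w.
Proof.
move=> hu hv; have hc f : integ f -> integ (fun t => f t * cas (t * w)).
  move=> hf; apply: (@integ_mul_bounded _ 2) => //; last by move=> x; exact: norm_cas.
  apply: measurableT_comp; first exact: continuous_measurable_fun continuous_cas.
  by apply: measurable_funM => //; exact: measurable_cst.
rewrite /hartley -mulrBr -RintegralB//; [|exact: hc..].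
by congr (_ * _); congr Rintegral; apply/funext => t; rewrite mulrBl.
Qed.

Lemma nrm_mulX (T : R) u : 0 < T -> L2 u -> supported T u ->
  nrm (fun t => t * u t) <= T * nrm u.
Proof.
move=> T0 hu su; rewrite -[X in X * _](gtr0_norm T0) -(nrmZ T hu).
apply: nrm_le; [exact: L2_mulX su|exact: L2Z|].
by move=> x; rewrite [leRHS]normrM (gtr0_norm T0); exact: norm_mulX.
Qed.

Lemma sqr_le_le (a b : R) : 0 <= b -> a ^+ 2 <= b ^+ 2 -> a <= b.
Proof.
move=> b0 ab; rewrite leNgt; apply/negP => ba; move: ab; rewrite leNgt => /negP; apply.
by rewrite ltrXn2r// nnegrE (le_trans b0)// ltW.
Qed.

(** The three terms are at most 1/20, 1/5 and 1 times [T ^+ 2 / K * x], which add up to 21/20 + 1/5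
    = 5/4. The tight one is the second: it needs 5 * 76 = 380 to be at most 24 * 16, where
    [T ^+ 4 >= 16]. *)
Lemma cutoff_numeric (T r a b c x K : R) : 2 <= T -> 24 * T ^+ 3 <= r -> 0 < K ->
  0 <= x -> a <= x -> b <= T * x -> c <= T ^+ 2 * x ->
  1342 / (r ^+ 2 * K) * a + 76 / (r * K) * b + K^-1 * c <= 5 / 4 * T ^+ 2 / K * x.
Proof.
move=> T2 Tr K0 x0 ax bx cx; have T0 : 0 < T by lra.
have T4 : 4 <= T ^+ 2 by rewrite expr2 (_ : 4 = 2 * 2) ?ler_pM//; ring.
have T8 : 8 <= T ^+ 3 by rewrite exprS (_ : 8 = 2 * 4) ?ler_pM//; ring.
have r192 : 192 <= r by lra.
have r0 : 0 < r by lra.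
have h1 : 1342 / r ^+ 2 <= T ^+ 2 / 20.
  rewrite ler_pdivrMr ?exprn_gt0//.
  have r2 : 192 * 192 <= r ^+ 2 by exact: (ler_pM (ler0n _ 192) (ler0n _ 192) r192 r192).
  have : 4 * r ^+ 2 <= T ^+ 2 * r ^+ 2 by rewrite ler_pM2r// exprn_gt0.
  rewrite mulrAC; lra.
have h2 : 76 / r * T <= T ^+ 2 / 5.
  rewrite mulrAC ler_pdivrMr//.
  have : T ^+ 2 * (24 * T ^+ 3) <= T ^+ 2 * r by rewrite ler_pM2l// exprn_gt0.
  have : 16 * T <= T ^+ 4 * T by rewrite ler_pM2r// (exprD T 2 2) (_ : 16 = 4 * 4) ?ler_pM//; ring.
  rewrite (_ : T ^+ 2 * (24 * T ^+ 3) = 24 * (T ^+ 4 * T)); last ring.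
  lra.
have -> : 1342 / (r ^+ 2 * K) * a + 76 / (r * K) * b + K^-1 * c =
   (1342 / r ^+ 2 * a + 76 / r * b + c) / K by field; rewrite !gt_eqF.
rewrite (mulrAC (5 / 4 * _)) ler_pM2r ?invr_gt0//.
have k1 : 1342 / r ^+ 2 * a <= T ^+ 2 / 20 * x.
  apply: le_trans (_ : 1342 / r ^+ 2 * x <= _); last by rewrite ler_wpM2r.
  apply: (ler_wpM2l _ ax); apply: divr_ge0; [exact: ler0n|apply: exprn_ge0; exact: ltW].
have k2 : 76 / r * b <= T ^+ 2 / 5 * x.
  apply: le_trans (_ : 76 / r * (T * x) <= _); last by rewrite mulrA ler_wpM2r.
  apply: (ler_wpM2l _ bx); apply: divr_ge0; [exact: ler0n|exact: ltW].
rewrite (_ : 5 / 4 * T ^+ 2 * x = T ^+ 2 / 20 * x + T ^+ 2 / 5 * x + T ^+ 2 * x); last by field.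
lra.
Qed.

(** The case [U = hartley u] and [r = sqrt n] of [cutoff_coef_le]; 576 is the square of 24, so
    [r >= 24 T ^+ 3]. *)
Lemma cutoff_hartley_coef (T : R) u (n k : nat) : 2 <= T -> L2 u -> supported T u ->
  576 * T ^+ 6 <= n%:R -> (n <= k)%N ->
  `|ip (fun w => chi (w / Num.sqrt n%:R) * hartley u w) (h k)| <= 5 / 4 * T ^+ 2 / k%:R * nrm u.
Proof.
move=> T2 hu su Tn nk; have T0 : 0 < T by lra.
have T60 : 0 < T ^+ 6 by rewrite exprn_gt0.
have n0 : 0 < n%:R :> R by apply: lt_le_trans Tn; apply: mulr_gt0; [exact: ltr0n|exact: T60].
have k0 : 0 < k%:R :> R by apply: lt_le_trans n0 _; rewrite ler_nat.
set r := Num.sqrt n%:R; have r0 : 0 < r by rewrite sqrtr_gt0.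
have rr : r ^+ 2 = n%:R by rewrite sqr_sqrtr// ltW.
have rk : r ^+ 2 <= k%:R by rewrite rr ler_nat.
pose v t := t * u t; pose z t := t * v t.
have hv : L2 v by exact: L2_mulX su.
have sv : supported T v by exact: supported_mulX.
have hz : L2 z by exact: L2_mulX sv.
have sz : supported T z by exact: supported_mulX.
have iu := supported_integ hu su; have iv := supported_integ hv sv; have iz := supported_integ hz sz.
have dU w : is_derive w 1 (hartley u) (hartley v (- w)) by exact: is_derive_hartley.
have dU1 w : is_derive w 1 (fun y => hartley v (- y)) (- hartley z w).
  (* The second reflection undoes the first, leaving a sign from the inner derivative. *)
  have d : is_derive (- w) 1 (hartley v) (hartley z w) by rewrite -[in hartley z w](opprK w); exact: is_derive_hartley.
  by apply: is_derive_val_eq (@is_derive_compose R (hartley v) (fun y => - y) w _ _ d (is_derive_opp (is_derive_idfun w))) _; rewrite mulrN1.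
have cU2 : continuous (fun w => - hartley z w).
  by move=> w; apply: cvgN; exact: (hartley_continuous hz sz).
have [LU nU] := hartley_L2_le T0 hu su; have [LV nV] := hartley_L2_le T0 hv sv.
have [LZ nZ] := hartley_L2_le T0 hz sz; have [LV' nV'] := L2_reflect LV.
have nv : nrm v <= T * nrm u by exact: nrm_mulX.
have nz : nrm z <= T ^+ 2 * nrm u.
  apply: (le_trans (nrm_mulX T0 hv sv)).
  by rewrite expr2 -mulrA ler_pM2l.
have := cutoff_coef_le r0 rk dU dU1 cU2 LU LV' (L2N LZ).
rewrite nrmN nV' => /le_trans; apply.
have u0 := nrm_ge0 u.
have T24 : 24 * T ^+ 3 <= r.
  have T3 : 0 <= T ^+ 3 by apply: exprn_ge0; exact: ltW.
  apply: (sqr_le_le (ltW r0)); rewrite rr; move: Tn; congr (_ <= _); ring.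
apply: (cutoff_numeric T2 T24 k0 u0 nU); [exact: le_trans nV nv|exact: le_trans nZ nz].
Qed.

(** Telescoping: the inverse square of [a + 1] is at most [1 / a - 1 / (a + 1)]. *)
Lemma sum_inv_sqr_le (n M : nat) : (0 < n)%N ->
  \sum_(k < M) (n.+1 + k)%:R^-1 ^+ 2 <= n%:R^-1 - (n + M)%:R^-1 :> R.
Proof.
move=> n0; elim: M => [|M ih]; first by rewrite big_ord0 addn0 subrr.
rewrite big_ord_recr/=; apply: (le_trans (lerD ih (lexx _))).
rewrite -addrA lerD2l -lerBrDl opprK addrC.
have a0 : 0 < (n + M)%:R :> R by rewrite ltr0n addn_gt0 n0.
rewrite addSn addnS -natr1; move: (n + M)%:R a0 => a a0.
rewrite -subr_ge0 (_ : _ - _ = a^-1 * (a + 1)^-1 ^+ 2); last first.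
  by field; rewrite !gt_eqF//; lra.
by rewrite mulr_ge0 ?invr_ge0 ?sqr_ge0// ltW.
Qed.

Lemma fprojD N e f g x : is_orthonormal N e -> L2 f -> L2 g ->
  fproj N e (fun x => f x + g x) x = fproj N e f x + fproj N e g x.
Proof.
move=> [he _] hf hg; rewrite /fproj -big_split/=.
by apply: eq_bigr => i _; rewrite ipDl// mulrDl.
Qed.

Lemma orthonormal_hermite_shift (n M : nat) : is_orthonormal M (fun k => h (n + k)).
Proof.
have [hL ho] := @orthonormal_hermite R (n + M); split; first by move=> k; exact: hL.
by move=> i j; have := ho (rshift n i) (rshift n j); rewrite eq_rshift.
Qed.

(** The tail sum is the squared norm of a projection of [hartley u], so the splitting [m + (1 - m)]
    goes through the triangle inequality. Coefficient bounds treat the first part, the contraction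
    property of the projection the second; the result is uniform in [M]. *)
Lemma hermite_tail_le (T : R) u (n M : nat) (O : R) : 2 <= T -> L2 u -> supported T u ->
  576 * T ^+ 6 <= n%:R -> 2 * O ^+ 2 <= n%:R -> 0 <= O ->
  \sum_(k < M) ip u (h (n.+1 + k)) ^+ 2 <=
  (5 / 4 * T ^+ 2 / Num.sqrt n%:R * nrm u + nrm (fun w => \1_(~` seg O) w * hartley u w)) ^+ 2.
Proof.
move=> T2 hu su Tn On O0; have T0 : 0 < T by lra.
have [LU nU] := hartley_L2_le T0 hu su.
set r := Num.sqrt n%:R; set e := fun k => h (n.+1 + k).
have oe : is_orthonormal M e by exact: orthonormal_hermite_shift.
have n0 : (0 < n)%N.
  by rewrite -(ltr0n R); apply: lt_le_trans Tn; apply: mulr_gt0; [exact: ltr0n|exact: exprn_gt0].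
have r0 : 0 < r by rewrite sqrtr_gt0 ltr0n.
have rr : r ^+ 2 = n%:R by rewrite sqr_sqrtr.
pose m w := chi (w / r).
have cm : continuous m.
  move=> w; apply: (@cont_comp R (fun y => y / r) chi w _ (is_derive_continuousT (@is_derive_chi R))).
  by apply: contM; [exact: cvg_id|exact: contC].
have mm : measurable_fun setT m by exact: continuous_measurable_fun.
have mb w : 0 <= m w <= 1.
  have [wr|wr] := lerP `|w / r| 1; first by have [] := chi_bounds wr.
  by rewrite /m (chi_eq0 (ltW wr)).1 lexx ler01.
have LmU : L2 (fun w => m w * hartley u w).
  by apply: (@L2_mul_bounded _ 1) => // w; rewrite ger0_norm; case/andP: (mb w).
have LcU : L2 (fun w => (1 - m w) * hartley u w).
  rewrite (_ : (fun _ => _) = fun w => hartley u w - m w * hartley u w); first exact: L2B.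
  by apply/funext => w; rewrite mulrBl mul1r.
have LO : L2 (fun w => \1_(~` seg O) w * hartley u w).
  by apply: L2_indic => //; apply: measurableC; exact: measurable_seg.
have s1 : \sum_(k < M) ip u (h (n.+1 + k)) ^+ 2 = nrm (fproj M e (hartley u)) ^+ 2.
  rewrite sqr_nrm nrm_fproj//; apply: eq_bigr => k _.
  by have [s ss ->] := hartley_hcoef hu su (n.+1 + k); rewrite exprMn ss mul1r.
rewrite s1 lerXn2r ?nnegrE ?nrm_ge0//.
  by apply: addr_ge0; [apply: mulr_ge0; [apply: divr_ge0; [apply: mulr_ge0; [lra|exact: sqr_ge0]|exact: ltW]|]|]; exact: nrm_ge0.
have -> : fproj M e (hartley u) = fun x => fproj M e (fun w => m w * hartley u w) x + fproj M e (fun w => (1 - m w) * hartley u w) x.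
  apply/funext => x; rewrite -fprojD//; congr (fproj _ _ _ _); apply/funext => w; ring.
apply: (le_trans (nrmD (L2_fproj _ oe) (L2_fproj _ oe))); apply: lerD.
  apply: sqr_le_le.
    by apply: mulr_ge0; [apply: divr_ge0; [apply: mulr_ge0; [lra|exact: sqr_ge0]|exact: ltW]|exact: nrm_ge0].
  rewrite sqr_nrm nrm_fproj//.
  apply: le_trans (_ : \sum_(k < M) (5 / 4 * T ^+ 2 * nrm u) ^+ 2 * (n.+1 + k)%:R^-1 ^+ 2 <= _).
    apply: ler_sum => k _; rewrite -exprMn -real_normK ?num_real//.
    have le := cutoff_hartley_coef T2 hu su Tn (leq_trans (leqnSn n) (leq_addr k n.+1)).
    rewrite lerXn2r ?nnegrE//; last by rewrite mulrAC.
    by rewrite mulrAC; exact: le_trans le.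
  rewrite -mulr_sumr (mulrAC (5 / 4 * T ^+ 2)) [leRHS]exprMn (exprVn r) rr.
  apply: ler_wpM2l; first exact: sqr_ge0.
  apply: (le_trans (sum_inv_sqr_le M n0)).
  by rewrite lerBlDr lerDl invr_ge0.
apply: (le_trans (nrm_fproj_le oe LcU)); apply: nrm_le => // w.
rewrite indicE; have [wO|wO] := lerP `|w| O.
  (* For [|w| <= O], twice the square of [w / r] is at most [2 O ^+ 2 / n <= 1], the range where the
     cutoff equals 1. *)
  rewrite (_ : m w = 1) ?subrr ?mul0r ?normr0//; apply: chi_eq1.
  rewrite exprMn exprVn rr mulrA ler_pdivrMr ?ltr0n// mul1r (le_trans _ On)//.
  by rewrite ler_pM2l// -real_normK ?num_real// lerXn2r.
rewrite mem_set; last by rewrite /seg/= leNgt wO.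
rewrite mul1r normrM ler_piMl//; case/andP: (mb w) => m0 m1.
by rewrite ger0_norm; lra.
Qed.
End RealBound.

(** * The estimate for real functions *)
Section RealTheorem.
Context {R : realType}.
Local Notation h := (@hermite_fun R).
Implicit Types (f g u : R -> R) (x w t : R).

(** Parseval makes the squared residual at most a finite tail sum plus [eps], and the tail bound
    does not depend on the length of the sum. *)
Lemma nrm_sub_hermite_le (T : R) u (n : nat) (O : R) : 2 <= T -> L2 u -> supported T u ->
  576 * T ^+ 6 <= n%:R -> 2 * O ^+ 2 <= n%:R -> 0 <= O ->
  nrm (fun x => u x - fproj n.+1 h u x) <=
  5 / 4 * T ^+ 2 / Num.sqrt n%:R * nrm u + nrm (fun w => \1_(~` seg O) w * hartley u w).
Proof.
move=> T2 hu su Tn On O0; apply: sqr_le_le.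
  apply: addr_ge0; last exact: nrm_ge0.
  apply: mulr_ge0; last exact: nrm_ge0.
  by apply: divr_ge0; [apply: mulr_ge0; [lra|exact: sqr_ge0]|exact: sqrtr_ge0].
have oh : is_orthonormal n.+1 h by exact: orthonormal_hermite.
rewrite sqr_nrm nrm_sub_fproj//; apply/ler_addgt0Pr => eps eps0.
have [N /(_ (n.+1 + N)%N (leq_addl _ _))] := hermite_parseval hu eps0.
rewrite big_split_ord/= => H.
have := hermite_tail_le N T2 hu su Tn On O0.
set S1 := \sum_(i < n.+1) _ in H *; set S2 := \sum_(i < N) _ in H * => H2.
by move: (ip u u) S1 S2 ((_ + _) ^+ 2) H H2 => a b c d; lra.
Qed.

Lemma indic_01 (D : set R) x : 0 <= (\1_D x : R) <= 1.
Proof. by rewrite indicE; case: (_ \in _); rewrite ?lexx ?ler01. Qed.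

Lemma nrm_indic_le (D : set R) f : measurable D -> L2 f -> nrm (fun x => \1_D x * f x) <= nrm f.
Proof.
move=> mD hf; apply: nrm_le => //; first exact: L2_indic.
by move=> x; have /andP[a b] := indic_01 D x; rewrite normrM ger0_norm// ler_piMl.
Qed.

Lemma measurable_out (T : R) : measurable (~` seg T).
Proof. by apply: measurableC; exact: measurable_seg. Qed.

Lemma indic_segC (T : R) x : \1_(seg T) x + \1_(~` seg T) x = 1 :> R.
Proof. by rewrite !indicE in_setC; case: (x \in seg T); rewrite /= ?addr0 ?add0r. Qed.

(** [A] is compared with the transform of [f] truncated at a large [r]. Replacing [r] by [T] changes
    the truncated function only on [T < |x| <= r], and [hartley_L2_le] carries this error to the
    frequency side. *)
Lemma nrm_out_hartley_le (T : R) f A (O : R) : 0 < T -> L2 f -> L2 A ->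
  nrm (fun w => A w - hartley (fun x => \1_(seg r) x * f x) w) @[r --> +oo] --> (0 : R) ->
  nrm (fun w => \1_(~` seg O) w * hartley (fun x => \1_(seg T) x * f x) w) <=
  nrm (fun w => \1_(~` seg O) w * A w) + nrm (fun x => \1_(~` seg T) x * f x).
Proof.
move=> T0 hf hA cA; apply/ler_addgt0Pr => eps eps0.
have [r [Tr Ar]] : exists r, T <= r /\ nrm (fun w => A w - hartley (fun x => \1_(seg r) x * f x) w) <= eps.
  have /cvgrPdist_le /(_ _ eps0) H := cA.
  have [r] : exists r, T <= r /\ `|0 - nrm (fun w => A w - hartley (fun x => \1_(seg r) x * f x) w)| <= eps.
    apply: (@filter_ex _ (+oo%R : set_system R)).
    by apply: (filterI _ H); apply: nbhs_pinfty_ge; exact: num_real.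
  by rewrite sub0r normrN (ger0_norm (nrm_ge0 _)) => -[? ?]; exists r.
have ms := @measurable_seg R; have mo := @measurable_out.
set u := fun x => \1_(seg T) x * f x; set v := fun x => \1_(seg r) x * f x.
have r0 : 0 < r by exact: lt_le_trans Tr.
have hu : L2 u by exact: L2_indic. have hv : L2 v by exact: L2_indic.
have su : supported T u by exact: indic_supported.
have sv : supported r v by exact: indic_supported.
have LU := (hartley_L2_le T0 hu su).1; have LV := (hartley_L2_le r0 hv sv).1.
pose z x := v x - u x.
have hz : L2 z by exact: L2B.
have sz : supported r z.
  by move=> x rx; rewrite /z (sv _ rx) (su _ (le_lt_trans Tr rx)) subrr.
have [LZ nZ] := hartley_L2_le r0 hz sz.
have zE w : hartley z w = hartley v w - hartley u w.
  by apply: hartleyB; [exact: supported_integ sv|exact: supported_integ su].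
have nz : nrm z <= nrm (fun x => \1_(~` seg T) x * f x).
  apply: nrm_le => //; first exact: L2_indic.
  move=> x; rewrite /z /u /v -mulrBl !normrM ler_wpM2r//.
  have e := indic_segC T x; rewrite (_ : \1_(~` _) x = 1 - \1_(seg T) x); last by rewrite -e addrAC subrr add0r.
  rewrite !indicE; have [xT|xT] := lerP `|x| T.
    have xr : `|x| <= r by exact: le_trans Tr.
    by rewrite [x \in seg r]mem_set// [x \in seg T]mem_set// !subrr.
  rewrite [x \in seg T](memNset _) ?subr0 ?normr1; last by rewrite /seg/= leNgt xT.
  by case: (_ \in _); rewrite ?normr1 ?normr0.
have -> : (fun w => \1_(~` seg O) w * hartley u w) = fun w => \1_(~` seg O) w * A w -
    \1_(~` seg O) w * ((A w - hartley v w) + hartley z w).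
  by apply/funext => w; rewrite zE; ring.
have LAv : L2 (fun w => A w - hartley v w) by exact: L2B.
have Ls : L2 (fun w => (A w - hartley v w) + hartley z w) by exact: L2D.
apply: (le_trans (nrmB (L2_indic (mo O) hA) (L2_indic (mo O) Ls))); rewrite -addrA lerD2l.
apply: (le_trans (nrm_indic_le (mo O) Ls)); apply: (le_trans (nrmD LAv LZ)).
by rewrite addrC lerD// (le_trans nZ).
Qed.

(** The part [v] of [f] outside [seg T] is paid for twice: once through its own projection, and once
    because removing it may add high frequencies to the transform of [u]. This is the origin of the
    factor 2 before [epsT]. *)
Lemma real_bound (T : R) f A (n : nat) (O : R) : 2 <= T -> L2 f -> L2 A ->
  nrm (fun w => A w - hartley (fun x => \1_(seg r) x * f x) w) @[r --> +oo] --> (0 : R) ->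
  576 * T ^+ 6 <= n%:R -> 2 * O ^+ 2 <= n%:R -> 0 <= O ->
  nrm (fun x => \1_(seg T) x * (f x - fproj n.+1 h f x)) <=
  2 * nrm (fun x => \1_(~` seg T) x * f x) + nrm (fun w => \1_(~` seg O) w * A w) +
  5 / 4 * T ^+ 2 / Num.sqrt n%:R * nrm f.
Proof.
move=> T2 hf hA cA Tn On O0; have T0 : 0 < T by lra.
have ms := @measurable_seg R; have mo := @measurable_out.
have oh : is_orthonormal n.+1 h by exact: orthonormal_hermite.
set u := fun x => \1_(seg T) x * f x; set v := fun x => \1_(~` seg T) x * f x.
have hu : L2 u by exact: L2_indic. have hv : L2 v by exact: L2_indic.
have su : supported T u by exact: indic_supported.
have fE : f = fun x => u x + v x.
  by apply/funext => x; rewrite /u /v -mulrDl indic_segC mul1r.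
have Lu : L2 (fun x => u x - fproj n.+1 h u x) by apply: L2B => //; exact: L2_fproj.
have Lv : L2 (fproj n.+1 h v) by exact: L2_fproj.
have -> : (fun x => \1_(seg T) x * (f x - fproj n.+1 h f x)) =
    fun x => \1_(seg T) x * (u x - fproj n.+1 h u x) - \1_(seg T) x * fproj n.+1 h v x.
  apply/funext => x; rewrite [in fproj _ _ f x]fE fprojD//.
  have -> : \1_(seg T) x * (f x - (fproj n.+1 h u x + fproj n.+1 h v x)) =
    \1_(seg T) x * f x - \1_(seg T) x * fproj n.+1 h u x - \1_(seg T) x * fproj n.+1 h v x by ring.
  congr (_ - _); rewrite mulrBr; congr (_ - _); rewrite /u mulrA; congr (_ * _).
  by rewrite indicE; case: (_ \in _); rewrite ?mul1r ?mul0r.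
apply: (le_trans (nrmB (L2_indic (ms T) Lu) (L2_indic (ms T) Lv))).
have h1 := le_trans (nrm_indic_le (ms T) Lu) (nrm_sub_hermite_le T2 hu su Tn On O0).
have h2 := le_trans (nrm_indic_le (ms T) Lv) (nrm_fproj_le oh hv).
have h3 := nrm_out_hartley_le O T0 hf hA cA; rewrite -/u -/v in h3.
have h4 : 5 / 4 * T ^+ 2 / Num.sqrt n%:R * nrm u <= 5 / 4 * T ^+ 2 / Num.sqrt n%:R * nrm f.
  apply: ler_wpM2l; last exact: nrm_indic_le.
  by apply: divr_ge0; [apply: mulr_ge0; [lra|exact: sqr_ge0]|exact: sqrtr_ge0].
move: (nrm (fun x => \1_(seg T) x * _)) (nrm (fun x => \1_(seg T) x * _)) h1 h2 => a b h1 h2.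
lra.
Qed.
End RealTheorem.

(** * From real to complex functions *)
Section Assembly.
Context {R : realType}.
Local Notation mu := (@lebesgue_measure R).
Implicit Types (f g u v a b : R -> R) (x w t : R).

(* [mix1] and [mix2] turn the real and imaginary parts of the Fourier transform of fr + i fi
   into the Hartley transforms of fr and fi. *)
Definition mix1 a b w := (a w + a (- w)) / 2 - (b w - b (- w)) / 2.
Definition mix2 a b w := (b w + b (- w)) / 2 + (a w - a (- w)) / 2.

(** If [u] and [v] are the Hartley transforms of [fr] and [fi], the Fourier transform has real part
    [mix2 v u] and imaginary part [mix1 v u]; [mix1] and [mix2] undo this. *)
Lemma mix1K u v : mix1 (mix2 v u) (mix1 v u) = u.
Proof. by apply/funext => w; rewrite /mix1 /mix2 opprK; field. Qed.

Lemma mix2K u v : mix2 (mix2 v u) (mix1 v u) = v.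
Proof. by apply/funext => w; rewrite /mix1 /mix2 opprK; field. Qed.

Lemma L2_even_odd a : L2 a -> L2 (fun w => (a w + a (- w)) / 2) /\ L2 (fun w => (a w - a (- w)) / 2).
Proof.
move=> ha; have [hN _] := L2_reflect ha.
split; [rewrite (_ : (fun w => _) = fun w => 2^-1 * (a w + a (- w)))|
  rewrite (_ : (fun w => _) = fun w => 2^-1 * (a w - a (- w)))];
  try (by apply/funext => w; rewrite mulrC); apply: L2Z; [exact: L2D|exact: L2B].
Qed.

Lemma L2_mix a b : L2 a -> L2 b -> L2 (mix1 a b) /\ L2 (mix2 a b).
Proof.
move=> /L2_even_odd[ae ao] /L2_even_odd[be bo].
by split; [exact: L2B|exact: L2D].
Qed.

Lemma ip_sqr f : ip f f = \int[mu]_x (f x ^+ 2).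
Proof. by rewrite /ip; under eq_Rintegral do rewrite -expr2. Qed.

Lemma nrm_mix a b : L2 a -> L2 b ->
  nrm (mix1 a b) ^+ 2 + nrm (mix2 a b) ^+ 2 = nrm a ^+ 2 + nrm b ^+ 2.
Proof.
move=> ha hb; have [h1 h2] := L2_mix ha hb.
(* The sums of squares differ pointwise by odd cross terms, so both sides are doubled and the values
   at [x] and [- x] are added before comparing integrands. *)
have key p q : L2 p -> L2 q ->
    2 * (nrm p ^+ 2 + nrm q ^+ 2) = \int[mu]_x ((p x ^+ 2 + q x ^+ 2) + (p (- x) ^+ 2 + q (- x) ^+ 2)).
  move=> hp hq; have [hp' np] := L2_reflect hp; have [hq' nq] := L2_reflect hq.
  rewrite RintegralD//; [|exact: integD hp.2 hq.2|exact: integD hp'.2 hq'.2].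
  rewrite !RintegralD//; [|exact: hp'.2|exact: hq'.2|exact: hp.2|exact: hq.2].
  by rewrite -!ip_sqr -!sqr_nrm np nq; ring.
apply: (@mulfI _ 2) => //; rewrite !key//; congr Rintegral; apply/funext => x.
by rewrite /mix1 /mix2 !opprK; field.
Qed.

Lemma mix_indic (O : R) a b : (fun w => \1_(~` seg O) w * mix1 a b w) =
    mix1 (fun w => \1_(~` seg O) w * a w) (fun w => \1_(~` seg O) w * b w) /\
  (fun w => \1_(~` seg O) w * mix2 a b w) =
    mix2 (fun w => \1_(~` seg O) w * a w) (fun w => \1_(~` seg O) w * b w).
Proof.
have e w : \1_(~` seg O) (- w) = \1_(~` seg O) w :> R.
  by rewrite !indicE !in_setC; congr (~~ _)%:R; apply/idP/idP; rewrite !inE /seg/= normrN.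
by split; apply/funext => w; rewrite /mix1 /mix2 e; field.
Qed.

Lemma sqnorm_lty_L2 a b : measurable_fun setT a -> measurable_fun setT b ->
  (sqnorm setT a b < +oo)%E -> L2 a /\ L2 b.
Proof.
move=> ma mb fin; have ms : measurable_fun setT (fun x => a x ^+ 2 + b x ^+ 2).
  by apply: measurable_funD; exact: measurable_funX.
have i : integ (fun x => a x ^+ 2 + b x ^+ 2).
  apply/integrableP; split; first exact/measurable_EFinP.
  by under eq_integral do rewrite gee0_abs ?lee_fin ?addr_ge0 ?sqr_ge0//.
split; split => //; (apply: (integ_le _ i); first exact: measurable_funX) => x;
  rewrite ger0_norm ?sqr_ge0//; [rewrite lerDl|rewrite lerDr]; exact: sqr_ge0.
Qed.

Lemma sqnormE (D : set R) a b : measurable D -> L2 a -> L2 b ->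
  sqnorm D a b = (nrm (fun x => \1_D x * a x) ^+ 2 + nrm (fun x => \1_D x * b x) ^+ 2)%:E.
Proof.
move=> mD ha hb; have hA := L2_indic mD ha; have hB := L2_indic mD hb.
rewrite !sqr_nrm !ip_sqr -RintegralD//; [|exact: hA.2|exact: hB.2].
rewrite -Rintegral_EFin; last exact: integD hA.2 hB.2.
rewrite /sqnorm integral_mkcond; apply: eq_integral => x _.
rewrite /patch !indicE; case: ifPn => _; rewrite ?mul1r// !mul0r expr0n/= addr0//.
Qed.

Lemma sqnormT a b : L2 a -> L2 b -> sqnorm setT a b = (nrm a ^+ 2 + nrm b ^+ 2)%:E.
Proof.
move=> ha hb; rewrite sqnormE//; congr (nrm _ ^+ 2 + nrm _ ^+ 2)%:E;
  by apply/funext => x; rewrite indicT mul1r.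
Qed.

Lemma trunc_FT_hartley fr fi (r : R) : L2 fr -> L2 fi ->
  let ur := fun t => \1_(seg r) t * fr t in let ui := fun t => \1_(seg r) t * fi t in
  trunc_FT_re fr fi r = mix2 (hartley ui) (hartley ur) /\ trunc_FT_im fr fi r = mix1 (hartley ui) (hartley ur).
Proof.
move=> hr hi ur ui.
have iu : integ ur by apply: (@supported_integ _ r); [apply: L2_indic => //; exact: measurable_seg|exact: indic_supported].
have ii : integ ui by apply: (@supported_integ _ r); [apply: L2_indic => //; exact: measurable_seg|exact: indic_supported].
have ic u w : integ u -> integ (fun t => u t * cos (t * w)).
  by move=> hu; apply: trig_integ => //; [exact: continuous_cos|exact: norm_cos].
have is_ u w : integ u -> integ (fun t => u t * sin (t * w)).
  by move=> hu; apply: trig_integ => //; [exact: continuous_sin|exact: norm_sin].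
pose c := (Num.sqrt (2 * pi))^-1 : R.
pose C u w := \int[mu]_t (u t * cos (t * w)); pose S u w := \int[mu]_t (u t * sin (t * w)).
have hE u w : integ u -> hartley u w = c * (C u w + S u w).
  move=> hu; rewrite /hartley -/c -RintegralD//; [|exact: ic|exact: is_].
  by congr (_ * _); congr Rintegral; apply/funext => t; rewrite /cas mulrDr.
have hNE u w : integ u -> hartley u (- w) = c * (C u w - S u w).
  move=> hu; rewrite /hartley -/c -RintegralB//; [|exact: ic|exact: is_].
  by congr (_ * _); congr Rintegral; apply/funext => t; rewrite /cas mulrN cosN sinN mulrDr mulrN.
split; apply/funext => w.
- rewrite /mix2 !hNE// !hE// /trunc_FT_re -/c -Rintegral_indic.
  rewrite (_ : (fun t => _) = fun t => ur t * cos (t * w) + ui t * sin (t * w)); last first.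
    by apply/funext => t; rewrite mulrDr !mulrA.
  by rewrite RintegralD//; [rewrite -/(C ur w) -/(S ui w); field|exact: ic|exact: is_].
- rewrite /mix1 !hNE// !hE// /trunc_FT_im -/c -Rintegral_indic.
  rewrite (_ : (fun t => _) = fun t => ui t * cos (t * w) - ur t * sin (t * w)); last first.
    by apply/funext => t; rewrite mulrBr !mulrA.
  by rewrite RintegralB//; [rewrite -/(C ui w) -/(S ur w); field|exact: ic|exact: is_].
Qed.

(** The Euclidean norm of the plane: it joins the estimates for [fr] and [fi] into one for
    [fr + i fi], and its triangle inequality keeps the constants. *)
Definition hyp2 (a b : R) := Num.sqrt (a ^+ 2 + b ^+ 2).

Lemma sqr_hyp2 (a b : R) : hyp2 a b ^+ 2 = a ^+ 2 + b ^+ 2.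
Proof. by rewrite sqr_sqrtr// addr_ge0 ?sqr_ge0. Qed.

Lemma hyp2_ge0 (a b : R) : 0 <= hyp2 a b. Proof. exact: sqrtr_ge0. Qed.

Lemma hyp2_le (a b c d : R) : 0 <= a -> 0 <= b -> a <= c -> b <= d -> hyp2 a b <= hyp2 c d.
Proof.
move=> a0 b0 ac bd; apply: ler_wsqrtr; apply: lerD; rewrite lerXn2r// nnegrE; lra.
Qed.

Lemma hyp2Z (k a b : R) : 0 <= k -> hyp2 (k * a) (k * b) = k * hyp2 a b.
Proof. by move=> k0; rewrite /hyp2 !exprMn -mulrDr sqrtrM ?sqr_ge0// sqrtr_sqr ger0_norm. Qed.

Lemma hyp2D (a b c d : R) : hyp2 (a + c) (b + d) <= hyp2 a b + hyp2 c d.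
Proof.
apply: sqr_le_le; first by rewrite addr_ge0 ?hyp2_ge0.
rewrite sqrrD !sqr_hyp2.
have : a * c + b * d <= hyp2 a b * hyp2 c d.
  apply: sqr_le_le; first by rewrite mulr_ge0 ?hyp2_ge0.
  rewrite exprMn !sqr_hyp2 -subr_ge0.
  rewrite (_ : _ - _ = (a * d - b * c) ^+ 2); [exact: sqr_ge0|ring].
move: (hyp2 a b) (hyp2 c d) => x y; nra.
Qed.
End Assembly.

(** * From the limit of truncated Fourier integrals to Hartley transforms *)

Section Limit.
Context {R : realType}.
Implicit Types (r : R).

(** The pair [mix1], [mix2] is linear and preserves the joint norm, so the convergence defining the
    Fourier transform becomes convergence of the truncated Hartley transforms of each component. *)
Lemma is_L2_fourier_hartley (fr fi gr gi : R -> R) : L2 fr -> L2 fi -> is_L2_fourier fr fi gr gi ->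
  [/\ L2 gr, L2 gi,
    nrm (fun w => mix1 gr gi w - hartley (fun x => \1_(seg r) x * fr x) w) @[r --> +oo] --> (0 : R) &
    nrm (fun w => mix2 gr gi w - hartley (fun x => \1_(seg r) x * fi x) w) @[r --> +oo] --> (0 : R)].
Proof.
move=> hr hi [mr mi /fine_cvgP[fin cv]].
have HU f r : 0 < r -> L2 f -> L2 (hartley (fun x => \1_(seg r) x * f x)).
  move=> r0 hf; apply: (hartley_L2_le r0 _ _).1; last exact: indic_supported.
  by apply: L2_indic => //; exact: measurable_seg.
have Lt r : 0 < r -> L2 (trunc_FT_re fr fi r) /\ L2 (trunc_FT_im fr fi r).
  move=> r0; have [-> ->] := trunc_FT_hartley r hr hi.
  by have [] := L2_mix (HU _ _ r0 hi) (HU _ _ r0 hr).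
(* Convergence to 0 in the extended reals makes some error norm finite; adding back the truncated
   transform, which is in L2, gives the claim. *)
have [Lgr Lgi] : L2 gr /\ L2 gi.
  have [r [r0 rf]] : exists r, 0 < r /\ sqnorm setT (fun w => gr w - trunc_FT_re fr fi r w)
      (fun w => gi w - trunc_FT_im fr fi r w) \is a fin_num.
    apply: (@filter_ex _ (+oo%R : set_system R)).
    by apply: (filterI _ fin); apply: nbhs_pinfty_gt; exact: num_real.
  have [L1 L2'] := Lt r r0.
  have [|||a b] := @sqnorm_lty_L2 R (fun w => gr w - trunc_FT_re fr fi r w) (fun w => gi w - trunc_FT_im fr fi r w).
  - exact: measurable_funB mr (measurable_L2 L1).
  - exact: measurable_funB mi (measurable_L2 L2').
  - by rewrite ltey_eq rf.
  split; [rewrite (_ : gr = fun w => (gr w - trunc_FT_re fr fi r w) + trunc_FT_re fr fi r w)|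
    rewrite (_ : gi = fun w => (gi w - trunc_FT_im fr fi r w) + trunc_FT_im fr fi r w)];
    try (by apply/funext => w; rewrite subrK); exact: L2D.
have key r : 0 < r -> nrm (fun w => mix1 gr gi w - hartley (fun x => \1_(seg r) x * fr x) w) ^+ 2 +
    nrm (fun w => mix2 gr gi w - hartley (fun x => \1_(seg r) x * fi x) w) ^+ 2 =
    fine (sqnorm setT (fun w => gr w - trunc_FT_re fr fi r w) (fun w => gi w - trunc_FT_im fr fi r w)).
  move=> r0; have [L1 L2'] := Lt r r0.
  rewrite (sqnormT (L2B Lgr L1) (L2B Lgi L2')) [RHS]/= -[RHS](nrm_mix (L2B Lgr L1) (L2B Lgi L2')).
  have [e1 e2] := trunc_FT_hartley r hr hi.
  congr (nrm _ ^+ 2 + nrm _ ^+ 2); apply/funext => w.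
  - by rewrite -[hartley (fun x => _ * fr x)](mix1K _ (hartley (fun x => \1_(seg r) x * fi x))) -e1 -e2 /mix1; field.
  - by rewrite -[hartley (fun x => _ * fi x)](mix2K (hartley (fun x => \1_(seg r) x * fr x))) -e1 -e2 /mix2; field.
have small eps : 0 < eps -> \forall r \near +oo%R,
    nrm (fun w => mix1 gr gi w - hartley (fun x => \1_(seg r) x * fr x) w) <= eps /\
    nrm (fun w => mix2 gr gi w - hartley (fun x => \1_(seg r) x * fi x) w) <= eps.
  move=> eps0; have /cvgrPdist_le /(_ _ (exprn_gt0 2 eps0)) cv' := cv.
  near=> r; have r0 : 0 < r by near: r; apply: nbhs_pinfty_gt; exact: num_real.
  have : `|0 - fine (sqnorm setT (fun w => gr w - trunc_FT_re fr fi r w)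
      (fun w => gi w - trunc_FT_im fr fi r w))| <= eps ^+ 2 by near: r; exact: cv'.
  rewrite sub0r normrN -(key _ r0); set p := nrm _; set q := nrm _; clearbody p q.
  have p0 : 0 <= p ^+ 2 by exact: sqr_ge0. have q0 : 0 <= q ^+ 2 by exact: sqr_ge0.
  move=> /(le_trans (ler_norm _)) le.
  by split; apply: (sqr_le_le (ltW eps0)); move: (p ^+ 2) (q ^+ 2) p0 q0 le => a b; lra.
have nr0 f : `|0 - nrm f| = nrm f :> R by rewrite sub0r normrN (ger0_norm (nrm_ge0 f)).
split; [exact: Lgr|exact: Lgi|apply/cvgrPdist_le => eps /small; apply: filterS => r [p q]..].
- by rewrite nr0; exact: p.
- by rewrite nr0; exact: q.
Unshelve. all: by end_near. Qed.
End Limit.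

(** * Numerical comparison of the rates and the theorem *)

Section Final.
Context {R : realType}.

(** Since [n >= 1], [sqrt (2 n + 1) <= 2 sqrt n], and [T >= 2] turns [T ^+ 2] into [T ^+ 3]. *)
Lemma rate_le (T : R) (n : nat) : 2 <= T -> 576 * T ^+ 6 <= n%:R ->
  5 / 4 * T ^+ 2 / Num.sqrt n%:R <= 34 * T ^+ 3 / Num.sqrt (2 * n%:R + 1).
Proof.
move=> T2 Tn; have T0 : 0 < T by lra.
have T60 : 0 < T ^+ 6 by exact: exprn_gt0.
have n0 : 0 < n%:R :> R by apply: lt_le_trans Tn; apply: mulr_gt0; [exact: ltr0n|exact: T60].
have n1 : 1 <= n%:R :> R by move: n0; rewrite ltr0n ler1n.
set r := Num.sqrt n%:R; have r0 : 0 < r by rewrite sqrtr_gt0.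
have rr : r ^+ 2 = n%:R by rewrite sqr_sqrtr// ltW.
have s0 : 0 < Num.sqrt (2 * n%:R + 1) :> R by rewrite sqrtr_gt0; lra.
have sr : Num.sqrt (2 * n%:R + 1) <= 2 * r.
  apply: sqr_le_le; first by apply: mulr_ge0; [exact: ler0n|exact: ltW].
  by rewrite sqr_sqrtr; [rewrite exprMn rr; lra|lra].
set s := Num.sqrt (2 * _ + 1) in s0 sr *; clearbody r s.
rewrite ler_pdivrMr// (mulrAC (34 * _)) ler_pdivlMr//.
have T20 : 0 < T ^+ 2 by exact: exprn_gt0.
apply: le_trans (_ : 5 / 4 * T ^+ 2 * (2 * r) <= _); first by rewrite ler_wpM2l//; lra.
have : T ^+ 2 * r * 2 <= T ^+ 2 * r * T by rewrite ler_pM2l// mulr_gt0.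
rewrite (_ : 34 * T ^+ 3 * r = 34 * (T ^+ 2 * r * T)); last ring.
have : 0 < T ^+ 2 * r by rewrite mulr_gt0.
rewrite (_ : 5 / 4 * T ^+ 2 * (2 * r) = 5 / 2 * (T ^+ 2 * r)); last by field.
lra.
Qed.

(** Here [2 n + 1 < 1152 T ^+ 6 + 1], which is below 1156 [T ^+ 6], the square of [34 T ^+ 3]. *)
Lemma rate_ge1 (T : R) (n : nat) : 2 <= T -> n%:R < 576 * T ^+ 6 ->
  1 <= 34 * T ^+ 3 / Num.sqrt (2 * n%:R + 1).
Proof.
move=> T2 Tn; have T0 : 0 < T by lra.
have n0 : 0 <= n%:R :> R by exact: ler0n.
have s0 : 0 < Num.sqrt (2 * n%:R + 1) :> R by rewrite sqrtr_gt0; lra.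
rewrite ler_pdivlMr// mul1r; apply: sqr_le_le.
  by apply: mulr_ge0; [exact: ler0n|apply: exprn_ge0; exact: ltW].
rewrite sqr_sqrtr; last lra.
have T4 : 4 <= T ^+ 2 by rewrite expr2 (_ : 4 = 2 * 2) ?ler_pM//; ring.
have T1 : 1 <= T ^+ 6 by apply: exprn_ege1; lra.
rewrite (_ : (34 * T ^+ 3) ^+ 2 = 1156 * T ^+ 6); last ring.
lra.
Qed.

Lemma nrm_indic_subset (D E : set R) (f : R -> R) : measurable D -> measurable E -> D `<=` E ->
  L2 f -> nrm (fun x => \1_D x * f x) <= nrm (fun x => \1_E x * f x).
Proof.
move=> mD mE DE hf; apply: nrm_le; [exact: L2_indic|exact: L2_indic|] => x.
rewrite !normrM; apply: ler_wpM2r => //; rewrite !indicE.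
have [xD|xD] := boolP (x \in D); last by rewrite normr0.
by rewrite mem_set//; apply: DE; rewrite -in_setE.
Qed.

Lemma setC_segE (T : R) : [set t | T < `|t|] = ~` seg T.
Proof. by apply/seteqP; split => x; rewrite /seg/= ltNge => /negP. Qed.
End Final.

Theorem theorem1 (R : realType) (Omega0 T0 epsT epsO : R)
  (fr fi gr gi : R -> R) (T : R) (n : nat) :
  2 <= Omega0 -> 2 <= T0 -> 0 < epsT -> 0 < epsO ->
  inL2 fr fi ->
  is_L2_fourier fr fi gr gi ->
  (sqnorm [set t | (T0 < `|t|)%R] fr fi <= (epsT ^+ 2 * L2norm setT fr fi ^+ 2)%:E)%E ->
  (sqnorm [set w | (Omega0 < `|w|)%R] gr gi <= (epsO ^+ 2 * L2norm setT fr fi ^+ 2)%:E)%E ->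
  T0 <= T ->
  2 * T ^+ 2 <= n%:R -> 2 * Omega0 ^+ 2 <= n%:R ->
  L2norm [set t | `|t| <= T] (fun t => fr t - Kproj n fr t)
                             (fun t => fi t - Kproj n fi t)
  <= (2 * epsT + epsO + 34 * T ^+ 3 / Num.sqrt (2 * n%:R + 1)) * L2norm setT fr fi.
Proof.
move=> O2 T02 eT0 eO0 [mr mi ffin] four hT hO TT Tn On.
have [hr hi] := sqnorm_lty_L2 mr mi ffin.
have [Lgr Lgi cr ci] := is_L2_fourier_hartley hr hi four.
have [LA LB] := L2_mix Lgr Lgi.
have T2 : 2 <= T by exact: le_trans TT.
have mo := @measurable_out R; have ms := @measurable_seg R.
have oh : is_orthonormal n.+1 (@hermite_fun R) by exact: orthonormal_hermite.
have dL f : L2 f -> L2 (fun t => f t - fproj n.+1 (@hermite_fun R) f t).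
  by move=> hf; apply: L2B => //; exact: L2_fproj.
pose d f := nrm (fun x => \1_(seg T) x * (f x - fproj n.+1 (@hermite_fun R) f x)).
have -> : L2norm [set t | `|t| <= T] (fun t => fr t - Kproj n fr t) (fun t => fi t - Kproj n fi t) =
    hyp2 (d fr) (d fi).
  by rewrite /L2norm (sqnormE (ms T) (dL _ hr) (dL _ hi)).
have NE : L2norm setT fr fi = hyp2 (nrm fr) (nrm fi) by rewrite /L2norm sqnormT.
move: hT hO; rewrite NE.
rewrite (setC_segE T0) (setC_segE Omega0) (sqnormE (mo T0) hr hi) (sqnormE (mo Omega0) Lgr Lgi) !lee_fin.
set N := hyp2 (nrm fr) (nrm fi) => hT hO.
have N0 : 0 <= N by exact: hyp2_ge0.
have [Tsmall|Tlarge] := ltP n%:R (576 * T ^+ 6).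
  apply: le_trans (_ : N <= _).
    apply: hyp2_le; try exact: nrm_ge0.
    - exact: le_trans (nrm_indic_le (ms T) (dL _ hr)) (nrm_sub_fproj_le oh hr).
    - exact: le_trans (nrm_indic_le (ms T) (dL _ hi)) (nrm_sub_fproj_le oh hi).
  rewrite -[leLHS]mul1r; apply: ler_wpM2r => //.
  have := rate_ge1 T2 Tsmall; move: (34 * _ / _) => c; lra.
have O0 : 0 <= Omega0 by lra.
have br := real_bound T2 hr LA cr Tlarge On O0.
have bi := real_bound T2 hi LB ci Tlarge On O0.
set del := 34 * T ^+ 3 / _.
have del0 : 0 <= del.
  by apply: divr_ge0; [apply: mulr_ge0; [exact: ler0n|apply: exprn_ge0; exact: le_trans (ler0n R 2) T2]|exact: sqrtr_ge0].
(* The real bounds see the part of [f] beyond [T], the hypothesis the larger part beyond [T0]. *)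
have sub : ~` seg T `<=` ~` seg T0.
  by move=> x; rewrite -!setC_segE/= => /(le_lt_trans TT).
have o1 := nrm_indic_subset (mo T) (mo T0) sub hr.
have o2 := nrm_indic_subset (mo T) (mo T0) sub hi.
have dl := rate_le T2 Tlarge; rewrite -/del in dl.
pose a f := nrm (fun x => \1_(~` seg T0) x * f x).
pose b g := nrm (fun x => \1_(~` seg Omega0) x * g x).
have kr : d fr <= 2 * a fr + b (mix1 gr gi) + del * nrm fr.
  apply: (le_trans br); apply: lerD; last by apply: ler_wpM2r dl; exact: nrm_ge0.
  by rewrite lerD2r ler_pM2l.
have ki : d fi <= 2 * a fi + b (mix2 gr gi) + del * nrm fi.
  apply: (le_trans bi); apply: lerD; last by apply: ler_wpM2r dl; exact: nrm_ge0.
  by rewrite lerD2r ler_pM2l.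
have ha : hyp2 (a fr) (a fi) <= epsT * N.
  by apply: sqr_le_le; [apply: mulr_ge0 => //; exact: ltW|rewrite sqr_hyp2 exprMn].
(* The indicator is even, hence commutes with [mix1] and [mix2]; their joint isometry identifies the
   Hartley tails with the Fourier tail of the hypothesis. *)
have hb : hyp2 (b (mix1 gr gi)) (b (mix2 gr gi)) <= epsO * N.
  apply: sqr_le_le; first by apply: mulr_ge0 => //; exact: ltW.
  have [e1 e2] := mix_indic Omega0 gr gi.
  by rewrite sqr_hyp2 exprMn /b e1 e2 nrm_mix//; exact: L2_indic.
(* Minkowski's inequality for the planar vectors formed by the three terms of [kr] and [ki]. *)
apply: (le_trans (hyp2_le (nrm_ge0 _) (nrm_ge0 _) kr ki)).
apply: (le_trans (hyp2D _ _ _ _)); rewrite (hyp2Z _ _ del0) (mulrDl (2 * epsT + epsO)) -/N lerD2r.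
apply: (le_trans (hyp2D _ _ _ _)); rewrite (hyp2Z _ _ (ler0n R 2)) (mulrDl (2 * epsT)).
by apply: (lerD _ hb); rewrite -mulrA ler_pM2l.
Qed.
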